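(* Let $f(q)=q+\sum_{n=2}^{+\infty}q^{n}a_{n}\in\mathcal{S}^{*}$ (with $a_n\in\mathbb{H}$). Then $|a_{n}|\leq n$ for all $n=2,3,\ldots$. Moreover, equality $|a_{n}|=n$ for a given $n\geq 2$ holds if and only if $$f(q)=q(1-qu)^{-\ast 2},\qquad \forall\, q\in\mathbb{B},$$ for some $u\in\partial\mathbb{B}$.
   Context: $\mathbb{H}$ denotes the quaternions, $\mathbb{B}=\{q\in\mathbb{H}:|q|<1\}$, $\mathbb{S}=\{q\in\mathbb{H}:q^2=-1\}$; for $I\in\mathbb{S}$, $\mathbb{C}_I=\mathbb{R}\oplus I\mathbb{R}$ and $\mathbb{B}_I=\mathbb{B}\cap\mathbb{C}_I$. A function $f:\mathbb{B}\to\mathbb{H}$ is (left) slice regular if for every $I\in\mathbb{S}$ the restriction $f_I=f|_{\mathbb{B}_I}$ has continuous partial derivatives and $\frac12\left(\frac{\partial}{\partial x}+I\frac{\partial}{\partial y}\right)f_I(x+yI)=0$ on $\mathbb{B}_I$; equivalently $f(q)=\sum_{n\ge0}q^na_n$ on $\mathbb{B}$ with $a_n\in\mathbb{H}$. Its slice derivative is $f'(x+yI)=\frac12\left(\frac{\partial}{\partial x}-I\frac{\partial}{\partial y}\right)f_I(x+yI)$, i.e. $f'(q)=\sum_{n\ge1}q^{n-1}na_n$. For slice regular $f=\sum q^na_n$, $g=\sum q^nb_n$ on $\mathbb{B}$: the regular product is $f\ast g(q)=\sum_n q^n\sum_{k=0}^n a_kb_{n-k}$; the regular conjugate is $f^c(q)=\sum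 q^n\overline{a_n}$; the symmetrization is $f^s=f\ast f^c$; the regular reciprocal is $f^{-\ast}(q)=f^s(q)^{-1}f^c(q)$ off the zero set of $f^s$. $(1-qu)^{-\ast2}$ denotes $(1-qu)^{-\ast}\ast(1-qu)^{-\ast}$, so that $q(1-qu)^{-\ast2}=\sum_{n\ge1}n\,q^nu^{n-1}$. $\mathcal{S}$ is the set of slice regular $f:\mathbb{B}\to\mathbb{H}$ whose zero set is $\mathcal{Z}_f=\{0\}$ and with $f'(0)=1$. The class of slice starlike functions $\mathcal{S}^{*}$ is the set of $f\in\mathcal{S}$ such that $\mathrm{Re}\big(f(q)^{-1}qf'(q)\big)>0$ for $q\in\mathbb{B}$ (pointwise products; at $q=0$ the expression is understood as its limit value $1$). *)

(* Defs.v *)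
From Stdlib Require Import Reals Lra Lia ClassicalEpsilon FunctionalExtensionality.
From Coquelicot Require Import Coquelicot.
Open Scope R_scope.

(* [(a, b, c, d)] stands for a + b i + c j + d k. *)
Definition H : Type := (R * R * R * R)%type.

Definition hre (q : H) : R := fst (fst (fst q)).
Definition him1 (q : H) : R := snd (fst (fst q)).
Definition him2 (q : H) : R := snd (fst q).
Definition him3 (q : H) : R := snd q.

Definition RtoH (x : R) : H := (x, 0, 0, 0).

Definition Hplus (p q : H) : H :=
  (hre p + hre q, him1 p + him1 q, him2 p + him2 q, him3 p + him3 q).
Definition Hopp (q : H) : H := (- hre q, - him1 q, - him2 q, - him3 q).
Definition Hmult (p q : H) : H :=
  (hre p * hre q - him1 p * him1 q - him2 p * him2 q - him3 p * him3 q,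
   hre p * him1 q + him1 p * hre q + him2 p * him3 q - him3 p * him2 q,
   hre p * him2 q - him1 p * him3 q + him2 p * hre q + him3 p * him1 q,
   hre p * him3 q + him1 p * him2 q - him2 p * him1 q + him3 p * hre q).
Definition Hconj (q : H) : H := (hre q, - him1 q, - him2 q, - him3 q).
Definition Hnorm2 (q : H) : R :=
  hre q ^ 2 + him1 q ^ 2 + him2 q ^ 2 + him3 q ^ 2.
Definition Hmod (q : H) : R := sqrt (Hnorm2 q).
Definition Hinv (q : H) : H := Hmult (RtoH (/ Hnorm2 q)) (Hconj q).

Declare Scope quat_scope.
Delimit Scope quat_scope with H.
Bind Scope quat_scope with H.
Notation "p + q" := (Hplus p q) : quat_scope.
Notation "- q" := (Hopp q) : quat_scope.
Notation "p - q" := (Hplus p (Hopp q)) : quat_scope.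
Notation "p * q" := (Hmult p q) : quat_scope.
Notation "/ q" := (Hinv q) : quat_scope.

(* With H an absolute-valued ring acting on itself by left multiplication,
   [is_pseries a q l] says that the sum over n of q^n a_n is l. *)

Lemma H_ext (p q : H) :
  hre p = hre q -> him1 p = him1 q -> him2 p = him2 q -> him3 p = him3 q ->
  p = q.
Proof.
destruct p as [[[? ?] ?] ?], q as [[[? ?] ?] ?]; cbn; intros; subst; easy.
Qed.

Ltac hred := unfold RtoH, Hplus, Hopp, Hmult, Hconj, Hnorm2, hre, him1, him2, him3; cbn [fst snd].
Ltac hring := intros; apply H_ext; hred; ring.

Lemma Hplus_comm p q : Hplus p q = Hplus q p. Proof. hring. Qed.
Lemma Hplus_assoc p q r : Hplus p (Hplus q r) = Hplus (Hplus p q) r.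
Proof. hring. Qed.
Lemma Hplus_0_r q : Hplus q (RtoH 0) = q. Proof. hring. Qed.
Lemma Hplus_opp_r q : Hplus q (Hopp q) = RtoH 0. Proof. hring. Qed.
Lemma Hmult_assoc p q r : Hmult p (Hmult q r) = Hmult (Hmult p q) r.
Proof. hring. Qed.
Lemma Hmult_1_r q : Hmult q (RtoH 1) = q. Proof. hring. Qed.
Lemma Hmult_1_l q : Hmult (RtoH 1) q = q. Proof. hring. Qed.
Lemma Hmult_plus_l p q r : Hmult (Hplus p q) r = Hplus (Hmult p r) (Hmult q r).
Proof. hring. Qed.
Lemma Hmult_plus_r p q r : Hmult p (Hplus q r) = Hplus (Hmult p q) (Hmult p r).
Proof. hring. Qed.

Definition H_AbelianMonoid_mixin :=
  AbelianMonoid.Mixin H Hplus (RtoH 0) Hplus_comm Hplus_assoc Hplus_0_r.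
Canonical H_AbelianMonoid := AbelianMonoid.Pack H H_AbelianMonoid_mixin H.
Definition H_AbelianGroup_mixin :=
  AbelianGroup.Mixin H_AbelianMonoid Hopp Hplus_opp_r.
Canonical H_AbelianGroup :=
  AbelianGroup.Pack H (AbelianGroup.Class _ _ H_AbelianGroup_mixin) H.
Definition H_Ring_mixin :=
  Ring.Mixin H_AbelianGroup Hmult (RtoH 1) Hmult_assoc Hmult_1_r Hmult_1_l
    Hmult_plus_l Hmult_plus_r.
Canonical H_Ring := Ring.Pack H (Ring.Class _ _ H_Ring_mixin) H.

Lemma Hnorm2_ge0 q : 0 <= Hnorm2 q.
Proof. unfold Hnorm2; nra. Qed.

Lemma Hmod_0 : Hmod (RtoH 0) = 0.
Proof.
unfold Hmod; replace (Hnorm2 (RtoH 0)) with 0 by (hred; ring).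
exact sqrt_0.
Qed.

Lemma Hmod_opp1 : Hmod (Hopp (RtoH 1)) = 1.
Proof.
unfold Hmod; replace (Hnorm2 (Hopp (RtoH 1))) with 1 by (hred; ring).
exact sqrt_1.
Qed.

Lemma Hmod_mult p q : Hmod (Hmult p q) = Hmod p * Hmod q.
Proof.
unfold Hmod; rewrite <- sqrt_mult by apply Hnorm2_ge0.
f_equal; hred; ring.
Qed.

Lemma Hmod_triangle p q : Hmod (Hplus p q) <= Hmod p + Hmod q.
Proof.
assert (Hp := sqrt_pos (Hnorm2 p)); assert (Hq := sqrt_pos (Hnorm2 q)).
apply Rsqr_incr_0_var; [|unfold Hmod; lra].
unfold Rsqr, Hmod.
rewrite sqrt_sqrt by apply Hnorm2_ge0.
replace ((sqrt (Hnorm2 p) + sqrt (Hnorm2 q)) *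
         (sqrt (Hnorm2 p) + sqrt (Hnorm2 q)))
  with (sqrt (Hnorm2 p) * sqrt (Hnorm2 p) + sqrt (Hnorm2 q) * sqrt (Hnorm2 q)
        + 2 * (sqrt (Hnorm2 p) * sqrt (Hnorm2 q))) by ring.
rewrite !sqrt_sqrt by apply Hnorm2_ge0.
rewrite <- sqrt_mult by apply Hnorm2_ge0.
set (s := hre p * hre q + him1 p * him1 q + him2 p * him2 q + him3 p * him3 q).
assert (Hs : s <= sqrt (Hnorm2 p * Hnorm2 q)).
{ apply Rle_trans with (Rabs s); [apply Rle_abs|].
  rewrite <- sqrt_Rsqr_abs; apply sqrt_le_1_alt; unfold Rsqr.
  assert (E : Hnorm2 p * Hnorm2 q - s * s =
    (hre p * him1 q - him1 p * hre q) ^ 2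
    + (hre p * him2 q - him2 p * hre q) ^ 2
    + (hre p * him3 q - him3 p * hre q) ^ 2
    + (him1 p * him2 q - him2 p * him1 q) ^ 2
    + (him1 p * him3 q - him3 p * him1 q) ^ 2
    + (him2 p * him3 q - him3 p * him2 q) ^ 2)
    by (unfold s; hred; ring).
  repeat match type of E with context [?x ^ 2] =>
    assert (0 <= x ^ 2) by apply pow2_ge_0;
    generalize dependent (x ^ 2); intros end.
  lra. }
replace (Hnorm2 (Hplus p q)) with (Hnorm2 p + Hnorm2 q + 2 * s)
  by (unfold s; hred; ring).
lra.
Qed.

Lemma Hmod_eq0 q : Hmod q = 0 -> q = RtoH 0.
Proof.
intros E; apply sqrt_eq_0 in E; [|apply Hnorm2_ge0].
destruct q as [[[a b] c] d]; unfold Hnorm2, hre, him1, him2, him3 in E.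
cbn [fst snd] in E; apply H_ext; hred; nra.
Qed.

Definition H_AbsRing_mixin :=
  AbsRing.Mixin H_Ring Hmod Hmod_0 Hmod_opp1 Hmod_triangle
    (fun p q => Req_le _ _ (Hmod_mult p q)) Hmod_eq0.
Canonical H_AbsRing := AbsRing.Pack H (AbsRing.Class _ _ H_AbsRing_mixin) H.
Canonical H_UniformSpace :=
  UniformSpace.Pack H (UniformSpace.class (AbsRing_UniformSpace H_AbsRing)) H.
Canonical H_ModuleSpace :=
  ModuleSpace.Pack H_Ring H (ModuleSpace.class _ (Ring_ModuleSpace H_Ring)) H.
Canonical H_NormedModuleAux :=
  NormedModuleAux.Pack H_AbsRing H
    (NormedModuleAux.class _
      (NormedModule.NormedModuleAux _ (AbsRing_NormedModule H_AbsRing))) H.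
Canonical H_NormedModule :=
  NormedModule.Pack H_AbsRing H
    (NormedModule.class _ (AbsRing_NormedModule H_AbsRing)) H.

Definition Hex_derive (g : R -> H) (t : R) : Prop :=
  ex_derive (fun s => hre (g s)) t /\ ex_derive (fun s => him1 (g s)) t /\
  ex_derive (fun s => him2 (g s)) t /\ ex_derive (fun s => him3 (g s)) t.

Definition HDerive (g : R -> H) (t : R) : H :=
  (Derive (fun s => hre (g s)) t, Derive (fun s => him1 (g s)) t,
   Derive (fun s => him2 (g s)) t, Derive (fun s => him3 (g s)) t).

Definition HSeries (u : nat -> H) : H :=
  (Series (fun n => hre (u n)), Series (fun n => him1 (u n)),
   Series (fun n => him2 (u n)), Series (fun n => him3 (u n))).

Definition HPSeries (a : nat -> H) (q : H) : H :=
  HSeries (fun n => Hmult (pow_n q n) (a n)).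

(* A function on the ball is represented by a total function H -> H whose values
   off the ball are irrelevant. *)
Definition in_ball (q : H) : Prop := Hmod q < 1.

Definition imag_unit (I : H) : Prop := Hmult I I = RtoH (-1).

Definition slice_pt (I : H) (x y : R) : H := (RtoH x + RtoH y * I)%H.

Definition slice_dx (f : H -> H) (I : H) (x y : R) : H :=
  HDerive (fun t => f (slice_pt I t y)) x.
Definition slice_dy (f : H -> H) (I : H) (x y : R) : H :=
  HDerive (fun t => f (slice_pt I x t)) y.

Definition slice_regular (f : H -> H) : Prop :=
  forall I, imag_unit I -> forall x y, in_ball (slice_pt I x y) ->
    Hex_derive (fun t => f (slice_pt I t y)) x /\
    Hex_derive (fun t => f (slice_pt I x t)) y /\
    continuous (fun p : R * R => slice_dx f I (fst p) (snd p)) (x, y) /\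
    continuous (fun p : R * R => slice_dy f I (fst p) (snd p)) (x, y) /\
    (RtoH (1 / 2) * (slice_dx f I x y + I * slice_dy f I x y))%H = RtoH 0.

Definition Him_mod (q : H) : R :=
  sqrt (him1 q ^ 2 + him2 q ^ 2 + him3 q ^ 2).

(* An imaginary unit I with q = Re q + |Im q| I: unique unless q is real, in
   which case i is taken. *)
Definition axis (q : H) : H :=
  if Req_EM_T (Him_mod q) 0 then (0, 1, 0, 0)
  else (0, him1 q / Him_mod q, him2 q / Him_mod q, him3 q / Him_mod q).

(* For slice regular f this agrees with (1/2)(d/dx - I d/dy) f_I (x + y I)
   for every representation q = x + y I: see [slice_derivE]. *)
Definition slice_deriv (f : H -> H) (q : H) : H :=
  let I := axis q in let x := hre q in let y := Him_mod q in
  (RtoH (1 / 2) * (slice_dx f I x y - I * slice_dy f I x y))%H.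

Lemma imag_unitP I : imag_unit I ->
  hre I = 0 /\ him1 I ^ 2 + him2 I ^ 2 + him3 I ^ 2 = 1.
Proof.
intros E.
destruct I as [[[a b] c] d].
assert (E0 := f_equal hre E); assert (E1 := f_equal him1 E);
assert (E2 := f_equal him2 E); assert (E3 := f_equal him3 E).
unfold RtoH, Hmult, hre, him1, him2, him3 in *; cbn [fst snd] in *.
assert (Ha : a = 0).
{ destruct (Req_dec a 0) as [|N]; [easy|exfalso].
  assert (b = 0) by (apply Rmult_eq_reg_l with (2 * a); lra).
  assert (c = 0) by (apply Rmult_eq_reg_l with (2 * a); lra).
  assert (d = 0) by (apply Rmult_eq_reg_l with (2 * a); lra).
  nra. }
split; [easy|]. rewrite Ha in E0; lra.
Qed.

Lemma slice_derivE f I x y :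
  slice_regular f -> imag_unit I -> in_ball (slice_pt I x y) ->
  slice_deriv f (slice_pt I x y) =
    (RtoH (1 / 2) * (slice_dx f I x y - I * slice_dy f I x y))%H.
Proof.
intros Hf HI Hb.
destruct (imag_unitP I HI) as [Hr Hn].
assert (Hx : hre (slice_pt I x y) = x).
{ unfold slice_pt; hred; change (fst (fst (fst I))) with (hre I).
  rewrite Hr; ring. }
assert (Hy : Him_mod (slice_pt I x y) = Rabs y).
{ unfold Him_mod; rewrite <- sqrt_Rsqr_abs; f_equal; unfold Rsqr.
  transitivity (y * y * (him1 I ^ 2 + him2 I ^ 2 + him3 I ^ 2));
    [unfold slice_pt; hred; ring|rewrite Hn; ring]. }
unfold slice_deriv; cbv zeta; rewrite Hx, Hy.
destruct (Req_dec y 0) as [->|Ny].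
- rewrite Rabs_R0.
  assert (HA : axis (slice_pt I x 0) = (0, 1, 0, 0)).
  { unfold axis; rewrite Hy, Rabs_R0; destruct (Req_EM_T 0 0); easy. }
  rewrite HA.
  assert (Hi : imag_unit (0, 1, 0, 0)) by (unfold imag_unit; hring).
  assert (Hs : forall J t, slice_pt J t 0 = RtoH t) by (unfold slice_pt; hring).
  assert (Hd : forall J, slice_dx f J x 0 = HDerive (fun t => f (RtoH t)) x).
  { intros J; unfold slice_dx; f_equal; apply functional_extensionality.
    intros t; now rewrite Hs. }
  assert (key : forall J, imag_unit J ->
    (RtoH (1 / 2) * (slice_dx f J x 0 - J * slice_dy f J x 0))%H =
    slice_dx f J x 0).
  { intros J HJ.
    assert (Hb' : in_ball (slice_pt J x 0)).
    { rewrite Hs; rewrite Hs in Hb; exact Hb. }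
    destruct (Hf J HJ x 0 Hb') as (_ & _ & _ & _ & E).
    revert E; generalize (slice_dx f J x 0), (J * slice_dy f J x 0)%H.
    intros d e E.
    assert (E0 := f_equal hre E); assert (E1 := f_equal him1 E);
    assert (E2 := f_equal him2 E); assert (E3 := f_equal him3 E).
    unfold RtoH, Hplus, Hmult, hre, him1, him2, him3 in E0, E1, E2, E3.
    cbn [fst snd] in E0, E1, E2, E3.
    apply H_ext; hred; lra. }
  rewrite !key by easy. now rewrite !Hd.
- assert (HA : axis (slice_pt I x y) = (RtoH (y / Rabs y) * I)%H).
  { unfold axis; rewrite Hy; destruct (Req_EM_T (Rabs y) 0) as [E|N].
    - now apply Rabs_no_R0 in Ny.
    - unfold slice_pt; apply H_ext; hred;
        change (fst (fst (fst I))) with (hre I); rewrite Hr; field; easy. }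
  rewrite HA; destruct (Rcase_abs y) as [Hneg|Hpos].
  + rewrite (Rabs_left y) by easy.
    replace (y / - y) with (-1) by (field; easy).
    assert (Hs : forall s t, slice_pt (RtoH (-1) * I)%H s (- t) = slice_pt I s t)
      by (unfold slice_pt; hring).
    assert (Hs' : forall s t, slice_pt (RtoH (-1) * I)%H s t = slice_pt I s (- t))
      by (unfold slice_pt; hring).
    assert (Dx : slice_dx f (RtoH (-1) * I)%H x (- y) = slice_dx f I x y).
    { unfold slice_dx; f_equal; apply functional_extensionality.
      intros t; now rewrite Hs. }
    assert (Dy : slice_dy f (RtoH (-1) * I)%H x (- y) =
                 (RtoH (-1) * slice_dy f I x y)%H).
    { unfold slice_dy.
      transitivity (HDerive (fun t => f (slice_pt I x (- t))) (- y)).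
      { f_equal; apply functional_extensionality; intros t; now rewrite Hs'. }
      destruct (Hf I HI x y Hb) as (_ & (D0 & D1 & D2 & D3) & _).
      assert (chain : forall g : R -> R, ex_derive g y ->
                Derive (fun t => g (- t)) (- y) = - Derive g y).
      { intros g Dg. rewrite (Derive_comp g (fun t => - t)).
        - rewrite Derive_opp, Derive_id, Ropp_involutive; ring.
        - now rewrite Ropp_involutive.
        - apply (ex_derive_opp (fun t : R => t)), ex_derive_id. }
      unfold HDerive.
      rewrite (chain (fun t => hre (f (slice_pt I x t))) D0),
        (chain (fun t => him1 (f (slice_pt I x t))) D1),
        (chain (fun t => him2 (f (slice_pt I x t))) D2),
        (chain (fun t => him3 (f (slice_pt I x t))) D3).
      hring. }
    rewrite Dx, Dy; hring.
  + rewrite (Rabs_right y) by easy.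
    replace (y / y) with 1 by (field; easy).
    now rewrite Hmult_1_l.
Qed.

Definition has_expansion (f : H -> H) (a : nat -> H) : Prop :=
  forall q, in_ball q -> is_pseries a q (f q).

Lemma Hcomp_le_mod q :
  Rabs (hre q) <= Hmod q /\ Rabs (him1 q) <= Hmod q /\
  Rabs (him2 q) <= Hmod q /\ Rabs (him3 q) <= Hmod q.
Proof.
assert (key : forall x, x ^ 2 <= Hnorm2 q -> Rabs x <= Hmod q).
{ intros x Hx; rewrite <- sqrt_Rsqr_abs; apply sqrt_le_1_alt.
  unfold Rsqr; lra. }
repeat split; apply key; unfold Hnorm2; nra.
Qed.

Lemma is_pseries_comp (pr : H -> R) (a : nat -> H) (t : R) (l : H) :
  (forall p q, pr (p + q)%H = pr p + pr q) ->
  (forall x q, pr (RtoH x * q)%H = x * pr q) ->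
  (forall q, Rabs (pr q) <= Hmod q) ->
  is_pseries a (RtoH t) l -> is_pseries (fun n => pr (a n)) t (pr l).
Proof.
intros prD prZ prle Hl.
assert (prB : forall p q, pr (p - q)%H = pr p - pr q).
{ intros p q; replace (- q)%H with (RtoH (-1) * q)%H by hring.
  rewrite prD, prZ; ring. }
assert (Hpow : forall n, pow_n (RtoH t) n = RtoH (pow_n t n)).
{ induction n as [|n IH]; [easy|].
  cbn [pow_n]; rewrite IH; apply H_ext; cbn; unfold mult; cbn; ring. }
apply filterlim_locally; intros eps.
generalize (proj1 (filterlim_locally _ _) Hl eps).
apply filter_imp; intros n Hn.
set (u := sum_n (fun k => scal (pow_n (RtoH t) k) (a k)) n) in *.
change (Hmod (u - l)%H < eps) in Hn.
assert (Hu : sum_n (fun k => scal (pow_n t k) (pr (a k))) n = pr u).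
2: { change (Rabs (sum_n (fun k => scal (pow_n t k) (pr (a k))) n - pr l) < eps).
  rewrite Hu, <- prB; eapply Rle_lt_trans; [apply prle|exact Hn]. }
unfold u; clear u Hn; induction n as [|n IH].
- rewrite !sum_O, Hpow; symmetry; apply prZ.
- rewrite !sum_Sn, IH, Hpow.
  generalize (sum_n (fun k => scal (pow_n (RtoH t) k) (a k)) n); intros v.
  change (pr v + pow_n t (S n) * pr (a (S n)) =
    pr (v + RtoH (pow_n t (S n)) * a (S n))%H).
  now rewrite prD, prZ.
Qed.

Lemma CV_radius_half (a : nat -> R) :
  ex_pseries a (1 / 2) -> Rbar_lt 0 (CV_radius a).
Proof.
intros Ha; apply Rbar_lt_le_trans with (Finite (1 / 2)); [cbn; lra|].
apply Rbar_not_lt_le; intros Hlt.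
apply (CV_disk_outside a (1 / 2)).
- now rewrite Rabs_pos_eq by lra.
- apply ex_series_lim_0; revert Ha; apply ex_series_ext.
  intros n; rewrite pow_n_pow; unfold scal; cbn; unfold mult; cbn; ring.
Qed.

Lemma has_expansion_unique (f : H -> H) (a b : nat -> H) :
  has_expansion f a -> has_expansion f b -> a = b.
Proof.
intros Ha Hb.
assert (key : forall pr : H -> R,
  (forall p q, pr (p + q)%H = pr p + pr q) ->
  (forall x q, pr (RtoH x * q)%H = x * pr q) ->
  (forall q, Rabs (pr q) <= Hmod q) -> forall n, pr (a n) = pr (b n)).
{ intros pr prD prZ prle n.
  assert (HB : forall t, Rabs t < 1 -> in_ball (RtoH t)).
  { intros t Ht; unfold in_ball, Hmod.
    replace (Hnorm2 (RtoH t)) with (Rsqr t) by (unfold Rsqr; hred; ring).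
    now rewrite sqrt_Rsqr_abs. }
  assert (A : forall t, Rabs t < 1 ->
    is_pseries (fun n => pr (a n)) t (pr (f (RtoH t))))
    by (intros t Ht; apply is_pseries_comp; auto).
  assert (B : forall t, Rabs t < 1 ->
    is_pseries (fun n => pr (b n)) t (pr (f (RtoH t))))
    by (intros t Ht; apply is_pseries_comp; auto).
  assert (Hh : Rabs (1 / 2) < 1) by (rewrite Rabs_pos_eq; lra).
  apply (PSeries_ext_recip (fun n => pr (a n)) (fun n => pr (b n))).
  - apply CV_radius_half; eexists; apply A, Hh.
  - apply CV_radius_half; eexists; apply B, Hh.
  - exists (mkposreal 1 Rlt_0_1); intros t Ht.
    assert (Ht' : Rabs t < 1).
    { cbn in Ht; unfold AbsRing_ball, minus, plus, opp in Ht; cbn in Ht.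
      now rewrite Ropp_0, Rplus_0_r in Ht. }
    now rewrite (is_pseries_unique _ _ _ (A t Ht')),
      (is_pseries_unique _ _ _ (B t Ht')). }
apply functional_extensionality; intros n.
apply H_ext; apply key; intros; try apply Hcomp_le_mod; hred; ring.
Qed.

(* The coefficients a_n in f(q) = sum q^n a_n on the ball, for slice regular f;
   they are unique by [has_expansion_unique]. *)
Definition coef (f : H -> H) : nat -> H :=
  epsilon (inhabits (fun _ : nat => RtoH 0)) (has_expansion f).

Lemma coefE (f : H -> H) (a : nat -> H) : has_expansion f a -> coef f = a.
Proof.
intros Ha; apply (has_expansion_unique f); [|easy].
unfold coef; apply epsilon_spec; now exists a.
Qed.

Definition reg_mult (f g : H -> H) (q : H) : H :=
  HPSeries (fun n => sum_n (fun k => Hmult (coef f k) (coef g (n - k))) n) q.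

Definition reg_conj (f : H -> H) (q : H) : H :=
  HPSeries (fun n => Hconj (coef f n)) q.

Definition symmetrization (f : H -> H) : H -> H := reg_mult f (reg_conj f).

(* f^s(q)^-1 f^c(q) as a pointwise product; meaningful only off the zero set
   of the symmetrization. *)
Definition reg_recip (f : H -> H) (q : H) : H :=
  (/ symmetrization f q * reg_conj f q)%H.

Definition class_S (f : H -> H) : Prop :=
  slice_regular f /\
  (forall q, in_ball q -> (f q = RtoH 0 <-> q = RtoH 0)) /\
  slice_deriv f (RtoH 0) = RtoH 1.

(* At q = 0 the expression f(q)^-1 q f'(q) has the limit value 1, whose real
   part is positive, so only q <> 0 carries a condition. *)
Definition slice_starlike (f : H -> H) : Prop :=
  class_S f /\
  forall q, in_ball q -> q <> RtoH 0 ->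
    0 < hre (/ f q * q * slice_deriv f q)%H.

(* q (1 - q u)^{-*2}; left multiplication by q is the same for the pointwise
   and the regular product. *)
Definition slice_koebe (u q : H) : H :=
  let r := reg_recip (fun p => (RtoH 1 - p * u)%H) in
  (q * reg_mult r r q)%H.

(* Main.v *)
(** The regular quotient p = f^{-*} * (q f') is a power series 1 + sum q^n p_n,
    and comparing coefficients in f * p = q f' gives
    (n - 1) a_n = sum_{k=1}^{n-1} a_{n-k} p_k.
    Since p(q) = f(T q)^{-1} (T q) f'(T q) for a map T preserving every sphere
    x + y S, starlikeness says that Re p > 0, so Caratheodory's inequality
    |p_n| <= 2 on each slice yields |a_n| <= n by induction.
    If |a_n| = n then |p_1| = 2, and positivity of the 3 x 3 Toeplitz forms
    forces p_n = 2 u^n with u = p_1 / 2, i.e. a_n = n u^(n-1).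

    That p is holomorphic on the whole ball is exploited without integration or
    convergence of its power series: the Fourier coefficients on a circle are
    limits of means over roots of unity, and a uniform second order Taylor
    estimate shows that they do not depend on the radius, so they can be
    computed on arbitrarily small circles. *)

(* The obstacle is that f and its quotient combine by the regular product, which is not pointwise,
   while Caratheodory's inequality concerns one complex function. The quotient is therefore never
   built as a function on the ball. For each imaginary unit J only the C_J-coordinate [qphi J] of
   its values on the slice C_J is formed, as an explicit ratio of complex power series with real
   coefficients: the numerator is bilinear in the components of b(q) = q^-1 f(q) and of f', and the
   denominator is the symmetrization of b. The coefficients p_n come separately, from formal left
   division, and the two are linked by jets at 0: after m + 1 division steps the remainder is
   z^(m+1) times a bounded factor.

   Projecting to C_J loses information, which the choice of J restores. Each p_n lies in some C_J,
   where its projection has full length. In the extremal case J is fixed by p_1, and |p_n| <= 2 then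
   forces all other coefficients into the same plane. *)
Require Import Defs.
From Stdlib Require Import Reals Lra Lia.
From Coquelicot Require Import Coquelicot.
Open Scope R_scope.

(** * Quaternion arithmetic by components *)

Lemma hre_plus p q : hre (p + q)%H = hre p + hre q.
Proof. reflexivity. Qed.
Lemma hre_opp p : hre (- p)%H = - hre p.
Proof. reflexivity. Qed.
Lemma hre_mult p q : hre (p * q)%H =
  hre p * hre q - him1 p * him1 q - him2 p * him2 q - him3 p * him3 q.
Proof. reflexivity. Qed.
Lemma hre_conj p : hre (Hconj p) = hre p.
Proof. reflexivity. Qed.
Lemma hre_RtoH x : hre (RtoH x) = x.
Proof. reflexivity. Qed.
Lemma him1_plus p q : him1 (p + q)%H = him1 p + him1 q.
Proof. reflexivity. Qed.
Lemma him1_opp p : him1 (- p)%H = - him1 p.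
Proof. reflexivity. Qed.
Lemma him1_mult p q : him1 (p * q)%H =
  hre p * him1 q + him1 p * hre q + him2 p * him3 q - him3 p * him2 q.
Proof. reflexivity. Qed.
Lemma him1_conj p : him1 (Hconj p) = - him1 p.
Proof. reflexivity. Qed.
Lemma him1_RtoH x : him1 (RtoH x) = 0.
Proof. reflexivity. Qed.
Lemma him2_plus p q : him2 (p + q)%H = him2 p + him2 q.
Proof. reflexivity. Qed.
Lemma him2_opp p : him2 (- p)%H = - him2 p.
Proof. reflexivity. Qed.
Lemma him2_mult p q : him2 (p * q)%H =
  hre p * him2 q - him1 p * him3 q + him2 p * hre q + him3 p * him1 q.
Proof. reflexivity. Qed.
Lemma him2_conj p : him2 (Hconj p) = - him2 p.
Proof. reflexivity. Qed.
Lemma him2_RtoH x : him2 (RtoH x) = 0.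
Proof. reflexivity. Qed.
Lemma him3_plus p q : him3 (p + q)%H = him3 p + him3 q.
Proof. reflexivity. Qed.
Lemma him3_opp p : him3 (- p)%H = - him3 p.
Proof. reflexivity. Qed.
Lemma him3_mult p q : him3 (p * q)%H =
  hre p * him3 q + him1 p * him2 q - him2 p * him1 q + him3 p * hre q.
Proof. reflexivity. Qed.
Lemma him3_conj p : him3 (Hconj p) = - him3 p.
Proof. reflexivity. Qed.
Lemma him3_RtoH x : him3 (RtoH x) = 0.
Proof. reflexivity. Qed.

#[local] Hint Rewrite hre_plus hre_opp hre_mult hre_conj hre_RtoH him1_plus
  him1_opp him1_mult him1_conj him1_RtoH him2_plus him2_opp him2_mult
  him2_conj him2_RtoH him3_plus him3_opp him3_mult him3_conj him3_RtoH : quat.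

(* Computing the components one operation at a time; [hring] unfolds the nested
   products all at once, which is exponential in their depth. *)
Ltac Hring := intros; apply H_ext; unfold Hnorm2; autorewrite with quat; ring.

(** * Uniformly differentiable functions *)

(** One constant controls f, the derivative D and the quadratic Taylor remainder between any two
    points of K, near or far. This form is stable under products and inverses, and it can be summed
    over sample points of a circle. *)
Definition unif_holo (K : C -> Prop) (f D : C -> C) : Prop :=
  exists M, 0 <= M /\
    (forall z, K z -> Cmod (f z) <= M /\ Cmod (D z) <= M) /\
    (forall z w, K z -> K w ->
       Cmod (f w - f z - (w - z) * D z)%C <= M * Cmod (w - z)%C ^ 2).

Definition holo (K : C -> Prop) (f : C -> C) : Prop := exists D, unif_holo K f D.

Lemma Cmod_minus (z w : C) : Cmod (z - w)%C <= Cmod z + Cmod w.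
Proof. rewrite <- (Cmod_opp w); apply Cmod_triangle. Qed.

Lemma unif_holo_lip K f D (HK : forall z, K z -> Cmod z <= 1) :
  unif_holo K f D ->
  exists L, 0 <= L /\ forall z w, K z -> K w ->
    Cmod (f w - f z)%C <= L * Cmod (w - z)%C.
Proof.
(* At distance d <= 2 the estimate M d^2 + M d is at most 3 M d. *)
intros (M & M0 & B & E); exists (3 * M); split; [lra|]; intros z w Kz Kw.
assert (H1 := E z w Kz Kw).
destruct (B z Kz) as [_ H2].
assert (H3 : Cmod (w - z)%C <= 2).
{ assert (A := Cmod_minus w z); assert (A1 := HK z Kz); assert (A2 := HK w Kw); lra. }
assert (H4 := Cmod_ge_0 (w - z)%C).
replace (f w - f z)%C with ((f w - f z - (w - z) * D z) + (w - z) * D z)%C by ring.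
eapply Rle_trans; [apply Cmod_triangle|rewrite Cmod_mult].
assert (H5 := Cmod_ge_0 (D z)).
revert H1 H2 H3 H4 H5; generalize (Cmod (w - z)%C) (Cmod (D z)); intros d e; intros.
assert (M * (d ^ 2) <= M * (2 * d)) by (apply Rmult_le_compat_l; nra).
nra.
Qed.

Lemma holo_sub (K K' : C -> Prop) f :
  (forall z, K' z -> K z) -> holo K f -> holo K' f.
Proof.
intros HK (D & M & M0 & B & E); exists D, M; split; [easy|]; split; auto.
Qed.

Lemma holo_ext (K : C -> Prop) f g :
  (forall z, K z -> f z = g z) -> holo K f -> holo K g.
Proof.
intros Hfg (D & M & M0 & B & E); exists D, M; split; [easy|]; split.
- intros z Kz; rewrite <- Hfg; auto.
- intros z w Kz Kw; rewrite <- !Hfg; auto.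
Qed.

Lemma holo_const K c : holo K (fun _ => c).
Proof.
exists (fun _ => RtoC 0), (Cmod c); split; [apply Cmod_ge_0|]; split.
- intros z _; split; [lra|rewrite Cmod_0; apply Cmod_ge_0].
- intros z w _ _; replace (c - c - (w - z) * 0)%C with (RtoC 0) by ring.
  rewrite Cmod_0; apply Rmult_le_pos; [apply Cmod_ge_0|apply pow2_ge_0].
Qed.

Lemma holo_id K : (forall z, K z -> Cmod z <= 1) -> holo K (fun z => z).
Proof.
intros HK; exists (fun _ => RtoC 1), 1; split; [lra|]; split.
- intros z Kz; rewrite Cmod_1; auto with real.
- intros z w _ _; replace (w - z - (w - z) * 1)%C with (RtoC 0) by ring.
  rewrite Cmod_0; apply Rmult_le_pos; [lra|apply pow2_ge_0].
Qed.

Lemma holo_plus K f g : holo K f -> holo K g -> holo K (fun z => f z + g z)%C.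
Proof.
intros (D & M & M0 & B & E) (D' & M' & M0' & B' & E').
exists (fun z => D z + D' z)%C, (M + M'); split; [lra|]; split.
- intros z Kz; destruct (B z Kz), (B' z Kz).
  split; (eapply Rle_trans; [apply Cmod_triangle|lra]).
- intros z w Kz Kw; specialize (E z w Kz Kw); specialize (E' z w Kz Kw).
  replace (f w + g w - (f z + g z) - (w - z) * (D z + D' z))%C
    with ((f w - f z - (w - z) * D z) + (g w - g z - (w - z) * D' z))%C by ring.
  eapply Rle_trans; [apply Cmod_triangle|lra].
Qed.

Lemma holo_mult K f g (HK : forall z, K z -> Cmod z <= 1) :
  holo K f -> holo K g -> holo K (fun z => f z * g z)%C.
Proof.
intros (D & HD) (D' & HD').
destruct (unif_holo_lip K g D' HK HD') as (L & L0 & HL).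
destruct HD as (M & M0 & B & E), HD' as (M' & M0' & B' & E').
(* The remainder of the product splits into three terms, which cost M M', M M' and M L. *)
exists (fun z => D z * g z + f z * D' z)%C, (2 * M * M' + M * L).
assert (0 <= M * M') by nra. assert (0 <= M * L) by nra.
split; [nra|]; split.
- intros z Kz; destruct (B z Kz), (B' z Kz).
  assert (Hm : forall x y, Cmod x <= M -> Cmod y <= M' -> Cmod (x * y)%C <= M * M').
  { intros x y Hx Hy; rewrite Cmod_mult.
    apply Rmult_le_compat; auto using Cmod_ge_0. }
  split; [specialize (Hm (f z) (g z)); nra|].
  eapply Rle_trans; [apply Cmod_triangle|].
  assert (A1 := Hm (D z) (g z)); assert (A2 := Hm (f z) (D' z)); nra.
- intros z w Kz Kw; specialize (E z w Kz Kw); specialize (E' z w Kz Kw);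
    specialize (HL z w Kz Kw).
  destruct (B z Kz), (B' w Kw).
  replace (f w * g w - f z * g z - (w - z) * (D z * g z + f z * D' z))%C
    with ((f w - f z - (w - z) * D z) * g w + f z * (g w - g z - (w - z) * D' z)
          + (w - z) * D z * (g w - g z))%C by ring.
  eapply Rle_trans; [apply Cmod_triangle|].
  eapply Rle_trans; [apply Rplus_le_compat_r, Cmod_triangle|].
  rewrite !Cmod_mult.
  set (d := Cmod (w - z)%C) in *.
  assert (0 <= d) by apply Cmod_ge_0.
  assert (A1 : Cmod (f w - f z - (w - z) * D z)%C * Cmod (g w) <= M * d ^ 2 * M')
    by (apply Rmult_le_compat; auto using Cmod_ge_0).
  assert (A2 : Cmod (f z) * Cmod (g w - g z - (w - z) * D' z)%C <= M * (M' * d ^ 2))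
    by (apply Rmult_le_compat; auto using Cmod_ge_0).
  assert (A3 : d * Cmod (D z) * Cmod (g w - g z)%C <= d * M * (L * d)).
  { apply Rmult_le_compat; auto using Cmod_ge_0.
    - apply Rmult_le_pos; auto using Cmod_ge_0.
    - apply Rmult_le_compat_l; auto. }
  nra.
Qed.

Lemma holo_pow K n (HK : forall z, K z -> Cmod z <= 1) :
  holo K (fun z => z ^ n)%C.
Proof.
induction n as [|n IH].
- apply (holo_const K (RtoC 1)).
- apply (holo_mult K (fun z => z) (fun z => z ^ n)%C HK); [now apply holo_id|easy].
Qed.

Lemma holo_inv K f m (HK : forall z, K z -> Cmod z <= 1) :
  0 < m -> (forall z, K z -> m <= Cmod (f z)) ->
  holo K f -> holo K (fun z => / f z)%C.
Proof.
intros m0 Hm (D & HD).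
destruct (unif_holo_lip K f D HK HD) as (L & L0 & HL).
destruct HD as (M & M0 & B & E).
assert (Hnz : forall z, K z -> f z <> RtoC 0).
{ intros z Kz Z; specialize (Hm z Kz); rewrite Z, Cmod_0 in Hm; lra. }
assert (i0 : 0 < / m) by now apply Rinv_0_lt_compat.
assert (Hi : forall z, K z -> Cmod (/ f z)%C <= / m).
{ intros z Kz; rewrite Cmod_inv by auto; apply Rinv_le_contravar; auto. }
(* The three summands of the constant majorize 1 / f, its derivative and its quadratic remainder. *)
exists (fun z => - (D z * (/ f z * / f z)))%C,
  (/ m + M * (/ m * / m) + (M * M + M * L) * (/ m * (/ m * / m))).
set (i := / m) in *.
assert (0 <= M * L) by nra. assert (0 <= M * M) by nra.
assert (0 <= i * i) by nra. assert (0 <= i * (i * i)) by nra.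
assert (0 <= M * (i * i)) by nra.
assert (0 <= (M * M + M * L) * (i * (i * i))) by (apply Rmult_le_pos; lra).
split; [lra|]; split.
- intros z Kz; destruct (B z Kz); specialize (Hi z Kz).
  split; [lra|].
  rewrite Cmod_opp, !Cmod_mult.
  assert (Cmod (D z) * (Cmod (/ f z)%C * Cmod (/ f z)%C) <= M * (i * i)); [|lra].
  apply Rmult_le_compat; auto using Cmod_ge_0.
  + apply Rmult_le_pos; apply Cmod_ge_0.
  + apply Rmult_le_compat; auto using Cmod_ge_0.
- intros z w Kz Kw; specialize (E z w Kz Kw); specialize (HL z w Kz Kw).
  destruct (B z Kz).
  assert (iz := Hi z Kz); assert (iw := Hi w Kw).
  replace (/ f w - / f z - (w - z) * - (D z * (/ f z * / f z)))%C
    with ((- ((f w - f z - (w - z) * D z) * f z) + (w - z) * D z * (f w - f z))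
          * (/ f w * (/ f z * / f z)))%C by (field; auto).
  set (d := Cmod (w - z)%C) in *.
  assert (0 <= d) by apply Cmod_ge_0.
  assert (A1 : Cmod (- ((f w - f z - (w - z) * D z) * f z)
    + (w - z) * D z * (f w - f z))%C <= (M * M + M * L) * d ^ 2).
  { eapply Rle_trans; [apply Cmod_triangle|].
    rewrite Cmod_opp, !Cmod_mult; fold d.
    assert (A1 : Cmod (f w - f z - (w - z) * D z)%C * Cmod (f z) <= M * d ^ 2 * M)
      by (apply Rmult_le_compat; auto using Cmod_ge_0).
    assert (A3 : d * Cmod (D z) * Cmod (f w - f z)%C <= d * M * (L * d)).
    { apply Rmult_le_compat; auto using Cmod_ge_0.
      - apply Rmult_le_pos; auto using Cmod_ge_0.
      - apply Rmult_le_compat_l; auto. }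
    nra. }
  rewrite Cmod_mult.
  assert (A2 : Cmod (/ f w * (/ f z * / f z))%C <= i * (i * i)).
  { rewrite !Cmod_mult; apply Rmult_le_compat; auto using Cmod_ge_0.
    - apply Rmult_le_pos; apply Cmod_ge_0.
    - apply Rmult_le_compat; auto using Cmod_ge_0. }
  apply Rle_trans with ((M * M + M * L) * d ^ 2 * (i * (i * i))).
  + apply Rmult_le_compat; auto using Cmod_ge_0.
  + assert (0 <= d ^ 2) by apply pow2_ge_0.
    assert (0 <= (i + M * (i * i)) * d ^ 2) by (apply Rmult_le_pos; lra).
    nra.
Qed.

(* A cover of the square by boxes on which f keeps half of its modulus, or
   which avoid the disc, has a positive Lebesgue number. *)
Lemma holo_bounded_below f rho : 0 <= rho <= 1 ->
  holo (fun z => Cmod z <= rho) f ->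
  (forall z, Cmod z <= rho -> f z <> RtoC 0) ->
  exists m, 0 < m /\ forall z, Cmod z <= rho -> m <= Cmod (f z).
Proof.
intros Hr (D & HD) Hnz.
destruct (unif_holo_lip (fun z => Cmod z <= rho) f D) as (L & L0 & HL).
{ intros z Hz; lra. }
{ exact HD. }
(* Points of a box of half-width d are within 2 d of its centre, so f varies there by at most 2 L d,
   less than half of 4 (L + 1) d. A box centred off the disc is small enough to miss it. *)
assert (Hd : forall x y : R, {d : posreal |
  (Cmod (x, y) <= rho -> 4 * (L + 1) * d <= Cmod (f (x, y))) /\
  (rho < Cmod (x, y) -> 2 * d <= Cmod (x, y) - rho)}).
{ intros x y; destruct (Rle_lt_dec (Cmod (x, y)) rho) as [Hle|Hlt].
  - assert (P : 0 < Cmod (f (x, y)) / (4 * (L + 1))).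
    { apply Rdiv_lt_0_compat; [apply Cmod_gt_0, Hnz, Hle|lra]. }
    exists (mkposreal _ P); cbn; split; [|lra].
    intros _; right; field; lra.
  - assert (P : 0 < (Cmod (x, y) - rho) / 2) by lra.
    exists (mkposreal _ P); cbn; split; [lra|]; intros _; lra. }
destruct (compactness_value_2d (-1) 1 (-1) 1 (fun x y => proj1_sig (Hd x y)))
  as [d Hcov].
exists d; split; [apply cond_pos|]; intros [x y] Hz.
(* The covering property is available only under a double negation, so the goal is first turned into
   [False]. *)
apply Rnot_lt_le; intros Hlt.
assert (Hxy := Rmax_Cmod (x, y)); cbn [fst snd] in Hxy.
assert (Rabs x <= 1 /\ Rabs y <= 1) as [Hx Hy].
{ split; eapply Rle_trans; [apply (Rmax_l (Rabs x) (Rabs y))|lra| |].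
  - apply (Rmax_r (Rabs x) (Rabs y)).
  - lra. }
apply Rabs_le_between in Hx; apply Rabs_le_between in Hy.
apply (Hcov x y Hx Hy); intros (u & v & _ & _ & Hu & Hv & Hduv).
destruct (Hd u v) as [e [He1 He2]]; cbn in Hu, Hv, Hduv.
assert (Hdist : Cmod ((x, y) - (u, v))%C <= 2 * e).
{ replace ((x, y) - (u, v))%C with (RtoC (x - u) + Ci * RtoC (y - v))%C.
  - eapply Rle_trans; [apply Cmod_triangle|].
    rewrite Cmod_mult, Cmod_Ci, !Cmod_R; lra.
  - apply injective_projections; cbn; ring. }
destruct (Rle_lt_dec (Cmod (u, v)) rho) as [Hle|Hgt].
- assert (A := HL (u, v) (x, y) Hle Hz); specialize (He1 Hle).
  assert (Hq : Cmod (f (u, v)) <= Cmod (f (x, y)) + Cmod (f (x, y) - f (u, v))%C).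
  { replace (f (u, v)) with (f (x, y) - (f (x, y) - f (u, v)))%C at 1 by ring.
    apply Cmod_minus. }
  assert (e0 := cond_pos e).
  assert (L * Cmod ((x, y) - (u, v))%C <= L * (2 * e))
    by (now apply Rmult_le_compat_l).
  nra.
- specialize (He2 Hgt).
  assert (Hq : Cmod (u, v) <= Cmod (x, y) + Cmod ((x, y) - (u, v))%C).
  { replace (u, v) with ((x, y) - ((x, y) - (u, v)))%C at 1 by ring.
    apply Cmod_minus. }
  assert (Hs : Cmod ((x, y) - (u, v))%C < 2 * e).
  { replace ((x, y) - (u, v))%C with (RtoC (x - u) + Ci * RtoC (y - v))%C.
    - eapply Rle_lt_trans; [apply Cmod_triangle|].
      rewrite Cmod_mult, Cmod_Ci, !Cmod_R; lra.
    - apply injective_projections; cbn; ring. }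
  lra.
Qed.

(** * Means over roots of unity *)

Ltac Cring :=
  repeat change (@plus _ ?x ?y) with (Cplus x y);
  repeat change (@mult _ ?x ?y) with (Cmult x y);
  match goal with |- @eq _ ?x ?y => change (@eq C x y) end; ring.

Definition cis (t : R) : C := (cos t, sin t).

Lemma cis_plus s t : cis (s + t) = (cis s * cis t)%C.
Proof.
unfold cis; apply injective_projections; cbn;
  rewrite ?cos_plus, ?sin_plus; ring.
Qed.

Lemma cis_pow t n : (cis t ^ n)%C = cis (INR n * t).
Proof.
induction n as [|n IH].
- cbn [Cpow INR]; unfold cis; rewrite Rmult_0_l, cos_0, sin_0; easy.
- rewrite Cpow_S, IH, <- cis_plus, S_INR; f_equal; ring.
Qed.

Lemma Cmod_cis t : Cmod (cis t) = 1.
Proof.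
unfold Cmod, cis; cbn [fst snd]; rewrite <- sqrt_1; f_equal.
generalize (sin2_cos2 t); unfold Rsqr; lra.
Qed.

Lemma Cmod_cis_minus1 t : Cmod (cis t - 1)%C = 2 * Rabs (sin (t / 2)).
Proof.
replace (2 * Rabs (sin (t / 2))) with (Rabs (2 * sin (t / 2)))
  by (rewrite Rabs_mult, (Rabs_pos_eq 2); lra).
rewrite <- sqrt_Rsqr_abs.
unfold Cmod; f_equal; cbn.
replace (cos t) with (cos (2 * (t / 2))) by (f_equal; field).
replace (sin t) with (sin (2 * (t / 2))) by (f_equal; field).
rewrite cos_2a_sin, sin_2a; unfold Rsqr.
generalize (sin2_cos2 (t / 2)); unfold Rsqr.
generalize (sin (t / 2)) (cos (t / 2)); intros s c E.
assert (c * c = 1 - s * s) by lra.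
transitivity (4 * (s * s) * (s * s) + 4 * (s * s) * (c * c)); [ring|].
rewrite H; ring.
Qed.

Lemma cis_neq1 t : 0 < t < 2 * PI -> cis t <> RtoC 1.
Proof.
intros Ht E.
assert (A := Cmod_cis_minus1 t); rewrite E in A.
replace (1 - 1)%C with (RtoC 0) in A by ring; rewrite Cmod_0 in A.
assert (0 < sin (t / 2)) by (apply sin_gt_0; lra).
rewrite Rabs_pos_eq in A; lra.
Qed.

Lemma Cmod_cis_minus1_le t : 0 <= t <= 2 * PI -> Cmod (cis t - 1)%C <= t.
Proof.
intros Ht; rewrite Cmod_cis_minus1.
destruct (Req_dec t 0) as [->|N].
{ replace (0 / 2) with 0 by field; rewrite sin_0, Rabs_R0; lra. }
assert (0 <= sin (t / 2)) by (apply sin_ge_0; lra).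
assert (sin (t / 2) < t / 2) by (apply sin_lt_x; lra).
rewrite Rabs_pos_eq; lra.
Qed.

(** The order is N + 1, which is the number of terms of [sum_n _ N]. *)
Definition root (N : nat) : C := cis (2 * PI / INR (S N)).

Lemma INR_S_pos N : 0 < INR (S N).
Proof. apply lt_0_INR; lia. Qed.

Lemma root_pow_neq1 N k : (0 < k <= N)%nat -> (root N ^ k)%C <> RtoC 1.
Proof.
intros Hk; unfold root; rewrite cis_pow; apply cis_neq1.
assert (P := PI_RGT_0); assert (n0 := INR_S_pos N).
assert (0 < INR k) by (apply lt_0_INR; lia).
assert (INR k < INR (S N)) by (apply lt_INR; lia).
replace (INR k * (2 * PI / INR (S N))) with (2 * PI * (INR k / INR (S N)))
  by (field; lra).
assert (0 < INR k / INR (S N) < 1); [|nra].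
split; [now apply Rdiv_lt_0_compat|].
apply Rlt_div_l; lra.
Qed.

Lemma root_pow_order N : (root N ^ S N)%C = RtoC 1.
Proof.
unfold root; rewrite cis_pow.
replace (INR (S N) * (2 * PI / INR (S N))) with (2 * PI)
  by (field; apply Rgt_not_eq, INR_S_pos).
unfold cis; rewrite cos_2PI, sin_2PI; easy.
Qed.

Lemma Cmod_root_pow N k : Cmod (root N ^ k)%C = 1.
Proof. unfold root; rewrite cis_pow; apply Cmod_cis. Qed.

Lemma sum_n_C_telescope (u : nat -> C) N :
  sum_n (fun k => u (S k) - u k)%C N = (u (S N) - u O)%C.
Proof.
induction N as [|N IH]; [now rewrite sum_O|].
rewrite sum_Sn, IH; Cring.
Qed.

Lemma Cmod_sum_n_le (u : nat -> C) (b : R) N :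
  (forall k, (k <= N)%nat -> Cmod (u k) <= b) ->
  Cmod (sum_n u N) <= INR (S N) * b.
Proof.
induction N as [|N IH]; intros Hb.
- rewrite sum_O; replace (INR 1 * b) with b by (cbn; ring); auto.
- rewrite sum_Sn, S_INR, Rmult_plus_distr_r, Rmult_1_l.
  eapply Rle_trans; [apply Cmod_triangle|].
  apply Rplus_le_compat; [apply IH; auto|auto].
Qed.

Definition ring_mean (N : nat) (f : C -> C) (r : R) : C :=
  (RtoC (/ INR (S N)) * sum_n (fun k => f (r * root N ^ k)%C) N)%C.

Lemma Cmod_ring_mean_le N f (r b : R) :
  (forall k, Cmod (f (r * root N ^ k)%C) <= b) -> Cmod (ring_mean N f r) <= b.
Proof.
intros Hb; unfold ring_mean.
assert (n0 := INR_S_pos N).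
rewrite Cmod_mult, Cmod_R, Rabs_pos_eq by (apply Rlt_le, Rinv_0_lt_compat, n0).
apply Rle_trans with (/ INR (S N) * (INR (S N) * b)).
- apply Rmult_le_compat_l; [apply Rlt_le, Rinv_0_lt_compat, n0|].
  apply Cmod_sum_n_le; auto.
- right; field; lra.
Qed.

Lemma Cmod_circle N k (r : R) : 0 <= r -> Cmod (r * root N ^ k)%C = r.
Proof.
intros Hr; rewrite Cmod_mult, Cmod_root_pow, Cmod_R, Rabs_pos_eq; lra.
Qed.

Lemma ring_mean_ext N f g (r : R) :
  (forall k, f (r * root N ^ k)%C = g (r * root N ^ k)%C) ->
  ring_mean N f r = ring_mean N g r.
Proof.
intros E; unfold ring_mean; f_equal; apply sum_n_ext; auto.
Qed.

Lemma ring_mean_plus N f g r :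
  ring_mean N (fun z => f z + g z)%C r = (ring_mean N f r + ring_mean N g r)%C.
Proof.
unfold ring_mean; rewrite <- Cmult_plus_distr_l; f_equal.
apply (sum_n_plus (fun k => f (r * root N ^ k)%C) (fun k => g (r * root N ^ k)%C)).
Qed.

Lemma sum_n_Cmult_l (c : C) (u : nat -> C) n :
  sum_n (fun k => c * u k)%C n = (c * sum_n u n)%C.
Proof. exact (sum_n_mult_l (K := C_Ring) c u n). Qed.

Lemma ring_mean_scal N c f r :
  ring_mean N (fun z => c * f z)%C r = (c * ring_mean N f r)%C.
Proof.
unfold ring_mean.
rewrite (sum_n_Cmult_l c (fun k => f (r * root N ^ k)%C)); ring.
Qed.

Lemma ring_mean_minus N f g r :
  ring_mean N (fun z => f z - g z)%C r = (ring_mean N f r - ring_mean N g r)%C.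
Proof.
transitivity (ring_mean N (fun z => f z + (-(1)) * g z)%C r).
{ apply ring_mean_ext; intros k; ring. }
rewrite ring_mean_plus, ring_mean_scal; ring.
Qed.

Lemma ring_mean_const N c r : ring_mean N (fun _ => c) r = c.
Proof.
unfold ring_mean.
assert (E : forall n, sum_n (fun _ : nat => c) n = (INR (S n) * c)%C).
{ induction n as [|n IH]; [rewrite sum_O; cbn; ring|].
  rewrite sum_Sn, IH, (S_INR (S n)), RtoC_plus.
  Cring. }
assert (n0 := INR_S_pos N).
rewrite E, Cmult_assoc, <- RtoC_mult, Rinv_l by lra; ring.
Qed.

(** Rotation by one step shifts the sample points cyclically: the difference of the two sums
    telescopes, and its end terms agree by [root_pow_order]. *)
Lemma ring_mean_rotation N f r :
  ring_mean N (fun z => f (root N * z)%C) r = ring_mean N f r.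
Proof.
apply Ceq_minus; rewrite <- ring_mean_minus; unfold ring_mean.
rewrite (sum_n_ext _ (fun k => f (r * root N ^ S k)%C - f (r * root N ^ k)%C)%C).
- rewrite (sum_n_C_telescope (fun k => f (r * root N ^ k)%C)), root_pow_order.
  cbn [Cpow]; ring.
- intros k; do 2 f_equal; rewrite Cpow_S; ring.
Qed.

(** A discrete form of the vanishing of the integral of f' over a circle. For w the root of unity,
    the mean of f(w z) - f(z) is 0, so (w - 1) times the mean of z D(z) is a mean of Taylor
    remainders, of size M |w - 1|^2. Dividing by |w - 1| leaves O(1/N). *)
Lemma ring_mean_zD_le (K : C -> Prop) (f D : C -> C) (M : R) N (r : R) :
  0 <= M -> 0 <= r <= 1 -> (forall z, Cmod z = r -> K z) ->
  (forall z, K z -> Cmod (f z) <= M /\ Cmod (D z) <= M) ->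
  (forall z w, K z -> K w ->
       Cmod (f w - f z - (w - z) * D z)%C <= M * Cmod (w - z)%C ^ 2) ->
  Cmod (ring_mean N (fun z => z * D z)%C r) <= 8 * M / INR (S N).
Proof.
intros M0 Hr HK B E; assert (n0 := INR_S_pos N).
assert (Kk : forall k, K (r * root N ^ k)%C) by (intros; apply HK, Cmod_circle; lra).
(* For a single sample point w = 1 and the division by w - 1 is impossible, but the trivial bound M
   is enough. *)
destruct (Nat.eq_dec N 0) as [->|NN].
{ replace (INR 1) with 1 by easy.
  apply Rle_trans with M; [|lra].
  apply Cmod_ring_mean_le; intros k; rewrite Cmod_mult, Cmod_circle by lra.
  destruct (B _ (Kk k)) as [_ A].
  assert (A0 := Cmod_ge_0 (D (r * root 0 ^ k)%C)); nra. }
set (w := root N).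
assert (Hw : w <> RtoC 1).
{ unfold w; rewrite <- (Cpow_1_r (root N)); apply root_pow_neq1; lia. }
assert (d0 : 0 < Cmod (w - 1)%C) by now apply Cmod_gt_0, Cminus_eq_contra.
(* The constant 8 majorizes 2 PI, by PI <= 4. *)
assert (d1 : Cmod (w - 1)%C <= 8 / INR (S N)).
{ assert (P := PI_RGT_0); assert (P4 := PI_4).
  assert (i0 : 0 < / INR (S N) <= 1).
  { split; [now apply Rinv_0_lt_compat|].
    rewrite <- Rinv_1; apply Rinv_le_contravar; [lra|].
    apply (le_INR 1); lia. }
  apply Rle_trans with (2 * PI / INR (S N)).
  - apply Cmod_cis_minus1_le; unfold Rdiv; nra.
  - unfold Rdiv; nra. }
assert (Hmain : Cmod ((w - 1) * ring_mean N (fun z => z * D z)%C r)%C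
                <= M * Cmod (w - 1)%C ^ 2).
{ rewrite <- ring_mean_scal.
  replace (ring_mean N (fun z => (w - 1) * (z * D z))%C r) with
    (- ring_mean N (fun z => (f (w * z) - f z) - (w - 1) * (z * D z))%C r)%C.
  2: { rewrite !ring_mean_minus; unfold w at 1; rewrite ring_mean_rotation; ring. }
  rewrite Cmod_opp; apply Cmod_ring_mean_le; intros k.
  assert (Kw : K (w * (r * root N ^ k))%C).
  { replace (w * (r * root N ^ k))%C with (r * root N ^ S k)%C
      by (unfold w; rewrite Cpow_S; ring); auto. }
  assert (A := E _ _ (Kk k) Kw).
  replace (w * (r * root N ^ k) - r * root N ^ k)%C
    with ((w - 1) * (r * root N ^ k))%C in A by ring.
  rewrite (Cmod_mult (w - 1)%C (r * root N ^ k)%C), Cmod_circle in A by lra.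
  rewrite (Cmult_assoc (w - 1)%C (r * root N ^ k)%C).
  eapply Rle_trans; [exact A|].
  apply Rmult_le_compat_l; [easy|]; apply pow_incr; nra. }
rewrite Cmod_mult in Hmain.
assert (Hc : Cmod (ring_mean N (fun z => z * D z)%C r) <= M * Cmod (w - 1)%C).
{ apply Rmult_le_reg_l with (Cmod (w - 1)%C); [easy|]; nra. }
eapply Rle_trans; [exact Hc|].
replace (8 * M / INR (S N)) with (M * (8 / INR (S N))) by (field; lra).
now apply Rmult_le_compat_l.
Qed.

(* Rotating the circle by one step shows that the mean of z D(z) is O(1/N);
   hence each of the N radial steps of length O(1/N) changes the mean of f by
   O(1/N^2). *)
Lemma ring_mean_shift f eps rho :
  0 < eps <= rho -> rho <= 1 ->
  holo (fun z => eps <= Cmod z <= rho) f ->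
  exists A, 0 <= A /\ forall N,
    Cmod (ring_mean N f rho - ring_mean N f eps)%C <= A / INR (S N).
Proof.
intros He Hr (D & M & M0 & B & E).
assert (ie : 0 < / eps) by (apply Rinv_0_lt_compat; lra).
assert (Me : 0 <= 8 * M * / eps) by nra.
exists (8 * M * / eps + M); split; [lra|]; intros N.
assert (n0 := INR_S_pos N).
set (d := (rho - eps) / INR (S N)).
assert (i0 : 0 < / INR (S N)) by now apply Rinv_0_lt_compat.
assert (Hd : 0 <= d <= / INR (S N)) by (unfold d, Rdiv; split; nra).
assert (step : forall r, eps <= r -> r + d <= rho ->
  Cmod (ring_mean N f (r + d) - ring_mean N f r)%C
  <= (8 * M * / eps + M) * (/ INR (S N)) ^ 2).
{ intros r Hr1 Hr2.
  assert (Hm' : Cmod (ring_mean N (fun z => z * D z)%C r) <= 8 * M / INR (S N)).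
  { apply (ring_mean_zD_le (fun z => eps <= Cmod z <= rho) f); auto; try lra.
    intros z Hz; lra. }
  replace (ring_mean N f (r + d)) with
    (ring_mean N (fun z => f ((1 + d / r)%R * z)%C) r).
  2: { unfold ring_mean; f_equal; apply sum_n_ext; intros k; f_equal.
       rewrite Cmult_assoc, <- RtoC_mult; do 2 f_equal; field; lra. }
  (* The radial step is the dilation by 1 + d / r. Its linear part is d / r times the mean of z
     D(z), a product of two quantities O(1/N), and its remainder is at most M d^2. *)
  replace (ring_mean N (fun z => f ((1 + d / r)%R * z)%C) r - ring_mean N f r)%C
    with (ring_mean N (fun z => (f ((1 + d / r)%R * z) - f z)
             - RtoC (d / r)%R * (z * D z))%C r
          + RtoC (d / r)%R * ring_mean N (fun z => z * D z)%C r)%C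
    by (rewrite !ring_mean_minus, ring_mean_scal; ring).
  eapply Rle_trans; [apply Cmod_triangle|].
  assert (A1 : Cmod (ring_mean N (fun z => (f ((1 + d / r)%R * z) - f z)
             - RtoC (d / r)%R * (z * D z))%C r) <= M * d ^ 2).
  { apply Cmod_ring_mean_le; intros k; set (z := (r * root N ^ k)%C).
    assert (Hz : Cmod z = r) by (apply Cmod_circle; lra).
    assert (Hdr : 0 <= d / r) by (apply Rdiv_le_0_compat; lra).
    assert (Hzd : Cmod ((1 + d / r)%R * z)%C = r + d).
    { rewrite Cmod_mult, Hz, Cmod_R, Rabs_pos_eq by lra; field; lra. }
    assert (Ed := E z ((1 + d / r)%R * z)%C).
    replace ((1 + d / r)%R * z - z)%C with (RtoC (d / r)%R * z)%C in Ed
      by (rewrite RtoC_plus; ring).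
    rewrite (Cmod_mult (RtoC (d / r)%R) z), Hz, Cmod_R, Rabs_pos_eq in Ed by easy.
    replace (d / r * r) with d in Ed by (field; lra).
    rewrite (Cmult_assoc (RtoC (d / r)) z (D z)); apply Ed; [lra|rewrite Hzd; lra]. }
  assert (A2 : d ^ 2 <= (/ INR (S N)) ^ 2) by (apply pow_incr; lra).
  assert (Hdr : 0 <= d / r <= / INR (S N) * / eps).
  { split; [apply Rdiv_le_0_compat; lra|].
    unfold Rdiv; apply Rmult_le_compat; try lra.
    - apply Rlt_le, Rinv_0_lt_compat; lra.
    - apply Rinv_le_contravar; lra. }
  assert (A3 : Cmod (RtoC (d / r)%R * ring_mean N (fun z => z * D z) r)%C
    <= / INR (S N) * / eps * (8 * M / INR (S N))).
  { rewrite Cmod_mult, Cmod_R, Rabs_pos_eq by lra.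
    apply Rmult_le_compat; auto using Cmod_ge_0; lra. }
  assert (M * d ^ 2 <= M * (/ INR (S N)) ^ 2) by now apply Rmult_le_compat_l.
  unfold Rdiv in A3; nra. }
assert (walk : forall k, (k <= S N)%nat ->
  Cmod (ring_mean N f (eps + INR k * d) - ring_mean N f eps)%C
  <= INR k * ((8 * M * / eps + M) * (/ INR (S N)) ^ 2)).
{ induction k as [|k IH]; intros Hk.
  - cbn [INR]; rewrite !Rmult_0_l, Rplus_0_r.
    replace (ring_mean N f eps - ring_mean N f eps)%C with (RtoC 0) by ring.
    rewrite Cmod_0; lra.
  - specialize (IH ltac:(lia)).
    assert (k0 := pos_INR k).
    specialize (step (eps + INR k * d)).
    replace (eps + INR k * d + d) with (eps + INR (S k) * d) in step
      by (rewrite S_INR; ring).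
    assert (Hend : INR (S k) * d <= rho - eps).
    { unfold d; apply Rle_trans with (INR (S N) * ((rho - eps) / INR (S N))).
      - apply Rmult_le_compat_r; [unfold d in Hd; lra|apply le_INR; lia].
      - right; field; lra. }
    specialize (step ltac:(nra) ltac:(lra)).
    replace (ring_mean N f (eps + INR (S k) * d) - ring_mean N f eps)%C with
      ((ring_mean N f (eps + INR (S k) * d) - ring_mean N f (eps + INR k * d))
       + (ring_mean N f (eps + INR k * d) - ring_mean N f eps))%C by ring.
    eapply Rle_trans; [apply Cmod_triangle|].
    replace (INR (S k)) with (INR k + 1) in * by now rewrite S_INR.
    lra. }
specialize (walk (S N) ltac:(lia)).
replace (eps + INR (S N) * d) with rho in walk by (unfold d; field; lra).
eapply Rle_trans; [exact walk|].
right; field; lra.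
Qed.

(** * Limits of the means as the number of sample points grows *)

Definition mean_lim (f : C -> C) (r : R) (l : C) : Prop :=
  forall eta, 0 < eta -> exists N0, forall N, (N0 <= N)%nat ->
    Cmod (ring_mean N f r - l)%C <= eta.

(** Moving to the radius eps costs an error that vanishes as N grows, and the error A * eps that
    remains there is small by the choice of eps. The order of choices matters, since the constant of
    [ring_mean_shift] depends on eps. *)
Lemma mean_lim_of_small_radius f rho l A :
  0 < rho <= 1 -> 0 <= A ->
  (forall eps, 0 < eps <= rho -> holo (fun z => eps <= Cmod z <= rho) f) ->
  (forall eps, 0 < eps <= rho -> exists N0, forall N, (N0 <= N)%nat ->
     Cmod (ring_mean N f eps - l)%C <= A * eps) ->
  mean_lim f rho l.
Proof.
intros Hr A0 Hf Hs eta Heta.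
set (eps := Rmin rho (eta / (2 * (A + 1)))).
assert (He : 0 < eps <= rho).
{ unfold eps; split; [|apply Rmin_l].
  apply Rmin_glb_lt; [lra|apply Rdiv_lt_0_compat; lra]. }
assert (HA : A * eps <= eta / 2).
{ apply Rle_trans with ((A + 1) * (eta / (2 * (A + 1)))).
  - apply Rmult_le_compat; try lra; apply Rmin_r.
  - right; field; lra. }
destruct (ring_mean_shift f eps rho He (proj2 Hr) (Hf eps He)) as (B & B0 & HB).
destruct (Hs eps He) as [N0 HN0].
destruct (nfloor_ex (2 * B / eta)) as [N1 HN1].
{ apply Rdiv_le_0_compat; lra. }
exists (max N0 N1); intros N HN.
specialize (HN0 N ltac:(lia)); specialize (HB N).
assert (n0 := INR_S_pos N).
assert (HBn : B / INR (S N) <= eta / 2).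
{ apply Rle_div_l; [easy|].
  assert (INR N1 + 1 <= INR (S N)) by (rewrite <- S_INR; apply le_INR; lia).
  apply Rle_trans with (eta / 2 * (2 * B / eta)); [right; field; lra|].
  apply Rmult_le_compat_l; lra. }
replace (ring_mean N f rho - l)%C with
  ((ring_mean N f rho - ring_mean N f eps) + (ring_mean N f eps - l))%C by ring.
eapply Rle_trans; [apply Cmod_triangle|lra].
Qed.

Lemma mean_lim_plus f g r l m :
  mean_lim f r l -> mean_lim g r m ->
  mean_lim (fun z => f z + g z)%C r (l + m)%C.
Proof.
intros Hf Hg eta Heta.
destruct (Hf (eta / 2) ltac:(lra)) as [N1 H1].
destruct (Hg (eta / 2) ltac:(lra)) as [N2 H2].
exists (max N1 N2); intros N HN; rewrite ring_mean_plus.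
specialize (H1 N ltac:(lia)); specialize (H2 N ltac:(lia)).
replace (ring_mean N f r + ring_mean N g r - (l + m))%C with
  ((ring_mean N f r - l) + (ring_mean N g r - m))%C by ring.
eapply Rle_trans; [apply Cmod_triangle|lra].
Qed.

Lemma mean_lim_scal c f r l :
  mean_lim f r l -> mean_lim (fun z => c * f z)%C r (c * l)%C.
Proof.
intros Hf eta Heta.
assert (c0 := Cmod_ge_0 c).
destruct (Hf (eta / (Cmod c + 1))) as [N0 H0].
{ apply Rdiv_lt_0_compat; lra. }
exists N0; intros N HN; rewrite ring_mean_scal.
replace (c * ring_mean N f r - c * l)%C with (c * (ring_mean N f r - l))%C by ring.
rewrite Cmod_mult; specialize (H0 N HN).
apply Rle_trans with ((Cmod c + 1) * (eta / (Cmod c + 1))).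
- apply Rmult_le_compat; auto using Cmod_ge_0; lra.
- right; field; lra.
Qed.

Lemma mean_lim_ext f g r l : 0 <= r ->
  (forall z, Cmod z = r -> f z = g z) -> mean_lim f r l -> mean_lim g r l.
Proof.
intros Hr E Hf eta Heta; destruct (Hf eta Heta) as [N0 H0].
exists N0; intros N HN; rewrite <- (ring_mean_ext N f g); auto.
intros k; apply E, Cmod_circle; lra.
Qed.

Lemma mean_lim_Re_ge0 f r l : 0 <= r ->
  (forall z, Cmod z = r -> 0 <= Re (f z)) -> mean_lim f r l -> 0 <= Re l.
Proof.
intros Hr P Hf; apply Rnot_lt_le; intros Hl.
destruct (Hf (- Re l / 2) ltac:(lra)) as [N0 H0].
specialize (H0 N0 (le_n _)).
assert (Hm : 0 <= Re (ring_mean N0 f r)).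
{ unfold ring_mean; rewrite re_scal_l.
  apply Rmult_le_pos; [apply Rlt_le, Rinv_0_lt_compat, INR_S_pos|].
  assert (G : forall n, 0 <= Re (sum_n (fun k => f (r * root N0 ^ k)%C) n)).
  { induction n as [|n IH]; [rewrite sum_O|rewrite sum_Sn].
    - apply P, Cmod_circle; lra.
    - assert (0 <= Re (f (r * root N0 ^ S n)%C)) by (apply P, Cmod_circle; lra).
      change (0 <= Re (sum_n (fun k => f (r * root N0 ^ k)%C) n)
                   + Re (f (r * root N0 ^ S n)%C)); lra. }
  apply G. }
assert (A := re_le_Cmod (ring_mean N0 f r - l)%C).
change (Re (ring_mean N0 f r - l)%C) with (Re (ring_mean N0 f r) + - Re l) in A.
rewrite Rabs_pos_eq in A; lra.
Qed.

(** * Caratheodory's inequality and its extremal case *)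

Lemma sum_n_geom_C (x : C) n :
  ((x - 1) * sum_n (fun k => x ^ k)%C n)%C = (x ^ S n - 1)%C.
Proof.
induction n as [|n IH]; [rewrite sum_O; cbn [Cpow]; ring|].
rewrite sum_Sn.
change (plus (sum_n (fun k => x ^ k)%C n) (x ^ S n)%C)
  with (sum_n (fun k => x ^ k)%C n + x ^ S n)%C.
rewrite Cmult_plus_distr_l, IH, (Cpow_S x (S n)); ring.
Qed.

Lemma sum_n_root_pow N k : (0 < k <= N)%nat ->
  sum_n (fun j => (root N ^ k) ^ j)%C N = RtoC 0.
Proof.
intros Hk; assert (G := sum_n_geom_C (root N ^ k)%C N).
rewrite <- Cpow_mult_r, Nat.mul_comm, Cpow_mult_r, root_pow_order, Cpow_1_l in G.
replace (1 - 1)%C with (RtoC 0) in G by ring.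
assert (Hn := Cminus_eq_contra _ _ (root_pow_neq1 N k Hk)).
set (s := sum_n _ N) in *.
replace s with (/ (root N ^ k - 1) * ((root N ^ k - 1) * s))%C by (field; easy).
rewrite G; Cring.
Qed.

Lemma ring_mean_conj N (f g : C -> C) (r : R) :
  (forall k, g (r * root N ^ k)%C = Cconj (f (r * root N ^ k)%C)) ->
  ring_mean N g r = Cconj (ring_mean N f r).
Proof.
intros E; unfold ring_mean.
rewrite (sum_n_ext _ (fun k => Cconj (f (r * root N ^ k)%C))) by auto.
assert (G : forall n, sum_n (fun k => Cconj (f (r * root N ^ k)%C)) n =
  Cconj (sum_n (fun k => f (r * root N ^ k)%C) n)).
{ induction n as [|n IH]; [now rewrite !sum_O|].
  rewrite !sum_Sn, IH; symmetry.
  apply (Cplus_conj (sum_n (fun k => f (r * root N ^ k)%C) n)). }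
rewrite G, Cmult_conj; f_equal.
apply injective_projections; cbn; ring.
Qed.

Lemma ring_mean_pow N k (r : R) : (0 < k <= N)%nat ->
  ring_mean N (fun z => z ^ k)%C r = RtoC 0.
Proof.
intros Hk; unfold ring_mean.
rewrite (sum_n_ext _ (fun j => r ^ k * (root N ^ k) ^ j)%C).
- rewrite sum_n_Cmult_l, sum_n_root_pow by easy; ring.
- intros j; rewrite Cpow_mult_l, <- !Cpow_mult_r; do 2 f_equal; lia.
Qed.

Lemma Cconj_circle (z : C) r : Cmod z = r -> r <> 0 ->
  Cconj z = (RtoC (r ^ 2) * / z)%C.
Proof.
intros Hz Hr.
assert (z <> RtoC 0) by (intros E; rewrite E, Cmod_0 in Hz; lra).
assert (E := Cmod2_conj z); rewrite Hz in E; rewrite E; field; easy.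
Qed.

(** On the circle 1 / z is conj(z) / r^2, so a negative power is a multiple of the conjugate of a
    positive one. *)
Lemma ring_mean_negpow N k (r : R) : 0 < r -> (0 < k <= N)%nat ->
  ring_mean N (fun z => / z ^ k)%C r = RtoC 0.
Proof.
intros Hr Hk.
assert (Hr0 : RtoC r <> RtoC 0) by (intros E; apply RtoC_inj in E; lra).
transitivity (ring_mean N (fun z => / RtoC (r ^ 2) ^ k * Cconj z ^ k)%C r).
- apply ring_mean_ext; intros j.
  assert (Hz := Cmod_circle N j r (Rlt_le _ _ Hr)).
  set (z := (r * root N ^ j)%C) in *.
  assert (z <> RtoC 0) by (intros E; rewrite E, Cmod_0 in Hz; lra).
  assert (RtoC (r ^ 2) <> RtoC 0) by (rewrite RtoC_pow; now apply Cpow_nz).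
  rewrite (Cconj_circle z r) by lra.
  rewrite Cpow_mult_l, Cpow_inv by easy; field; split; now apply Cpow_nz.
- rewrite (ring_mean_scal N _ (fun z => Cconj z ^ k)%C).
  rewrite (ring_mean_conj N (fun z => z ^ k)%C).
  + rewrite ring_mean_pow by easy.
    replace (Cconj 0) with (RtoC 0) by (apply injective_projections; cbn; ring).
    ring.
  + intros j; symmetry; apply Cpow_conj.
Qed.

(** An expansion at 0 to every order, with a constant that may grow with the order. It makes no
    claim that the series of the [lam k] converges, and it is what finitely many steps of formal
    division provide. *)
Definition has_jets (phi : C -> C) (lam : nat -> C) : Prop :=
  forall rho m, 0 < rho < 1 -> exists K, forall z, Cmod z <= rho ->
    Cmod (phi z - sum_n (fun k => lam k * z ^ k)%C m)%C <= K * Cmod z ^ S m.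

(** Each exponent k - M lies between -N and -1, a range in which sampling at N + 1 points confuses
    no power with the constant term. *)
Lemma ring_mean_jet_low N (lam : nat -> C) m M (r : R) :
  0 < r -> (m < M <= N)%nat ->
  ring_mean N (fun z => sum_n (fun k => lam k * z ^ k)%C m * / z ^ M)%C r = RtoC 0.
Proof.
intros Hr; induction m as [|m IH]; intros HM.
- transitivity (ring_mean N (fun z => lam O * / z ^ M)%C r).
  + apply ring_mean_ext; intros k; rewrite sum_O; cbn [Cpow]; ring.
  + rewrite (ring_mean_scal N _ (fun z => / z ^ M)%C), ring_mean_negpow by easy; ring.
- transitivity (ring_mean N (fun z =>
    sum_n (fun k => lam k * z ^ k)%C m * / z ^ M + lam (S m) * / z ^ (M - S m))%C r).
  + apply ring_mean_ext; intros k; rewrite sum_Sn.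
    set (z := (r * root N ^ k)%C).
    assert (z <> RtoC 0).
    { apply Cmod_gt_0; unfold z; rewrite Cmod_circle; lra. }
    change (plus (sum_n (fun k => lam k * z ^ k)%C m) (lam (S m) * z ^ S m)%C)
      with (sum_n (fun k => lam k * z ^ k)%C m + lam (S m) * z ^ S m)%C.
    replace (z ^ M)%C with (z ^ S m * z ^ (M - S m))%C
      by (rewrite <- Cpow_add_r; f_equal; lia).
    field; split; now apply Cpow_nz.
  + rewrite (ring_mean_plus N _ (fun z => lam (S m) * / z ^ (M - S m))%C).
    rewrite IH by lia.
    rewrite (ring_mean_scal N _ (fun z => / z ^ (M - S m))%C).
    rewrite ring_mean_negpow by (easy || lia); ring.
Qed.

Lemma ring_mean_jet N (lam : nat -> C) m (r : R) : 0 < r -> (m <= N)%nat ->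
  ring_mean N (fun z => sum_n (fun k => lam k * z ^ k)%C m * / z ^ m)%C r = lam m.
Proof.
intros Hr Hm; destruct m as [|m].
- transitivity (ring_mean N (fun z => lam O)%C r).
  + apply ring_mean_ext; intros k; rewrite sum_O; cbn [Cpow].
    field; intros E; injection E; lra.
  + apply ring_mean_const.
- transitivity (ring_mean N (fun z =>
    sum_n (fun k => lam k * z ^ k)%C m * / z ^ S m + lam (S m))%C r).
  + apply ring_mean_ext; intros k; rewrite sum_Sn.
    set (z := (r * root N ^ k)%C).
    assert (z <> RtoC 0).
    { apply Cmod_gt_0; unfold z; rewrite Cmod_circle; lra. }
    change (plus (sum_n (fun k => lam k * z ^ k)%C m) (lam (S m) * z ^ S m)%C)
      with (sum_n (fun k => lam k * z ^ k)%C m + lam (S m) * z ^ S m)%C.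
    field; now apply Cpow_nz.
  + rewrite (ring_mean_plus N _ (fun z => lam (S m))%C).
    rewrite ring_mean_jet_low, ring_mean_const by (easy || lia); ring.
Qed.

Section Caratheodory.

Variables (phi : C -> C) (lam : nat -> C).
Hypothesis phi_holo : forall rho, 0 < rho < 1 -> holo (fun z => Cmod z <= rho) phi.
Hypothesis phi_jets : has_jets phi lam.

(** Cauchy's coefficient formula. On the circle of radius eps the jet of order m, divided by z ^ m,
    has mean exactly [lam m] as soon as m <= N, and the remainder divided by z ^ m is O(eps). *)
Lemma mean_lim_coef rho m : 0 < rho < 1 ->
  mean_lim (fun z => phi z * / z ^ m)%C rho (lam m).
Proof.
intros Hr; destruct (phi_jets rho m Hr) as [K HK].
(* The jets give K without a sign, whereas a nonnegative constant is required here. *)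
apply (mean_lim_of_small_radius _ _ _ (Rmax K 0)); [lra|apply Rmax_r| |].
- intros eps He.
  assert (HK1 : forall z, eps <= Cmod z <= rho -> Cmod z <= 1) by (intros; lra).
  apply (holo_mult _ phi (fun z => / z ^ m)%C HK1).
  + apply (holo_sub (fun z => Cmod z <= rho)); [intros; lra|auto].
  + apply (holo_inv _ _ (eps ^ m) HK1); [apply pow_lt; lra| |now apply holo_pow].
    intros z Hz; rewrite Cmod_pow; apply pow_incr; lra.
- intros eps He; exists m; intros N HN.
  rewrite <- (ring_mean_jet N lam m eps) by (easy || lra).
  rewrite <- ring_mean_minus; apply Cmod_ring_mean_le; intros k.
  assert (Hz := Cmod_circle N k eps ltac:(lra)).
  set (z := (eps * root N ^ k)%C) in *.
  assert (z <> RtoC 0) by (intros E; rewrite E, Cmod_0 in Hz; lra).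
  replace (phi z * / z ^ m - sum_n (fun k => lam k * z ^ k)%C m * / z ^ m)%C
    with ((phi z - sum_n (fun k => lam k * z ^ k)%C m) * / z ^ m)%C by ring.
  rewrite Cmod_mult, Cmod_inv, Cmod_pow, Hz by now apply Cpow_nz.
  assert (A := HK z ltac:(lra)); rewrite Hz in A.
  assert (P : 0 < eps ^ m) by (apply pow_lt; lra).
  apply Rle_trans with (K * eps ^ S m * / eps ^ m).
  + apply Rmult_le_compat_r; [apply Rlt_le, Rinv_0_lt_compat, P|easy].
  + replace (K * eps ^ S m * / eps ^ m) with (K * eps) by (cbn; field; lra).
    apply Rmult_le_compat_r; [lra|apply Rmax_l].
Qed.

(** On the circle of radius eps boundedness of [phi] makes the integrand O(eps), because m > 0. *)
Lemma mean_lim_negcoef rho m : 0 < rho < 1 -> (0 < m)%nat ->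
  mean_lim (fun z => phi z * z ^ m)%C rho (RtoC 0).
Proof.
intros Hr Hm; destruct (phi_holo rho Hr) as (D & M & M0 & B & _).
apply (mean_lim_of_small_radius _ _ _ M); [lra|easy| |].
- intros eps He.
  assert (HK1 : forall z, eps <= Cmod z <= rho -> Cmod z <= 1) by (intros; lra).
  apply (holo_mult _ phi (fun z => z ^ m)%C HK1); [|now apply holo_pow].
  apply (holo_sub (fun z => Cmod z <= rho)); [intros; lra|auto].
- intros eps He; exists O; intros N _.
  replace (ring_mean N (fun z => phi z * z ^ m)%C eps - 0)%C
    with (ring_mean N (fun z => phi z * z ^ m)%C eps) by ring.
  apply Cmod_ring_mean_le; intros k.
  assert (Hz := Cmod_circle N k eps ltac:(lra)).
  set (z := (eps * root N ^ k)%C) in *.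
  destruct (B z ltac:(lra)) as [A _].
  rewrite Cmod_mult, Cmod_pow, Hz.
  apply Rmult_le_compat; auto using Cmod_ge_0; [apply pow_le; lra|].
  destruct m as [|m]; [lia|].
  cbn; rewrite <- (Rmult_1_r eps) at 3; apply Rmult_le_compat_l; [lra|].
  rewrite <- (pow1 m); apply pow_incr; lra.
Qed.

(** On the circle conj(z / rho) = rho / z, so the bracket is the real trigonometric polynomial 2 Re
    (B (z / rho)^m), written without conjugating z so that only powers of z are averaged. *)
Lemma mean_lim_trig rho (B : C) m : 0 < rho < 1 -> (0 < m)%nat ->
  mean_lim (fun z => phi z * (B * (z ^ m * / rho ^ m)
     + Cconj B * (rho ^ m * / z ^ m)))%C rho (Cconj B * (rho ^ m * lam m))%C.
Proof.
intros Hr Hm.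
assert (A := mean_lim_plus _ _ _ _ _
  (mean_lim_scal (B * / rho ^ m)%C _ _ _ (mean_lim_negcoef rho m Hr Hm))
  (mean_lim_scal (Cconj B * rho ^ m)%C _ _ _ (mean_lim_coef rho m Hr))).
replace (Cconj B * (rho ^ m * lam m))%C with
  (B * / rho ^ m * 0 + Cconj B * rho ^ m * lam m)%C by ring.
eapply mean_lim_ext; [lra| |exact A].
intros z _; cbv beta; ring.
Qed.

Hypothesis phi_pos : forall z, Cmod z < 1 -> 0 <= Re (phi z).
Hypothesis lam0 : lam O = RtoC 1.

(* The real part of phi is tested against |al + be e + ga e^(j+1)|^2 with
   e = z / rho on the circle of radius rho, which is a trigonometric polynomial. *)
Lemma toeplitz_form_radius rho j (al be ga : C) : 0 < rho < 1 -> (0 < j)%nat ->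
  0 <= Cmod al ^ 2 + Cmod be ^ 2 + Cmod ga ^ 2
     + Re (al * Cconj be * (rho * lam 1%nat))
     + Re (al * Cconj ga * (rho ^ S j * lam (S j)))
     + Re (be * Cconj ga * (rho ^ j * lam j)).
Proof.
intros Hr Hj.
assert (HL := mean_lim_plus _ _ _ _ _ (mean_lim_plus _ _ _ _ _
 (mean_lim_plus _ _ _ _ _
  (mean_lim_scal (al * Cconj al + be * Cconj be + ga * Cconj ga)%C _ _ _
     (mean_lim_coef rho 0 Hr))
  (mean_lim_trig rho (Cconj al * be)%C 1 Hr Nat.lt_0_1))
  (mean_lim_trig rho (Cconj al * ga)%C (S j) Hr (Nat.lt_0_succ j)))
  (mean_lim_trig rho (Cconj be * ga)%C j Hr Hj)).
apply mean_lim_Re_ge0 in HL; [|lra|].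
- rewrite lam0, !Cmult_conj, !Cconj_conj, <- !Cmod2_conj in HL.
  rewrite !re_plus, Cmult_1_r, !re_plus, <- !RtoC_pow, !re_RtoC in HL.
  rewrite !pow_1, !RtoC_pow in HL; exact HL.
- intros z Hz.
  assert (Hr0 : RtoC rho <> RtoC 0) by (intros E; apply RtoC_inj in E; lra).
  assert (Hz0 : z <> RtoC 0) by (intros E; rewrite E, Cmod_0 in Hz; lra).
  assert (Hc := Cconj_circle z rho Hz ltac:(lra)).
  set (E := ((z * / rho) ^ j)%C).
  set (e := (z * / rho)%C).
  set (w := (al + be * e + ga * (e * E))%C).
  assert (Hec : Cconj e = (rho * / z)%C).
  { unfold e; rewrite Cmult_conj, Hc.
    replace (Cconj (/ rho)) with (/ rho)%C.
    - rewrite RtoC_pow; cbn [Cpow]; field; easy.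
    - rewrite <- RtoC_inv by lra; apply injective_projections; cbn; ring. }
  assert (Hej : forall n, (z ^ n * / rho ^ n)%C = (e ^ n)%C).
  { intros n; unfold e; rewrite Cpow_mult_l, Cpow_inv; easy. }
  assert (Hejc : forall n, (rho ^ n * / z ^ n)%C = Cconj (e ^ n)%C).
  { intros n; rewrite Cpow_conj, Hec, Cpow_mult_l, Cpow_inv; easy. }
  assert (He1 : (e * Cconj e)%C = RtoC 1) by (rewrite Hec; unfold e; field; easy).
  assert (HE1 : (E * Cconj E)%C = RtoC 1).
  { unfold E; fold e; rewrite Cpow_conj, <- Cpow_mult_l, He1; apply Cpow_1_l. }
  rewrite !Hej, !Hejc, !Cmult_conj, !Cconj_conj, !Cpow_S.
  change (e ^ 0)%C with (RtoC 1); rewrite (Cmult_1_r e); change (e ^ j)%C with E.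
  assert (Heq : ((al * Cconj al + be * Cconj be + ga * Cconj ga) * (phi z * / z ^ 0) +
     phi z * (Cconj al * be * e + al * Cconj be * Cconj e) +
     phi z * (Cconj al * ga * (e * E) + al * Cconj ga * Cconj (e * E)) +
     phi z * (Cconj be * ga * E + be * Cconj ga * Cconj E))%C
     = (phi z * RtoC (Cmod w ^ 2))%C).
  { rewrite Cmod2_conj; unfold w.
    rewrite !Cplus_conj, !Cmult_conj.
    revert He1 HE1; generalize (Cconj e) (Cconj E); intros e' E' He1 HE1.
    cbn [Cpow].
    transitivity (phi z * (al * Cconj al + be * Cconj be * (e * e')
       + ga * Cconj ga * ((e * e') * (E * E'))
       + Cconj al * be * e + al * Cconj be * e'
       + Cconj al * ga * (e * E) + al * Cconj ga * (e' * E')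
       + Cconj be * ga * E * (e * e') + be * Cconj ga * E' * (e * e')))%C.
    - rewrite He1, HE1; field; intros Q; injection Q; lra.
    - ring. }
  rewrite Heq, re_scal_r.
  apply Rmult_le_pos; [apply phi_pos; lra|apply pow2_ge_0].
Qed.

(** The form is polynomial in the radius, so positivity passes by continuity to rho = 1 although
    [phi] is controlled only inside the disc. *)
Lemma toeplitz_form j (al be ga : C) : (0 < j)%nat ->
  0 <= Cmod al ^ 2 + Cmod be ^ 2 + Cmod ga ^ 2
     + Re (al * Cconj be * lam 1%nat)
     + Re (al * Cconj ga * lam (S j)) + Re (be * Cconj ga * lam j).
Proof.
intros Hj.
set (g := fun rho : R => Cmod al ^ 2 + Cmod be ^ 2 + Cmod ga ^ 2
     + rho * Re (al * Cconj be * lam 1%nat)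
     + rho ^ S j * Re (al * Cconj ga * lam (S j))
     + rho ^ j * Re (be * Cconj ga * lam j)).
assert (Hg : forall rho, 0 < rho < 1 -> 0 <= g rho).
{ intros rho Hr; assert (A := toeplitz_form_radius rho j al be ga Hr Hj).
  assert (sw : forall (x y : C) (t : R), Re (x * (t * y)) = t * Re (x * y))
    by (intros; rewrite <- re_scal_l; f_equal; ring).
  rewrite <- !RtoC_pow, !sw in A; exact A. }
assert (Hc : continuous g 1).
{ apply (ex_derive_continuous (K := R_AbsRing) (V := R_NormedModule) g 1).
  unfold g; auto_derive; easy. }
replace (Cmod al ^ 2 + _ + _ + _ + _ + _) with (g 1)
  by (unfold g; rewrite !pow1; ring).
apply Rnot_lt_le; intros Hn.
assert (e0 : 0 < - g 1 / 2) by lra.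
destruct (proj1 (filterlim_locally g (g 1)) Hc (mkposreal _ e0)) as [d Hd].
set (r := 1 - Rmin (d / 2) (1 / 2)).
assert (d0 := cond_pos d).
assert (0 < Rmin (d / 2) (1 / 2)) by (apply Rmin_glb_lt; lra).
assert (A1 := Rmin_l (d / 2) (1 / 2)); assert (A2 := Rmin_r (d / 2) (1 / 2)).
assert (P := Hg r ltac:(unfold r; lra)).
assert (Q : ball 1 d r).
{ change (Rabs (r - 1) < d); apply Rabs_lt_between; unfold r; lra. }
apply Hd in Q; change (Rabs (g r - g 1) < - g 1 / 2) in Q.
apply Rabs_lt_between in Q; lra.
Qed.

Lemma caratheodory_le2 n : (0 < n)%nat -> Cmod (lam n) <= 2.
Proof.
intros Hn.
(* For this vector the form equals 2 |lam n|^2 - |lam n|^3. *)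
assert (A := toeplitz_form n 0 (- Cconj (lam n) * 1)%C (Cmod (lam n)) Hn).
assert (A0 := Cmod_ge_0 (lam n)).
destruct (Req_dec (Cmod (lam n)) 0) as [->|N]; [lra|].
rewrite Cmult_1_r, Cmod_opp, Cmod_conj, Cmod_0, Cmod_R, Rabs_pos_eq in A by easy.
replace (0 * Cconj (- Cconj (lam n)) * lam 1%nat)%C with (RtoC 0) in A by ring.
replace (0 * Cconj (Cmod (lam n)) * lam (S n))%C with (RtoC 0) in A by ring.
replace (Cconj (Cmod (lam n))) with (RtoC (Cmod (lam n))) in A
  by (apply injective_projections; cbn; ring).
replace (- Cconj (lam n) * Cmod (lam n) * lam n)%C with
  (- RtoC (Cmod (lam n)) * (lam n * Cconj (lam n)))%C in A by ring.
rewrite <- Cmod2_conj, re_RtoC, <- RtoC_opp, <- RtoC_mult, re_RtoC in A.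
assert (0 < Cmod (lam n)) by lra.
apply Rmult_le_reg_r with (Cmod (lam n) ^ 2); [apply pow_lt; easy|nra].
Qed.

(** When |lam 1| = 2, the vector with al = -conj(lam 1) / 2, be = 1 and ga = 0 is isotropic for a
    positive form, hence lies in its kernel. The part linear in [ga] then vanishes, which gives al
    lam (j+1) + lam j = 0. *)
Lemma caratheodory_extremal_step j : (0 < j)%nat -> Cmod (lam 1%nat) = 2 ->
  lam (S j) = (lam 1%nat / 2 * lam j)%C.
Proof.
intros Hj H1.
set (al := (- Cconj (lam 1%nat) / 2)%C).
set (x := (al * lam (S j) + lam j)%C).
assert (E1 : (lam 1%nat * Cconj (lam 1%nat))%C = RtoC 4).
{ rewrite <- Cmod2_conj, H1; f_equal; lra. }
assert (E2 : RtoC 2 <> RtoC 0) by (intros E; injection E; lra).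
assert (Hx : x = RtoC 0).
(* The form has become |ga|^2 + Re (conj(ga) x). Its minimum is -|x|^2 / 4, reached at ga = -x /
   2. *)
{ assert (A := toeplitz_form j al 1 (- (1 / 2)%R * x)%C Hj).
  assert (Hal : Cmod al = 1).
  { unfold al; rewrite Cmod_div, Cmod_opp, Cmod_conj, H1, Cmod_R, Rabs_pos_eq
      by (easy || lra); field. }
  replace (Cconj 1) with (RtoC 1) in A by (apply injective_projections; cbn; ring).
  replace (al * 1 * lam 1%nat)%C with (- RtoC 2)%C in A.
  2: { unfold al; transitivity (- (lam 1%nat * Cconj (lam 1%nat)) / 2)%C.
       - rewrite E1; apply injective_projections; cbn; field.
       - field; easy. }
  assert (R2 : Re (- RtoC 2)%C = - 2) by (cbn; ring).
  assert (Rx : Re (al * Cconj (- (1 / 2)%R * x) * lam (S j))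
    + Re (1 * Cconj (- (1 / 2)%R * x) * lam j) = - (1 / 2) * Cmod x ^ 2).
  { rewrite <- re_plus, <- re_RtoC, RtoC_mult, Cmod2_conj; f_equal.
    rewrite Cmult_conj.
    replace (Cconj (- (1 / 2)%R)) with (RtoC (- (1 / 2)))
      by (apply injective_projections; cbn; ring).
    unfold x; ring. }
  rewrite Hal, Cmod_1, R2, Cmod_mult, Cmod_opp, Cmod_R, Rabs_pos_eq in A by lra.
  apply Cmod_eq_0; assert (A0 := Cmod_ge_0 x); nra. }
assert (E3 : lam (S j) = ((lam 1%nat * Cconj (lam 1%nat)) / 4 * lam (S j))%C).
{ rewrite E1; field; intros E; injection E; lra. }
assert (E4 : lam j = (- al * lam (S j))%C).
{ replace (lam j) with (x - al * lam (S j))%C by (unfold x; ring).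
  rewrite Hx; ring. }
rewrite E4, E3 at 1; unfold al; field.
Qed.

Lemma caratheodory_extremal n : (0 < n)%nat -> Cmod (lam 1%nat) = 2 ->
  lam n = (2 * (lam 1%nat / 2) ^ n)%C.
Proof.
intros Hn H1; induction n as [|n IH]; [lia|].
assert (E2 : RtoC 2 <> RtoC 0) by (intros E; injection E; lra).
destruct n as [|n].
- rewrite Cpow_1_r; field; easy.
- rewrite caratheodory_extremal_step, IH, (Cpow_S _ (S n)) by (easy || lia); ring.
Qed.

End Caratheodory.

(** * Complex power series with real coefficients *)

Ltac Rring := match goal with |- @eq _ ?x ?y => change (@eq R x y) end; ring.

Definition conv_disc (c : nat -> R) : Prop :=
  forall r, 0 <= r < 1 -> ex_series (fun n => Rabs (c n) * r ^ n).

Lemma conv_disc_CV_radius c : conv_disc c <-> Rbar_le 1 (CV_radius c).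
Proof.
split.
- intros Hc; apply Rbar_not_lt_le; intros Hlt.
  assert (R0 := CV_radius_ge_0 c).
  destruct (CV_radius c) as [r| |] eqn:E; cbn in Hlt, R0; try easy.
  assert (Ht : 0 <= (r + 1) / 2 < 1) by lra.
  apply (CV_disk_outside c ((r + 1) / 2)).
  + rewrite E, Rabs_pos_eq by lra; cbn; lra.
  + apply ex_series_lim_0, ex_series_Rabs.
    generalize (Hc _ Ht); apply ex_series_ext; intros n.
    rewrite Rabs_mult, (Rabs_pos_eq (_ ^ _)); [easy|apply pow_le; lra].
- intros Hc r Hr.
  assert (A : ex_series (fun n => Rabs (c n * r ^ n))).
  { apply CV_disk_inside; rewrite Rabs_pos_eq by lra.
    eapply Rbar_lt_le_trans; [|exact Hc]; cbn; lra. }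
  revert A; apply ex_series_ext; intros n.
  rewrite Rabs_mult, (Rabs_pos_eq (_ ^ _)); [easy|apply pow_le; lra].
Qed.

Lemma conv_disc_derive c : conv_disc c -> conv_disc (PS_derive c).
Proof. rewrite !conv_disc_CV_radius, CV_radius_derive; easy. Qed.

Lemma conv_disc_of_ex_pseries c :
  (forall t, 0 <= t < 1 -> ex_pseries c t) -> conv_disc c.
Proof.
intros Hc; apply conv_disc_CV_radius, Rbar_not_lt_le; intros Hlt.
assert (R0 := CV_radius_ge_0 c).
destruct (CV_radius c) as [r| |] eqn:E; cbn in Hlt, R0; try easy.
assert (Ht : 0 <= (r + 1) / 2 < 1) by lra.
apply (CV_disk_outside c ((r + 1) / 2)).
- rewrite E, Rabs_pos_eq by lra; cbn; lra.
- apply ex_series_lim_0; generalize (Hc _ Ht); apply ex_series_ext; intros n.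
  rewrite pow_n_pow; unfold scal; cbn; unfold mult; cbn; ring.
Qed.

Definition CSeries (u : nat -> C) : C :=
  (Series (fun n => Re (u n)), Series (fun n => Im (u n))).

Lemma im_le_Cmod c : Rabs (Im c) <= Cmod c.
Proof. exact (Rle_trans _ _ _ (Rmax_r _ _) (Rmax_Cmod c)). Qed.

Lemma ex_series_dom (u b : nat -> R) :
  (forall n, Rabs (u n) <= b n) -> ex_series b -> ex_series u.
Proof. intros H; apply (@ex_series_le R_AbsRing R_CompleteNormedModule); exact H. Qed.

Lemma Series_Rabs_le (u b : nat -> R) :
  (forall n, Rabs (u n) <= b n) -> ex_series b -> Rabs (Series u) <= Series b.
Proof.
intros H Hb; eapply Rle_trans; [apply Series_Rabs|apply Series_le; auto].
- apply (ex_series_dom _ b); [intros n; rewrite Rabs_Rabsolu; auto|easy].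
- intros n; split; [apply Rabs_pos|auto].
Qed.

Lemma CSeries_bound u b : (forall n, Cmod (u n) <= b n) -> ex_series b ->
  Cmod (CSeries u) <= 2 * Series b.
Proof.
intros H Hb.
assert (A : Rabs (Series (fun n => Re (u n))) <= Series b).
{ apply Series_Rabs_le; [|easy]; intros n.
  eapply Rle_trans; [apply re_le_Cmod|auto]. }
assert (B : Rabs (Series (fun n => Im (u n))) <= Series b).
{ apply Series_Rabs_le; [|easy]; intros n.
  eapply Rle_trans; [apply im_le_Cmod|auto]. }
replace (CSeries u) with (RtoC (fst (CSeries u)) + Ci * RtoC (snd (CSeries u)))%C
  by (apply injective_projections; cbn; ring).
eapply Rle_trans; [apply Cmod_triangle|].
rewrite Cmod_mult, Cmod_Ci, !Cmod_R; cbn [fst snd CSeries]; lra.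
Qed.

(** Real coefficients are enough: a quaternionic series enters through its four components, each
    summed at a complex point. *)
Definition cps (c : nat -> R) (z : C) : C := CSeries (fun n => RtoC (c n) * z ^ n)%C.

Lemma cps_ex c z : conv_disc c -> Cmod z < 1 ->
  ex_series (fun n => Re (RtoC (c n) * z ^ n)%C) /\
  ex_series (fun n => Im (RtoC (c n) * z ^ n)%C).
Proof.
intros Hc Hz; specialize (Hc (Cmod z) (conj (Cmod_ge_0 z) Hz)).
assert (B : forall n, Cmod (RtoC (c n) * z ^ n)%C <= Rabs (c n) * Cmod z ^ n)
  by (intros n; rewrite Cmod_mult, Cmod_pow, Cmod_R; lra).
split; eapply ex_series_dom; try exact Hc; intros n;
  (eapply Rle_trans; [apply re_le_Cmod || apply im_le_Cmod|apply B]).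
Qed.

Lemma cps_bound c rho : conv_disc c -> 0 <= rho < 1 ->
  forall z, Cmod z <= rho ->
  Cmod (cps c z) <= 2 * Series (fun n => Rabs (c n) * rho ^ n).
Proof.
intros Hc Hr z Hz; apply CSeries_bound; auto.
intros n; rewrite Cmod_mult, Cmod_pow, Cmod_R.
apply Rmult_le_compat_l; [apply Rabs_pos|apply pow_incr].
split; [apply Cmod_ge_0|easy].
Qed.

(* The exponent n - 2 is truncated, but the bound vanishes when n < 2. *)
Lemma pow_second_order (z w : C) rho n :
  Cmod z <= rho -> Cmod w <= rho ->
  Cmod (w ^ n - z ^ n - (w - z) * (INR n * z ^ pred n))%C
  <= INR n * INR (pred n) * rho ^ (n - 2) * Cmod (w - z)%C ^ 2.
Proof.
intros Hz Hw; assert (z0 := Cmod_ge_0 z).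
assert (d0 : 0 <= Cmod (w - z)%C ^ 2) by apply pow2_ge_0.
assert (key : forall n, Cmod (w ^ S n - z ^ S n - (w - z) * (INR (S n) * z ^ n))%C
  <= INR (S n) * INR n * rho ^ pred n * Cmod (w - z)%C ^ 2).
{ clear n; induction n as [|n IH].
  - replace (w ^ 1 - z ^ 1 - (w - z) * (INR 1 * z ^ 0))%C with (RtoC 0)
      by (cbn [Cpow]; change (INR 1) with 1; ring).
    rewrite Cmod_0; change (INR 0) with 0; lra.
  - replace (w ^ S (S n) - z ^ S (S n) - (w - z) * (INR (S (S n)) * z ^ S n))%C
      with (w * (w ^ S n - z ^ S n - (w - z) * (INR (S n) * z ^ n))
            + (w - z) * (w - z) * (INR (S n) * z ^ n))%C.
    2: { rewrite (S_INR (S n)), RtoC_plus; cbn [Cpow]; ring. }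
    eapply Rle_trans; [apply Cmod_triangle|].
    rewrite !Cmod_mult, Cmod_pow, Cmod_R, Rabs_pos_eq by apply pos_INR.
    assert (n0 := pos_INR n).
    assert (A : Cmod z ^ n <= rho ^ n) by (apply pow_incr; lra).
    assert (r0 : 0 <= rho ^ n) by (apply pow_le; lra).
    apply Rle_trans with (rho * (INR (S n) * INR n * rho ^ pred n * Cmod (w - z)%C ^ 2)
      + Cmod (w - z)%C ^ 2 * (INR (S n) * rho ^ n)).
    + apply Rplus_le_compat.
      * apply Rmult_le_compat; auto using Cmod_ge_0.
      * replace (Cmod (w - z)%C * Cmod (w - z)%C) with (Cmod (w - z)%C ^ 2) by ring.
        apply Rmult_le_compat_l; [easy|].
        apply Rmult_le_compat_l; [apply pos_INR|easy].
    + replace (pred (S n)) with n by easy.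
      assert (B : rho * (INR n * rho ^ pred n) = INR n * rho ^ n)
        by (destruct n; [cbn; ring|cbn [pred pow]; ring]).
      replace (rho * (INR (S n) * INR n * rho ^ pred n * Cmod (w - z)%C ^ 2))
        with (INR (S n) * (rho * (INR n * rho ^ pred n)) * Cmod (w - z)%C ^ 2) by ring.
      rewrite B, !S_INR.
      set (d := Cmod (w - z)%C ^ 2) in *.
      assert (0 <= rho ^ n * d) by (apply Rmult_le_pos; easy).
      assert (0 <= INR n * (rho ^ n * d)) by (apply Rmult_le_pos; easy).
      nra. }
destruct n as [|n].
- change (INR 0) with 0.
  replace (w ^ 0 - z ^ 0 - (w - z) * (0 * z ^ pred 0))%C with (RtoC 0)
    by (cbn [Cpow]; ring).
  rewrite Cmod_0; lra.
- replace (S n - 2)%nat with (pred n) by lia; apply key.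
Qed.

Lemma ex_series_pow_second_order c rho : conv_disc c -> 0 <= rho < 1 ->
  ex_series (fun n => Rabs (c n) * (INR n * INR (pred n) * rho ^ (n - 2))).
Proof.
intros Hc Hr; apply (ex_series_incr_n _ 2).
generalize (conv_disc_derive _ (conv_disc_derive _ Hc) rho Hr).
apply ex_series_ext; intros n; unfold PS_derive.
rewrite !Rabs_mult, !(Rabs_pos_eq (INR _)) by apply pos_INR.
replace (2 + n - 2)%nat with n by lia.
replace (pred (2 + n)) with (S n) by easy.
change (2 + n)%nat with (S (S n)).
Rring.
Qed.

(** The estimate is termwise: the quadratic remainders of the powers sum to at most the series of n
    (n - 1) |c n| rho^(n-2), which converges as the second derivative does. The factors 2 come from
    bounding real and imaginary parts separately. *)
Lemma holo_cps c rho : conv_disc c -> 0 <= rho < 1 ->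
  unif_holo (fun z => Cmod z <= rho) (cps c) (cps (PS_derive c)).
Proof.
intros Hc Hr; assert (Hd := conv_disc_derive c Hc).
set (T := fun n => Rabs (c n) * (INR n * INR (pred n) * rho ^ (n - 2))).
assert (HT : ex_series T) by now apply ex_series_pow_second_order.
assert (P : forall b : nat -> R, (forall n, 0 <= b n) -> ex_series b -> 0 <= Series b).
{ intros b Hb Eb; rewrite <- (Rmult_0_l (Series b)), <- Series_scal_l.
  apply Series_le; [|easy]; intros n; specialize (Hb n); lra. }
set (s0 := Series (fun n => Rabs (c n) * rho ^ n)).
set (s1 := Series (fun n => Rabs (PS_derive c n) * rho ^ n)).
assert (0 <= s0).
{ apply P; [|auto]; intros n; apply Rmult_le_pos; [apply Rabs_pos|apply pow_le; lra]. }
assert (0 <= s1).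
{ apply P; [|auto]; intros n; apply Rmult_le_pos; [apply Rabs_pos|apply pow_le; lra]. }
assert (0 <= Series T).
{ apply P; [|auto]; intros n; apply Rmult_le_pos; [apply Rabs_pos|].
  apply Rmult_le_pos; [apply Rmult_le_pos; apply pos_INR|apply pow_le; lra]. }
exists (2 * s0 + 2 * s1 + 2 * Series T); split; [lra|]; split.
- intros z Hz; split.
  + assert (A := cps_bound c rho Hc Hr z Hz); fold s0 in A; lra.
  + assert (A := cps_bound _ rho Hd Hr z Hz); fold s1 in A; lra.
- intros z w Hz Hw.
  set (h := (w - z)%C).
  set (t := fun n => (RtoC (c n) * (w ^ n - z ^ n - h * (INR n * z ^ pred n)))%C).
  set (D := fun n => (RtoC (c n) * (INR n * z ^ pred n))%C).
  assert (ED : cps (PS_derive c) z = CSeries D).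
  { unfold cps, CSeries; f_equal; symmetry.
    - rewrite Series_incr_1_aux.
      + apply Series_ext; intros n; unfold D, PS_derive; cbn [pred].
        rewrite RtoC_mult, (Cmult_comm (INR (S n)) (c (S n))), <- Cmult_assoc; easy.
      + unfold D; change (INR 0) with 0; rewrite Cmult_0_l, Cmult_0_r; easy.
    - rewrite Series_incr_1_aux.
      + apply Series_ext; intros n; unfold D, PS_derive; cbn [pred].
        rewrite RtoC_mult, (Cmult_comm (INR (S n)) (c (S n))), <- Cmult_assoc; easy.
      + unfold D; change (INR 0) with 0; rewrite Cmult_0_l, Cmult_0_r; easy. }
  assert (HD : ex_series (fun n => Re (D n)) /\ ex_series (fun n => Im (D n))).
  { destruct (cps_ex _ z Hd ltac:(lra)) as [E1 E2].
    split; apply ex_series_incr_1; [revert E1|revert E2]; apply ex_series_ext;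
      intros n; unfold D, PS_derive; cbn [pred]; rewrite RtoC_mult, (Cmult_comm (INR (S n)) (c (S n))), <- Cmult_assoc; easy. }
  destruct (cps_ex c z Hc ltac:(lra)) as [Z1 Z2].
  destruct (cps_ex c w Hc ltac:(lra)) as [W1 W2].
  destruct HD as [D1 D2].
  assert (Et : (cps c w - cps c z - h * cps (PS_derive c) z)%C = CSeries t).
  { rewrite ED; unfold cps, CSeries.
    apply Series_correct in Z1; apply Series_correct in Z2;
    apply Series_correct in W1; apply Series_correct in W2;
    apply Series_correct in D1; apply Series_correct in D2.
    apply injective_projections; cbn [fst snd Cminus Cplus Copp Cmult]; symmetry;
      apply is_series_unique.
    - generalize (is_series_minus _ _ _ _ (is_series_minus _ _ _ _ W1 Z1)
        (is_series_minus _ _ _ _ (is_series_scal (fst h) _ _ D1)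
           (is_series_scal (snd h) _ _ D2))).
      match goal with |- is_series _ ?x -> is_series _ ?y => replace y with x end.
      2: { unfold plus, opp, scal, minus; cbn; unfold mult; cbn.
           unfold CSeries; cbn; ring. }
      apply is_series_ext; intros n; unfold t, D.
      unfold plus, opp, scal; cbn; unfold mult; cbn; ring.
    - generalize (is_series_minus _ _ _ _ (is_series_minus _ _ _ _ W2 Z2)
        (is_series_plus _ _ _ _ (is_series_scal (fst h) _ _ D2)
           (is_series_scal (snd h) _ _ D1))).
      match goal with |- is_series _ ?x -> is_series _ ?y => replace y with x end.
      2: { unfold plus, opp, scal, minus; cbn; unfold mult; cbn.
           unfold CSeries; cbn; ring. }
      apply is_series_ext; intros n; unfold t, D.
      unfold plus, opp, scal; cbn; unfold mult; cbn; ring. }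
  rewrite Et; fold h.
  apply Rle_trans with (2 * Series (fun n => T n * Cmod h ^ 2)).
  + apply CSeries_bound.
    * intros n; unfold t, T; rewrite Cmod_mult, Cmod_R, Rmult_assoc.
      apply Rmult_le_compat_l; [apply Rabs_pos|].
      now apply pow_second_order.
    * now apply ex_series_scal_r.
  + rewrite Series_scal_r.
    assert (0 <= Cmod h ^ 2) by apply pow2_ge_0; nra.
Qed.

(** * Quaternionic power series and the slice derivative *)

Lemma Hmod_ge0 q : 0 <= Hmod q.
Proof. apply sqrt_pos. Qed.

Lemma hre_le q : Rabs (hre q) <= Hmod q. Proof. apply Hcomp_le_mod. Qed.
Lemma him1_le q : Rabs (him1 q) <= Hmod q. Proof. apply Hcomp_le_mod. Qed.
Lemma him2_le q : Rabs (him2 q) <= Hmod q. Proof. apply Hcomp_le_mod. Qed.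
Lemma him3_le q : Rabs (him3 q) <= Hmod q. Proof. apply Hcomp_le_mod. Qed.

Lemma hre_scal x q : hre (RtoH x * q)%H = x * hre q. Proof. hred; ring. Qed.
Lemma him1_scal x q : him1 (RtoH x * q)%H = x * him1 q. Proof. hred; ring. Qed.
Lemma him2_scal x q : him2 (RtoH x * q)%H = x * him2 q. Proof. hred; ring. Qed.
Lemma him3_scal x q : him3 (RtoH x * q)%H = x * him3 q. Proof. hred; ring. Qed.

Lemma Hmod_sq q : Hmod q ^ 2 = Hnorm2 q.
Proof. unfold Hmod; rewrite pow2_sqrt; [easy|apply Hnorm2_ge0]. Qed.

Lemma Hmod_le_of_Hnorm2 q b : 0 <= b -> Hnorm2 q <= b ^ 2 -> Hmod q <= b.
Proof.
intros Hb H; unfold Hmod; rewrite <- (sqrt_pow2 b Hb); now apply sqrt_le_1_alt.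
Qed.

Lemma Hmod_RtoH x : Hmod (RtoH x) = Rabs x.
Proof.
unfold Hmod; replace (Hnorm2 (RtoH x)) with (Rsqr x) by (unfold Rsqr; hred; ring).
apply sqrt_Rsqr_abs.
Qed.

Lemma Hmod_1 : Hmod (RtoH 1) = 1.
Proof. rewrite Hmod_RtoH; apply Rabs_R1. Qed.

Lemma Hmod_opp q : Hmod (- q)%H = Hmod q.
Proof. unfold Hmod; f_equal; hred; ring. Qed.

Lemma Hmod_conj q : Hmod (Hconj q) = Hmod q.
Proof. unfold Hmod; f_equal; hred; ring. Qed.

Lemma Hmod_pow q n : Hmod (pow_n q n) = Hmod q ^ n.
Proof.
induction n as [|n IH]; [apply Hmod_1|].
cbn [pow_n pow]; rewrite <- IH; apply Hmod_mult.
Qed.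

Lemma Hmod_le_sum q :
  Hmod q <= Rabs (hre q) + Rabs (him1 q) + Rabs (him2 q) + Rabs (him3 q).
Proof.
assert (P0 := Rabs_pos (hre q)); assert (P1 := Rabs_pos (him1 q));
assert (P2 := Rabs_pos (him2 q)); assert (P3 := Rabs_pos (him3 q)).
apply Hmod_le_of_Hnorm2; [lra|].
unfold Hnorm2; rewrite <- (pow2_abs (hre q)), <- (pow2_abs (him1 q)),
  <- (pow2_abs (him2 q)), <- (pow2_abs (him3 q)); nra.
Qed.

Lemma Hmod_pos q : q <> RtoH 0 -> 0 < Hmod q.
Proof.
intros Hq; destruct (Hmod_ge0 q) as [|E]; [easy|].
now elim Hq; apply Hmod_eq0.
Qed.

Lemma Hnorm2_neq0 q : q <> RtoH 0 -> Hnorm2 q <> 0.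
Proof.
intros Hq E; assert (A := Hmod_pos q Hq).
unfold Hmod in A; rewrite E, sqrt_0 in A; lra.
Qed.

Lemma Hinv_l q : q <> RtoH 0 -> (/ q * q)%H = RtoH 1.
Proof.
intros Hq; assert (A := Hnorm2_neq0 q Hq); unfold Hinv.
transitivity (RtoH (/ Hnorm2 q * Hnorm2 q)).
- unfold Hnorm2 at 2; hring.
- now rewrite Rinv_l.
Qed.

Lemma Hinv_r q : q <> RtoH 0 -> (q * / q)%H = RtoH 1.
Proof.
intros Hq; assert (A := Hnorm2_neq0 q Hq); unfold Hinv.
transitivity (RtoH (/ Hnorm2 q * Hnorm2 q)).
- unfold Hnorm2 at 2; hring.
- now rewrite Rinv_l.
Qed.

Lemma H1_neq0 : RtoH 1 <> RtoH 0.
Proof. intros E; apply (f_equal hre) in E; cbn in E; lra. Qed.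

Lemma Hmult_0_l q : (RtoH 0 * q)%H = RtoH 0. Proof. hring. Qed.
Lemma Hmult_0_r q : (q * RtoH 0)%H = RtoH 0. Proof. hring. Qed.

Lemma Hinv_unique p q : (p * q)%H = RtoH 1 -> (/ q)%H = p.
Proof.
intros E.
assert (Hq : q <> RtoH 0).
{ intros Z; apply H1_neq0; rewrite <- E, Z; apply Hmult_0_r. }
rewrite <- (Hmult_1_l (/ q)%H), <- E, <- Hmult_assoc, Hinv_r by easy.
apply Hmult_1_r.
Qed.

(** Summation by components lets the results on real series apply directly; [hsum_is_series]
    identifies it with convergence in the normed space of quaternions. *)
Definition hsum (u : nat -> H) (l : H) : Prop :=
  is_series (fun n => hre (u n)) (hre l) /\
  is_series (fun n => him1 (u n)) (him1 l) /\
  is_series (fun n => him2 (u n)) (him2 l) /\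
  is_series (fun n => him3 (u n)) (him3 l).

Lemma hsum_HSeries u l : hsum u l -> HSeries u = l.
Proof.
intros (H0 & H1 & H2 & H3); unfold HSeries.
apply H_ext; cbn; now apply is_series_unique.
Qed.

Lemma hsum_ext u v l : (forall n, u n = v n) -> hsum u l -> hsum v l.
Proof.
intros E (H0 & H1 & H2 & H3); split; [|split; [|split]];
  (eapply is_series_ext; [intros n; rewrite <- E; reflexivity|assumption]).
Qed.

Lemma hsum_plus u v l m : hsum u l -> hsum v m ->
  hsum (fun n => u n + v n)%H (l + m)%H.
Proof.
intros (H0 & H1 & H2 & H3) (K0 & K1 & K2 & K3); split; [|split; [|split]].
- exact (is_series_plus _ _ _ _ H0 K0).
- exact (is_series_plus _ _ _ _ H1 K1).
- exact (is_series_plus _ _ _ _ H2 K2).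
- exact (is_series_plus _ _ _ _ H3 K3).
Qed.

(** Multiplication by a fixed quaternion, on either side, makes each component of the product a
    linear form in the four components of the other factor. *)
Lemma is_series_lin4 (u : nat -> H) (l : H) (c0 c1 c2 c3 : R) (v : nat -> R) (m : R) :
  hsum u l ->
  (forall n, v n = c0 * hre (u n) + c1 * him1 (u n) + c2 * him2 (u n) + c3 * him3 (u n)) ->
  m = c0 * hre l + c1 * him1 l + c2 * him2 l + c3 * him3 l ->
  is_series v m.
Proof.
intros (H0 & H1 & H2 & H3) Hv ->.
generalize (is_series_plus _ _ _ _ (is_series_plus _ _ _ _ (is_series_plus _ _ _ _
  (is_series_scal c0 _ _ H0) (is_series_scal c1 _ _ H1))
  (is_series_scal c2 _ _ H2)) (is_series_scal c3 _ _ H3)).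
apply is_series_ext; intros n; rewrite Hv; easy.
Qed.

Lemma hsum_lmul p u l : hsum u l -> hsum (fun n => p * u n)%H (p * l)%H.
Proof.
intros H; split; [|split; [|split]].
- eapply (is_series_lin4 u l (hre p) (- him1 p) (- him2 p) (- him3 p) _ _ H);
    intros; hred; ring.
- eapply (is_series_lin4 u l (him1 p) (hre p) (- him3 p) (him2 p) _ _ H);
    intros; hred; ring.
- eapply (is_series_lin4 u l (him2 p) (him3 p) (hre p) (- him1 p) _ _ H);
    intros; hred; ring.
- eapply (is_series_lin4 u l (him3 p) (- him2 p) (him1 p) (hre p) _ _ H);
    intros; hred; ring.
Qed.

Lemma hsum_rmul p u l : hsum u l -> hsum (fun n => u n * p)%H (l * p)%H.
Proof.
intros H; split; [|split; [|split]].
- eapply (is_series_lin4 u l (hre p) (- him1 p) (- him2 p) (- him3 p) _ _ H);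
    intros; hred; ring.
- eapply (is_series_lin4 u l (him1 p) (hre p) (him3 p) (- him2 p) _ _ H);
    intros; hred; ring.
- eapply (is_series_lin4 u l (him2 p) (- him3 p) (hre p) (him1 p) _ _ H);
    intros; hred; ring.
- eapply (is_series_lin4 u l (him3 p) (him2 p) (- him1 p) (hre p) _ _ H);
    intros; hred; ring.
Qed.

Lemma hsum_opp u l : hsum u l -> hsum (fun n => - u n)%H (- l)%H.
Proof.
intros H; generalize (hsum_lmul (RtoH (-1)) u l H).
replace (RtoH (-1) * l)%H with (- l)%H by hring.
apply hsum_ext; intros n; hring.
Qed.

Lemma hsum_incr u l : hsum (fun n => u (S n)) l -> hsum u (u O + l)%H.
Proof.
assert (key : forall (v : nat -> R) (m : R),
  is_series (fun n => v (S n)) m -> is_series v (v O + m)).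
{ intros v m Hv; apply is_series_decr_1.
  match goal with |- is_series _ ?x => replace x with m; [easy|] end.
  unfold plus, opp; cbn; ring. }
intros (H0 & H1 & H2 & H3); split; [|split; [|split]].
- exact (key (fun n => hre (u n)) _ H0).
- exact (key (fun n => him1 (u n)) _ H1).
- exact (key (fun n => him2 (u n)) _ H2).
- exact (key (fun n => him3 (u n)) _ H3).
Qed.

Lemma hsum_of_bound u b : (forall n, Hmod (u n) <= b n) -> ex_series b ->
  hsum u (HSeries u) /\ Hmod (HSeries u) <= 4 * Series b.
Proof.
intros Hu Hb.
assert (key : forall pr : H -> R, (forall q, Rabs (pr q) <= Hmod q) ->
  is_series (fun n => pr (u n)) (Series (fun n => pr (u n))) /\
  Rabs (Series (fun n => pr (u n))) <= Series b).
{ intros pr Hpr.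
  assert (A : forall n, Rabs (pr (u n)) <= b n)
    by (intros n; eapply Rle_trans; [apply Hpr|auto]).
  split; [apply Series_correct; now apply (ex_series_dom _ b)|].
  now apply Series_Rabs_le. }
destruct (key hre hre_le) as [A0 B0].
destruct (key him1 him1_le) as [A1 B1].
destruct (key him2 him2_le) as [A2 B2].
destruct (key him3 him3_le) as [A3 B3].
split; [easy|].
eapply Rle_trans; [apply Hmod_le_sum|].
unfold HSeries; cbn [hre him1 him2 him3 fst snd].
change (Rabs (Series (fun n => hre (u n))) + Rabs (Series (fun n => him1 (u n)))
  + Rabs (Series (fun n => him2 (u n))) + Rabs (Series (fun n => him3 (u n)))
  <= 4 * Series b); lra.
Qed.

Lemma sum_n_additive (pr : H -> R) (u : nat -> H) n :
  (forall p q, pr (p + q)%H = pr p + pr q) ->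
  pr (sum_n u n) = sum_n (fun k => pr (u k)) n.
Proof.
intros prD; induction n as [|n IH]; [now rewrite !sum_O|].
rewrite !sum_Sn, <- IH; apply prD.
Qed.

Lemma hsum_is_series (u : nat -> H) (l : H) : hsum u l <-> is_series u l.
Proof.
split.
- intros (H0 & H1 & H2 & H3); apply filterlim_locally; intros eps.
  assert (e4 : 0 < eps / 4) by (assert (A := cond_pos eps); lra).
  assert (key : forall (pr : H -> R) (m : R),
    (forall p q, pr (p + q)%H = pr p + pr q) ->
    is_series (fun n => pr (u n)) m ->
    eventually (fun n => Rabs (pr (sum_n u n) - m) < eps / 4)).
  { intros pr m prD Hm.
    generalize (proj1 (filterlim_locally _ _) Hm (mkposreal _ e4)).
    apply filter_imp; intros n Hn; rewrite sum_n_additive by easy; exact Hn. }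
  generalize (filter_and _ _ (filter_and _ _
    (key hre _ (fun p q => eq_refl) H0) (key him1 _ (fun p q => eq_refl) H1))
    (filter_and _ _ (key him2 _ (fun p q => eq_refl) H2)
       (key him3 _ (fun p q => eq_refl) H3))).
  apply filter_imp; intros n [[A0 A1] [A2 A3]].
  change (Hmod (sum_n u n - l)%H < eps).
  eapply Rle_lt_trans; [apply Hmod_le_sum|].
  set (s := sum_n u n) in *.
  change (Rabs (hre s - hre l) + Rabs (him1 s - him1 l)
    + Rabs (him2 s - him2 l) + Rabs (him3 s - him3 l) < eps); lra.
- intros Hl.
  assert (key : forall pr : H -> R, (forall q, Rabs (pr q) <= Hmod q) ->
    (forall p q, pr (p + q)%H = pr p + pr q) ->
    (forall p, pr (- p)%H = - pr p) ->
    is_series (fun n => pr (u n)) (pr l)).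
  { intros pr prle prD prN; apply filterlim_locally; intros eps.
    generalize (proj1 (filterlim_locally _ _) Hl eps).
    apply filter_imp; intros n Hn.
    change (Hmod (sum_n u n - l)%H < eps) in Hn.
    change (Rabs (sum_n (fun k => pr (u k)) n - pr l) < eps).
    rewrite <- (sum_n_additive pr) by easy.
    replace (pr (sum_n u n) - pr l) with (pr (sum_n u n - l)%H)
      by (rewrite prD, prN; ring).
    eapply Rle_lt_trans; [apply prle|exact Hn]. }
  repeat split; apply key; intros; easy || apply Hcomp_le_mod.
Qed.

Lemma conv_disc_dom (c b : nat -> R) :
  (forall n, Rabs (c n) <= b n) -> conv_disc b -> conv_disc c.
Proof.
intros Hcb Hb r Hr; apply (ex_series_dom _ (fun n => Rabs (b n) * r ^ n)); [|auto].
intros n; assert (P : 0 <= r ^ n) by (apply pow_le; lra).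
rewrite Rabs_mult, Rabs_Rabsolu, (Rabs_pos_eq (r ^ n)) by easy.
apply Rmult_le_compat_r; [easy|].
eapply Rle_trans; [apply Hcb|apply Rle_abs].
Qed.

Lemma conv_disc_plus (c b : nat -> R) :
  conv_disc c -> conv_disc b -> conv_disc (fun n => Rabs (c n) + Rabs (b n)).
Proof.
intros Hc Hb r Hr; generalize (ex_series_plus _ _ (Hc r Hr) (Hb r Hr)).
apply ex_series_ext; intros n.
rewrite (Rabs_pos_eq (_ + _)) by (apply Rplus_le_le_0_compat; apply Rabs_pos).
unfold plus; cbn; ring.
Qed.

Definition conv_ball (c : nat -> H) : Prop := conv_disc (fun n => Hmod (c n)).

Lemma conv_ball_comp c (pr : H -> R) : (forall q, Rabs (pr q) <= Hmod q) ->
  conv_ball c -> conv_disc (fun n => pr (c n)).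
Proof. intros Hpr; apply conv_disc_dom; auto. Qed.

Lemma conv_ball_minus a b : conv_ball a -> conv_ball b ->
  conv_ball (fun n => a n - b n)%H.
Proof.
intros Ha Hb; generalize (conv_disc_plus _ _ Ha Hb); apply conv_disc_dom.
intros n; rewrite !Rabs_pos_eq by apply Hmod_ge0.
eapply Rle_trans; [apply Hmod_triangle|rewrite Hmod_opp; lra].
Qed.

Lemma conv_ball_rmul a p : conv_ball a -> conv_ball (fun n => a n * p)%H.
Proof.
intros Ha r Hr; generalize (ex_series_scal_r (Hmod p) _ (Ha r Hr)).
apply ex_series_ext; intros n.
rewrite Hmod_mult, Rabs_mult, (Rabs_pos_eq (Hmod p)) by apply Hmod_ge0; Rring.
Qed.

Lemma conv_ball_shift a : conv_ball a -> conv_ball (fun n => a (S n)).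
Proof.
unfold conv_ball; intros Ha; apply conv_disc_CV_radius.
change (fun n => Hmod (a (S n))) with (PS_decr_1 (fun n => Hmod (a n))).
rewrite CV_radius_decr_1; now apply conv_disc_CV_radius.
Qed.

Definition hderiv (a : nat -> H) (n : nat) : H := (RtoH (INR (S n)) * a (S n))%H.

Lemma conv_ball_hderiv a : conv_ball a -> conv_ball (hderiv a).
Proof.
intros Ha; generalize (conv_disc_derive _ Ha); apply conv_disc_dom.
intros n; rewrite Rabs_pos_eq by apply Hmod_ge0; unfold hderiv, PS_derive.
rewrite Hmod_mult, Hmod_RtoH, Rabs_pos_eq by apply pos_INR; lra.
Qed.

Lemma hsum_HPSeries c q : conv_ball c -> Hmod q < 1 ->
  hsum (fun n => pow_n q n * c n)%H (HPSeries c q).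
Proof.
intros Hc Hq; apply (hsum_of_bound _ (fun n => Rabs (Hmod (c n)) * Hmod q ^ n)).
- intros n; rewrite Hmod_mult, Hmod_pow, Rabs_pos_eq by apply Hmod_ge0; lra.
- apply Hc; split; [apply Hmod_ge0|easy].
Qed.

Lemma HPSeries_bounded c rho : conv_ball c -> 0 <= rho < 1 ->
  exists M, 0 <= M /\ forall q, Hmod q <= rho -> Hmod (HPSeries c q) <= M.
Proof.
intros Hc Hr.
exists (Rabs (4 * Series (fun n => Rabs (Hmod (c n)) * rho ^ n))).
split; [apply Rabs_pos|]; intros q Hq; eapply Rle_trans; [|apply Rle_abs].
apply hsum_of_bound; [|now apply Hc].
intros n; rewrite Hmod_mult, Hmod_pow, Rabs_pos_eq by apply Hmod_ge0.
rewrite Rmult_comm; apply Rmult_le_compat_l; [apply Hmod_ge0|].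
apply pow_incr; split; [apply Hmod_ge0|easy].
Qed.

Lemma HPSeries_shift c q : conv_ball c -> Hmod q < 1 ->
  HPSeries c q = (c O + q * HPSeries (fun n => c (S n)) q)%H.
Proof.
intros Hc Hq; apply hsum_HSeries.
replace (c O) with (pow_n q 0 * c O)%H by apply Hmult_1_l.
apply (hsum_incr (fun n => pow_n q n * c n)%H).
generalize (hsum_lmul q _ _ (hsum_HPSeries _ q (conv_ball_shift c Hc) Hq)).
apply hsum_ext; intros n; apply Hmult_assoc.
Qed.

Lemma HPSeries_rmul a p q : conv_ball a -> Hmod q < 1 ->
  HPSeries (fun n => a n * p)%H q = (HPSeries a q * p)%H.
Proof.
intros Ha Hq; apply hsum_HSeries.
generalize (hsum_rmul p _ _ (hsum_HPSeries a q Ha Hq)).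
apply hsum_ext; intros n; symmetry; apply Hmult_assoc.
Qed.

Lemma conv_ball_has_expansion a : conv_ball a -> has_expansion (HPSeries a) a.
Proof.
intros Ha q Hq; apply hsum_is_series.
generalize (hsum_HPSeries a q Ha Hq); apply hsum_ext; easy.
Qed.

Lemma has_expansion_HPSeries f a q : has_expansion f a -> in_ball q ->
  f q = HPSeries a q.
Proof.
intros Hf Hq; symmetry; apply hsum_HSeries; apply hsum_is_series, Hf, Hq.
Qed.

(** Convergence at the real points of the ball already gives the four component series radius at
    least 1, and their absolute values dominate the moduli. *)
Lemma has_expansion_conv_ball f a : has_expansion f a -> conv_ball a.
Proof.
intros Hf.
assert (key : forall pr : H -> R, (forall q, Rabs (pr q) <= Hmod q) ->
  (forall p q, pr (p + q)%H = pr p + pr q) ->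
  (forall x q, pr (RtoH x * q)%H = x * pr q) -> conv_disc (fun n => pr (a n))).
{ intros pr prle prD prZ; apply conv_disc_of_ex_pseries; intros t Ht.
  exists (pr (f (RtoH t))); apply is_pseries_comp; auto.
  apply Hf; unfold in_ball; rewrite Hmod_RtoH, Rabs_pos_eq; lra. }
assert (H0 := key hre hre_le (fun p q => eq_refl) hre_scal).
assert (H1 := key him1 him1_le (fun p q => eq_refl) him1_scal).
assert (H2 := key him2 him2_le (fun p q => eq_refl) him2_scal).
assert (H3 := key him3 him3_le (fun p q => eq_refl) him3_scal).
generalize (conv_disc_plus _ _ (conv_disc_plus _ _ H0 H1) (conv_disc_plus _ _ H2 H3)).
apply conv_disc_dom; intros n.
rewrite (Rabs_pos_eq (Hmod _)) by apply Hmod_ge0.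
rewrite !(Rabs_pos_eq (_ + _)) by (apply Rplus_le_le_0_compat; apply Rabs_pos).
generalize (Hmod_le_sum (a n)); lra.
Qed.

(** * Values and derivatives of quaternionic series along a slice *)

Definition re_cps (c : nat -> H) (z : C) : H :=
  (Re (cps (fun n => hre (c n)) z), Re (cps (fun n => him1 (c n)) z),
   Re (cps (fun n => him2 (c n)) z), Re (cps (fun n => him3 (c n)) z)).

Definition im_cps (c : nat -> H) (z : C) : H :=
  (Im (cps (fun n => hre (c n)) z), Im (cps (fun n => him1 (c n)) z),
   Im (cps (fun n => him2 (c n)) z), Im (cps (fun n => him3 (c n)) z)).

Lemma Hmod_slice_pt I x y : imag_unit I -> Hmod (slice_pt I x y) = Cmod (x, y).
Proof.
intros HI; destruct (imag_unitP I HI) as [Hr Hn].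
unfold Hmod, Cmod; f_equal; cbn [fst snd].
transitivity (x ^ 2 + 2 * x * y * hre I + (y * hre I) ^ 2
  + y ^ 2 * (him1 I ^ 2 + him2 I ^ 2 + him3 I ^ 2)).
- unfold slice_pt; hred; ring.
- rewrite Hn, Hr; ring.
Qed.

Lemma slice_pt_mult I x y u v : imag_unit I ->
  (slice_pt I x y * slice_pt I u v)%H = slice_pt I (x * u - y * v) (x * v + y * u).
Proof.
intros HI; unfold slice_pt.
transitivity (RtoH (x * u) + RtoH (y * v) * (I * I) + RtoH (x * v + y * u) * I)%H.
- hring.
- rewrite HI; hring.
Qed.

Lemma pow_n_slice_pt I (z : C) n : imag_unit I ->
  pow_n (slice_pt I (Re z) (Im z)) n = slice_pt I (Re (z ^ n)%C) (Im (z ^ n)%C).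
Proof.
intros HI; induction n as [|n IH].
- change (RtoH 1 = slice_pt I 1 0); unfold slice_pt; hring.
- cbn [pow_n]; rewrite IH.
  change (slice_pt I (Re z) (Im z) * slice_pt I (Re (z ^ n)%C) (Im (z ^ n)%C) =
    slice_pt I (Re (z ^ S n)%C) (Im (z ^ S n)%C))%H.
  now rewrite slice_pt_mult.
Qed.

Lemma hsum_re_cps c z : conv_ball c -> Cmod z < 1 ->
  hsum (fun n => RtoH (Re (z ^ n)%C) * c n)%H (re_cps c z) /\
  hsum (fun n => RtoH (Im (z ^ n)%C) * c n)%H (im_cps c z).
Proof.
intros Hc Hz.
assert (key : forall pr : H -> R, (forall q, Rabs (pr q) <= Hmod q) ->
  (forall x q, pr (RtoH x * q)%H = x * pr q) ->
  is_series (fun n => pr (RtoH (Re (z ^ n)%C) * c n)%H) (Re (cps (fun n => pr (c n)) z)) /\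
  is_series (fun n => pr (RtoH (Im (z ^ n)%C) * c n)%H) (Im (cps (fun n => pr (c n)) z))).
{ intros pr prle prZ.
  destruct (cps_ex (fun n => pr (c n)) z (conv_ball_comp c pr prle Hc) Hz) as [E1 E2].
  apply Series_correct in E1; apply Series_correct in E2.
  split; [revert E1|revert E2]; apply is_series_ext; intros n;
    rewrite prZ, ?re_scal_l, ?im_scal_l; Rring. }
destruct (key hre hre_le hre_scal) as [A0 B0].
destruct (key him1 him1_le him1_scal) as [A1 B1].
destruct (key him2 him2_le him2_scal) as [A2 B2].
destruct (key him3 him3_le him3_scal) as [A3 B3].
exact (conj (conj A0 (conj A1 (conj A2 A3))) (conj B0 (conj B1 (conj B2 B3)))).
Qed.

(** The representation formula: the same two quaternions, the sums of Re (z^n) c_n and of Im (z^n)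
    c_n, serve all imaginary units I. A change of slice thus only changes the factor I. *)
Lemma HPSeries_slice I c z : imag_unit I -> conv_ball c -> Cmod z < 1 ->
  HPSeries c (slice_pt I (Re z) (Im z)) = (re_cps c z + I * im_cps c z)%H.
Proof.
intros HI Hc Hz; destruct (hsum_re_cps c z Hc Hz) as [A B].
apply hsum_HSeries; generalize (hsum_plus _ _ _ _ A (hsum_lmul I _ _ B)).
apply hsum_ext; intros n; rewrite pow_n_slice_pt by easy.
unfold slice_pt; hring.
Qed.

Definition is_hderive (g : R -> H) (x : R) (l : H) : Prop :=
  is_derive (fun t => hre (g t)) x (hre l) /\
  is_derive (fun t => him1 (g t)) x (him1 l) /\
  is_derive (fun t => him2 (g t)) x (him2 l) /\
  is_derive (fun t => him3 (g t)) x (him3 l).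

Lemma is_hderive_HDerive g x l : is_hderive g x l -> HDerive g x = l.
Proof.
intros (H0 & H1 & H2 & H3); unfold HDerive.
apply H_ext; cbn; now apply is_derive_unique.
Qed.

Lemma is_derive_cps c x y : conv_disc c -> Cmod (x, y) < 1 ->
  is_derive (fun t => Re (cps c (t, y))) x (Re (cps (PS_derive c) (x, y))) /\
  is_derive (fun t => Im (cps c (t, y))) x (Im (cps (PS_derive c) (x, y))).
Proof.
(* The midpoint between |z| and 1 leaves room for small real increments inside a disc where the
   Taylor estimate is uniform. *)
intros Hc Hz; set (rho := (1 + Cmod (x, y)) / 2).
assert (z0 := Cmod_ge_0 (x, y)).
destruct (holo_cps c rho Hc ltac:(unfold rho; lra)) as (M & M0 & _ & E).
assert (key : forall h, Rabs h <= rho - Cmod (x, y) ->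
  Cmod (cps c ((x + h)%R, y) - cps c (x, y) - h * cps (PS_derive c) (x, y))%C <= M * h ^ 2).
{ intros h Hh.
  assert (Eh : (x + h, y) = ((x, y) + RtoC h)%C)
    by (apply injective_projections; cbn; ring).
  assert (Hw : Cmod (x + h, y) <= rho).
  { rewrite Eh; eapply Rle_trans; [apply Cmod_triangle|rewrite Cmod_R; lra]. }
  specialize (E (x, y) (x + h, y) ltac:(unfold rho; lra) Hw).
  replace (((x + h)%R, y) - (x, y))%C with (RtoC h) in E
    by (apply injective_projections; cbn; ring).
  rewrite Cmod_R, pow2_abs in E; exact E. }
assert (gen : forall (pr : C -> R), (forall w, Rabs (pr w) <= Cmod w) ->
  (forall u v, pr (u - v)%C = pr u - pr v) -> (forall (h : R) u, pr (h * u)%C = h * pr u) ->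
  is_derive (fun t => pr (cps c (t, y))) x (pr (cps (PS_derive c) (x, y)))).
{ intros pr prle prB prZ; apply is_derive_Reals; intros eps Heps.
  assert (d0 : 0 < Rmin (rho - Cmod (x, y)) (eps / (M + 1))).
  { apply Rmin_glb_lt; [unfold rho; lra|apply Rdiv_lt_0_compat; lra]. }
  exists (mkposreal _ d0); cbn; intros h Nh Hh.
  assert (A1 := Rmin_l (rho - Cmod (x, y)) (eps / (M + 1))).
  assert (A2 := Rmin_r (rho - Cmod (x, y)) (eps / (M + 1))).
  specialize (key h ltac:(lra)).
  eapply Rle_trans in key; [|apply prle]; rewrite !prB, prZ in key.
  match goal with |- Rabs ?e < _ => replace e with
    ((pr (cps c (x + h, y)) - pr (cps c (x, y)) - h * pr (cps (PS_derive c) (x, y))) / h)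
    by (field; easy) end.
  assert (h0 := Rabs_pos_lt h Nh).
  unfold Rdiv; rewrite Rabs_mult, Rabs_inv.
  apply Rle_lt_trans with (M * h ^ 2 * / Rabs h).
  - apply Rmult_le_compat_r; [apply Rlt_le, Rinv_0_lt_compat; easy|easy].
  - rewrite <- (pow2_abs h).
    replace (M * Rabs h ^ 2 * / Rabs h) with (M * Rabs h) by (field; lra).
    apply Rle_lt_trans with (M * (eps / (M + 1))).
    + apply Rmult_le_compat_l; lra.
    + apply Rlt_le_trans with ((M + 1) * (eps / (M + 1))); [|right; field; lra].
      apply Rmult_lt_compat_r; [apply Rdiv_lt_0_compat; lra|lra]. }
split; apply gen; intros.
- apply re_le_Cmod.
- reflexivity.
- apply re_scal_l.
- apply im_le_Cmod.
- reflexivity.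
- apply im_scal_l.
Qed.

Lemma is_hderive_lin I (g h : R -> H) x l m :
  is_hderive g x l -> is_hderive h x m ->
  is_hderive (fun t => g t + I * h t)%H x (l + I * m)%H.
Proof.
intros (G0 & G1 & G2 & G3) (H0 & H1 & H2 & H3).
assert (key : forall (g0 : R -> R) l0 c0 c1 c2 c3 (v : R -> R) (k : R),
  is_derive g0 x l0 ->
  (forall t, v t = g0 t + (c0 * hre (h t) + c1 * him1 (h t)
     + c2 * him2 (h t) + c3 * him3 (h t))) ->
  k = l0 + (c0 * hre m + c1 * him1 m + c2 * him2 m + c3 * him3 m) ->
  is_derive v x k).
{ intros g0 l0 c0 c1 c2 c3 v k D0 Hv ->.
  generalize (is_derive_plus _ _ _ _ _ D0
   (is_derive_plus _ _ _ _ _ (is_derive_plus _ _ _ _ _ (is_derive_plus _ _ _ _ _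
     (is_derive_scal _ _ c0 _ H0) (is_derive_scal _ _ c1 _ H1))
     (is_derive_scal _ _ c2 _ H2)) (is_derive_scal _ _ c3 _ H3))).
  apply is_derive_ext; intros t; rewrite Hv; easy. }
split; [|split; [|split]].
- eapply (key _ _ (hre I) (- him1 I) (- him2 I) (- him3 I) _ _ G0);
    intros; hred; ring.
- eapply (key _ _ (him1 I) (hre I) (- him3 I) (him2 I) _ _ G1);
    intros; hred; ring.
- eapply (key _ _ (him2 I) (him3 I) (hre I) (- him1 I) _ _ G2);
    intros; hred; ring.
- eapply (key _ _ (him3 I) (- him2 I) (him1 I) (hre I) _ _ G3);
    intros; hred; ring.
Qed.

Lemma PS_derive_hderiv (pr : H -> R) a n :
  (forall x q, pr (RtoH x * q)%H = x * pr q) ->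
  PS_derive (fun n => pr (a n)) n = pr (hderiv a n).
Proof. intros prZ; unfold PS_derive, hderiv; now rewrite prZ. Qed.

Lemma cps_ext b c z : (forall n, b n = c n) -> cps b z = cps c z.
Proof.
intros E; unfold cps, CSeries; f_equal; apply Series_ext; intros n; now rewrite E.
Qed.

Lemma is_hderive_re_im_cps a x y : conv_ball a -> Cmod (x, y) < 1 ->
  is_hderive (fun t => re_cps a (t, y)) x (re_cps (hderiv a) (x, y)) /\
  is_hderive (fun t => im_cps a (t, y)) x (im_cps (hderiv a) (x, y)).
Proof.
intros Ha Hz.
assert (key : forall pr : H -> R, (forall q, Rabs (pr q) <= Hmod q) ->
  (forall x q, pr (RtoH x * q)%H = x * pr q) ->
  is_derive (fun t => Re (cps (fun n => pr (a n)) (t, y))) x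
    (Re (cps (fun n => pr (hderiv a n)) (x, y))) /\
  is_derive (fun t => Im (cps (fun n => pr (a n)) (t, y))) x
    (Im (cps (fun n => pr (hderiv a n)) (x, y)))).
{ intros pr prle prZ.
  rewrite (cps_ext (fun n => pr (hderiv a n)) (PS_derive (fun n => pr (a n))))
    by (intros n; symmetry; now apply PS_derive_hderiv).
  apply is_derive_cps; [now apply conv_ball_comp|easy]. }
destruct (key hre hre_le hre_scal) as [A0 B0].
destruct (key him1 him1_le him1_scal) as [A1 B1].
destruct (key him2 him2_le him2_scal) as [A2 B2].
destruct (key him3 him3_le him3_scal) as [A3 B3].
exact (conj (conj A0 (conj A1 (conj A2 A3))) (conj B0 (conj B1 (conj B2 B3)))).
Qed.

Lemma slice_rep q : exists I x y, imag_unit I /\ q = slice_pt I x y.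
Proof.
exists (axis q), (hre q), (Him_mod q); unfold axis.
assert (Hs : Him_mod q ^ 2 = him1 q ^ 2 + him2 q ^ 2 + him3 q ^ 2).
{ unfold Him_mod; apply pow2_sqrt; nra. }
destruct (Req_EM_T (Him_mod q) 0) as [E|N].
- split; [unfold imag_unit; hring|].
  rewrite E in Hs |- *.
  unfold slice_pt; apply H_ext; hred; change (fst (fst (fst q))) with (hre q);
    change (snd (fst (fst q))) with (him1 q); change (snd (fst q)) with (him2 q);
    change (snd q) with (him3 q); nra.
- split.
  + unfold imag_unit; apply H_ext; hred;
      change (fst (fst (fst q))) with (hre q);
      change (snd (fst (fst q))) with (him1 q); change (snd (fst q)) with (him2 q);
      change (snd q) with (him3 q); try (field; easy).
    transitivity (- ((him1 q ^ 2 + him2 q ^ 2 + him3 q ^ 2) / Him_mod q ^ 2));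
      [field; easy|rewrite <- Hs; field; easy].
  + unfold slice_pt; apply H_ext; hred; field; easy.
Qed.

(** Only the derivative in x is computed from the series. Writing d and e for [slice_dx] and I times
    [slice_dy], the Cauchy-Riemann equation d + e = 0 turns (d - e) / 2 into d. *)
Lemma slice_deriv_HPSeries f a q : slice_regular f -> has_expansion f a ->
  in_ball q -> slice_deriv f q = HPSeries (hderiv a) q.
Proof.
intros Hf Ha Hq.
assert (Hc := has_expansion_conv_ball f a Ha).
destruct (slice_rep q) as (I & x & y & HI & ->).
assert (Hz : Cmod (x, y) < 1) by (rewrite <- (Hmod_slice_pt I); easy).
assert (Hdx : slice_dx f I x y = HPSeries (hderiv a) (slice_pt I x y)).
{ assert (ES := HPSeries_slice I (hderiv a) (x, y) HI (conv_ball_hderiv a Hc) Hz).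
  cbn [Re Im fst snd] in ES; rewrite ES; clear ES.
  destruct (is_hderive_re_im_cps a x y Hc Hz) as [D1 D2].
  assert (D := is_hderive_lin I _ _ _ _ _ D1 D2).
  apply is_hderive_HDerive.
  (* The function agrees with its series only inside the ball, hence only for t near x. *)
  assert (L : locally x (fun t => (re_cps a (t, y) + I * im_cps a (t, y))%H
                                  = f (slice_pt I t y))).
  { assert (d0 : 0 < 1 - Cmod (x, y)) by lra.
    exists (mkposreal _ d0); intros t Ht.
    change (Rabs (t - x) < 1 - Cmod (x, y)) in Ht.
    assert (Ht' : Cmod (t, y) < 1).
    { replace (t, y) with ((x, y) + RtoC (t - x))%C
        by (apply injective_projections; cbn; ring).
      eapply Rle_lt_trans; [apply Cmod_triangle|rewrite Cmod_R; lra]. }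
    assert (ES := HPSeries_slice I a (t, y) HI Hc Ht').
    cbn [Re Im fst snd] in ES; rewrite <- ES; clear ES.
    symmetry; apply has_expansion_HPSeries; [easy|].
    unfold in_ball; now rewrite Hmod_slice_pt. }
  destruct D as (E0 & E1 & E2 & E3).
  split; [|split; [|split]].
  - apply (is_derive_ext_loc (fun t => hre (re_cps a (t, y) + I * im_cps a (t, y))%H));
      [|exact E0]; revert L; apply filter_imp; intros t Et; exact (f_equal hre Et).
  - apply (is_derive_ext_loc (fun t => him1 (re_cps a (t, y) + I * im_cps a (t, y))%H));
      [|exact E1]; revert L; apply filter_imp; intros t Et; exact (f_equal him1 Et).
  - apply (is_derive_ext_loc (fun t => him2 (re_cps a (t, y) + I * im_cps a (t, y))%H));
      [|exact E2]; revert L; apply filter_imp; intros t Et; exact (f_equal him2 Et).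
  - apply (is_derive_ext_loc (fun t => him3 (re_cps a (t, y) + I * im_cps a (t, y))%H));
      [|exact E3]; revert L; apply filter_imp; intros t Et; exact (f_equal him3 Et). }
rewrite slice_derivE, <- Hdx by easy.
destruct (Hf I HI x y Hq) as (_ & _ & _ & _ & CR).
revert CR; generalize (slice_dx f I x y) (I * slice_dy f I x y)%H.
intros d e CR.
transitivity (d - RtoH (1 / 2) * (d + e))%H.
- apply H_ext; hred; field.
- rewrite CR; hring.
Qed.

(** * The regular quotient on slices *)

Lemma holo_minus K f g : (forall z, K z -> Cmod z <= 1) ->
  holo K f -> holo K g -> holo K (fun z => f z - g z)%C.
Proof.
intros HK Hf Hg.
apply (holo_ext K (fun z => f z + (- (1)) * g z)%C); [intros; ring|].
apply (holo_plus K f (fun z => - (1) * g z)%C Hf).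
apply (holo_mult K (fun _ => - (1))%C g HK); [apply holo_const|easy].
Qed.

(** The complex coordinate of the orthogonal projection of v to the plane C_J. It commutes with left
    multiplication by elements of C_J and keeps the real part. *)
Definition lamJ (J v : H) : C := (hre v, - hre (J * v)%H).

Lemma lamJ_plus J v w : lamJ J (v + w)%H = (lamJ J v + lamJ J w)%C.
Proof. apply injective_projections; unfold lamJ; hred; cbn; ring. Qed.

Lemma lamJ_slice J (z : C) v : imag_unit J ->
  lamJ J (slice_pt J (Re z) (Im z) * v)%H = (z * lamJ J v)%C.
Proof.
intros HJ; assert (E : (J * (J * v))%H = (- v)%H).
{ rewrite Hmult_assoc, HJ; Hring. }
assert (E' : (slice_pt J (Re z) (Im z) * v)%H =
  (RtoH (Re z) * v + RtoH (Im z) * (J * v))%H) by (unfold slice_pt; Hring).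
assert (E2 : (J * (slice_pt J (Re z) (Im z) * v))%H =
  (RtoH (Re z) * (J * v) - RtoH (Im z) * v)%H).
{ rewrite E'; transitivity (RtoH (Re z) * (J * v) + RtoH (Im z) * (J * (J * v)))%H;
    [Hring|rewrite E; Hring]. }
unfold lamJ; rewrite E2, E'.
generalize (J * v)%H; intros w.
apply injective_projections; hred; cbn; unfold Re, Im; ring.
Qed.

Lemma lamJ_slice_pt J (z : C) : imag_unit J -> lamJ J (slice_pt J (Re z) (Im z)) = z.
Proof.
intros HJ; rewrite <- (Hmult_1_r (slice_pt J (Re z) (Im z))), lamJ_slice by easy.
destruct (imag_unitP J HJ) as [E _].
unfold lamJ; rewrite Hmult_1_r, E, Ropp_0.
change (hre (RtoH 1), 0) with (RtoC 1); ring.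
Qed.

(** Pythagoras for the projection to C_J. *)
Lemma Cmod_lamJ J v : imag_unit J ->
  Cmod (lamJ J v) ^ 2 + Hmod (v - slice_pt J (Re (lamJ J v)) (Im (lamJ J v)))%H ^ 2
  = Hmod v ^ 2.
Proof.
intros HJ; destruct (imag_unitP J HJ) as [E0 E1].
rewrite Cmod2_alt, !Hmod_sq.
unfold lamJ, slice_pt, Hnorm2; cbn [Re Im fst snd].
autorewrite with quat; rewrite E0.
set (y := him1 J * him1 v + him2 J * him2 v + him3 J * him3 v).
transitivity (hre v ^ 2 + him1 v ^ 2 + him2 v ^ 2 + him3 v ^ 2
  + y ^ 2 * (him1 J ^ 2 + him2 J ^ 2 + him3 J ^ 2 - 1)).
- unfold y; ring.
- rewrite E1; ring.
Qed.

Lemma Cmod_lamJ_le J v : imag_unit J -> Cmod (lamJ J v) <= Hmod v.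
Proof.
intros HJ; assert (A := Cmod_lamJ J v HJ).
assert (B := pow2_ge_0 (Hmod (v - slice_pt J (Re (lamJ J v)) (Im (lamJ J v)))%H)).
assert (P := Hmod_ge0 v); assert (Q := Cmod_ge_0 (lamJ J v)); nra.
Qed.

(** The equality case of [Cmod_lamJ_le]: a quaternion whose projection has full length lies in
    C_J. *)
Lemma slice_pt_lamJ J v : imag_unit J -> Hmod v <= Cmod (lamJ J v) ->
  v = slice_pt J (Re (lamJ J v)) (Im (lamJ J v)).
Proof.
intros HJ Hle; assert (A := Cmod_lamJ J v HJ).
set (w := slice_pt J _ _) in *.
assert (P := Hmod_ge0 v); assert (Q := Hmod_ge0 (v - w)%H).
assert (E : Hmod (v - w)%H = 0) by nra.
apply Hmod_eq0 in E.
replace v with ((v - w) + w)%H by Hring; rewrite E; Hring.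
Qed.

(** The complex bilinear norm s conj(s) of a biquaternion, which can vanish for nonzero s. On the
    components of a power series it gives the symmetrization, with z in the place of the slice
    variable. *)
Definition qnorm (s0 s1 s2 s3 : C) : C := (s0 * s0 + s1 * s1 + s2 * s2 + s3 * s3)%C.

(* The complex-linear extension of [lamJ J] to biquaternions, at conj(s) * d. *)
Definition qnum (J : H) (s0 s1 s2 s3 d0 d1 d2 d3 : C) : C :=
  ((s0 * d0 + s1 * d1 + s2 * d2 + s3 * d3)
   + Ci * (RtoC (him1 J) * (s0 * d1 - s1 * d0 - s2 * d3 + s3 * d2)
           + RtoC (him2 J) * (s0 * d2 + s1 * d3 - s2 * d0 - s3 * d1)
           + RtoC (him3 J) * (s0 * d3 - s1 * d2 + s2 * d1 - s3 * d0)))%C.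

(* Invert s = A + iB in the biquaternions as G = conj(s) / N(s).  The value of G at
   J is h, and evaluation at J of a product G s is h times the value of s at
   K = h^-1 J h. *)
Lemma slice_quotient J (s0 s1 s2 s3 d0 d1 d2 d3 : C) :
  imag_unit J -> qnorm s0 s1 s2 s3 <> RtoC 0 ->
  let A : H := (Re s0, Re s1, Re s2, Re s3) in
  let B : H := (Im s0, Im s1, Im s2, Im s3) in
  let C : H := (Re d0, Re d1, Re d2, Re d3) in
  let D : H := (Im d0, Im d1, Im d2, Im d3) in
  exists K h, imag_unit K /\ (h * (A + K * B))%H = RtoH 1 /\ (h * K = J * h)%H /\
    Hmod h <= Cmod (/ qnorm s0 s1 s2 s3)%C * (2 * (Hmod A + Hmod B)) /\
    (qnum J s0 s1 s2 s3 d0 d1 d2 d3 * / qnorm s0 s1 s2 s3)%C = lamJ J (h * (C + K * D))%H.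
Proof.
intros HJ HN A B C0 D.
set (N := qnorm s0 s1 s2 s3) in *.
set (mu := Re (/ N)%C); set (nu := Im (/ N)%C).
assert (EN : (N * / N)%C = RtoC 1) by now apply Cinv_r.
assert (E1 : Re N * mu - Im N * nu = 1) by exact (f_equal fst EN).
assert (E2 : Re N * nu + Im N * mu = 0) by exact (f_equal snd EN).
assert (n1 : Re N = Hnorm2 A - Hnorm2 B).
{ unfold N, qnorm, A, B; hred; cbn; unfold Re, Im; ring. }
assert (n2 : RtoH (Im N) = (Hconj A * B + Hconj B * A)%H).
{ unfold N, qnorm, A, B; apply H_ext; hred; cbn; unfold Re, Im; ring. }
assert (nA : (Hconj A * A)%H = RtoH (Hnorm2 A)) by Hring.
assert (nB : (Hconj B * B)%H = RtoH (Hnorm2 B)) by Hring.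
(* Since mu + i nu = 1 / N, the biquaternion conj(s) / N is GA + i GB; [G1] and [G2] are the two
   parts of the statement that its product with s is 1. *)
set (GA := (RtoH mu * Hconj A - RtoH nu * Hconj B)%H).
set (GB := (RtoH nu * Hconj A + RtoH mu * Hconj B)%H).
assert (G1 : (GA * A - GB * B)%H = RtoH 1).
{ transitivity (RtoH mu * (Hconj A * A - Hconj B * B)
    - RtoH nu * (Hconj A * B + Hconj B * A))%H; [unfold GA, GB; Hring|].
  rewrite nA, nB, <- n2, <- E1, n1; Hring. }
assert (G2 : (GB * A + GA * B)%H = RtoH 0).
{ transitivity (RtoH nu * (Hconj A * A - Hconj B * B)
    + RtoH mu * (Hconj A * B + Hconj B * A))%H; [unfold GA, GB; Hring|].
  rewrite nA, nB, <- n2, <- E2, n1; Hring. }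
(* Replacing i by J on the left is compatible with the product because J^2 + 1 = 0 removes the term
   in GB B, so the inverse relation becomes h A + J h B = 1. *)
set (h := (GA + J * GB)%H).
assert (Hh : (h * A + J * h * B)%H = RtoH 1).
{ transitivity ((GA * A - GB * B) + J * (GB * A + GA * B)
    + (J * J + RtoH 1) * (GB * B))%H; [unfold h; Hring|].
  rewrite G1, G2, HJ; Hring. }
assert (h0 : h <> RtoH 0).
{ intros E; apply H1_neq0; rewrite <- Hh, E; Hring. }
set (K := (/ h * (J * h))%H).
assert (hK : (h * K = J * h)%H).
{ unfold K; rewrite Hmult_assoc, Hinv_r by easy; apply Hmult_1_l. }
exists K, h; split; [|split; [|split; [|split]]].
- unfold imag_unit.
  transitivity (/ h * (J * (h * / h) * J) * h)%H.
  + unfold K; generalize (/ h)%H; intros g; rewrite !Hmult_assoc; easy.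
  + rewrite Hinv_r, Hmult_1_r, HJ by easy.
    transitivity (RtoH (-1) * (/ h * h))%H; [generalize (/ h)%H; Hring|].
    rewrite Hinv_l by easy; apply Hmult_1_r.
- rewrite Hmult_plus_r, Hmult_assoc, hK; exact Hh.
- exact hK.
- assert (HJ1 : Hmod J = 1).
  { assert (E := f_equal Hmod HJ); rewrite Hmod_mult, Hmod_RtoH in E.
    rewrite Rabs_left in E by lra; assert (P := Hmod_ge0 J); nra. }
  assert (Hmu : Rabs mu <= Cmod (/ N)%C) by apply re_le_Cmod.
  assert (Hnu : Rabs nu <= Cmod (/ N)%C) by apply im_le_Cmod.
  assert (PA := Hmod_ge0 A); assert (PB := Hmod_ge0 B).
  assert (HGA : Hmod GA <= Cmod (/ N)%C * (Hmod A + Hmod B)).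
  { unfold GA; eapply Rle_trans; [apply Hmod_triangle|].
    rewrite Hmod_opp, !Hmod_mult, !Hmod_RtoH, !Hmod_conj; nra. }
  assert (HGB : Hmod GB <= Cmod (/ N)%C * (Hmod A + Hmod B)).
  { unfold GB; eapply Rle_trans; [apply Hmod_triangle|].
    rewrite !Hmod_mult, !Hmod_RtoH, !Hmod_conj; nra. }
  unfold h; eapply Rle_trans; [apply Hmod_triangle|].
  rewrite Hmod_mult, HJ1; lra.
- rewrite Hmult_plus_r, Hmult_assoc, hK.
  set (PA := (GA * C0 - GB * D)%H); set (PB := (GA * D + GB * C0)%H).
  replace (h * C0 + J * h * D)%H with (PA + J * PB)%H.
  2: { transitivity (PA + J * PB + (J * J + RtoH 1) * (GB * D))%H.
       - rewrite HJ; Hring.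
       - unfold h, PA, PB; Hring. }
  replace (lamJ J (PA + J * PB)%H) with
    (hre PA + hre (J * PB)%H, hre PB - hre (J * PA)%H).
  2: { unfold lamJ; f_equal.
       replace (J * (PA + J * PB))%H with (J * PA - PB)%H.
       - autorewrite with quat; ring.
       - transitivity (J * PA + (J * J) * PB)%H; [rewrite HJ; Hring|Hring]. }
  destruct (imag_unitP J HJ) as [J0 _].
  assert (Einv : (/ N)%C = (mu, nu)) by (apply injective_projections; easy).
  rewrite Einv; clearbody mu nu; clear - J0.
  destruct s0 as [a0 b0], s1 as [a1 b1], s2 as [a2 b2], s3 as [a3 b3],
    d0 as [c0 e0], d1 as [c1 e1], d2 as [c2 e2], d3 as [c3 e3].
  apply injective_projections; cbn [fst snd]; unfold PA, PB, GA, GB;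
    autorewrite with quat; rewrite J0;
    change (hre A) with a0; change (him1 A) with a1;
    change (him2 A) with a2; change (him3 A) with a3;
    change (hre B) with b0; change (him1 B) with b1;
    change (him2 B) with b2; change (him3 B) with b3;
    change (hre C0) with c0; change (him1 C0) with c1;
    change (him2 C0) with c2; change (him3 C0) with c3;
    change (hre D) with e0; change (him1 D) with e1;
    change (him2 D) with e2; change (him3 D) with e3;
    unfold qnum, Cminus, Ci, RtoC; unfold Cminus, Cplus, Copp, Cmult; cbn [fst snd]; ring.
Qed.

(** Vanishing of the norm means |A| = |B| and A orthogonal to B, so for B nonzero -A B^-1 is an
    imaginary unit, and it solves A + I B = 0. A zero of the symmetrization thus produces a zero of
    the function on the same sphere. *)
Lemma qnorm_zero_slice (s0 s1 s2 s3 : C) : qnorm s0 s1 s2 s3 = RtoC 0 ->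
  exists I, imag_unit I /\
    ((Re s0, Re s1, Re s2, Re s3) + I * (Im s0, Im s1, Im s2, Im s3))%H = RtoH 0.
Proof.
intros EN; set (A := (Re s0, Re s1, Re s2, Re s3) : H);
  set (B := (Im s0, Im s1, Im s2, Im s3) : H).
assert (E1 : Hnorm2 A - Hnorm2 B = 0).
{ transitivity (Re (qnorm s0 s1 s2 s3)); [|now rewrite EN].
  unfold qnorm, A, B; hred; cbn; unfold Re, Im; ring. }
assert (E2 : hre (A * Hconj B)%H = 0).
{ apply Rmult_eq_reg_l with 2; [|lra]; rewrite Rmult_0_r.
  transitivity (Im (qnorm s0 s1 s2 s3)); [|now rewrite EN].
  unfold qnorm, A, B; hred; cbn; unfold Re, Im; ring. }
clearbody A B.
destruct (Req_dec (Hnorm2 B) 0) as [ZB|NB].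
- assert (B0 : B = RtoH 0) by (apply Hmod_eq0; unfold Hmod; rewrite ZB; apply sqrt_0).
  assert (A0 : A = RtoH 0).
  { apply Hmod_eq0; unfold Hmod; replace (Hnorm2 A) with 0 by lra; apply sqrt_0. }
  exists (0, 1, 0, 0); split; [unfold imag_unit; hring|].
  rewrite A0, B0; Hring.
- exists (RtoH (- / Hnorm2 B) * (A * Hconj B))%H.
  assert (EW : ((A * Hconj B) * (A * Hconj B))%H = RtoH (- (Hnorm2 A * Hnorm2 B))).
  { transitivity (RtoH (2 * hre (A * Hconj B)%H) * (A * Hconj B)
      - RtoH (Hnorm2 A * Hnorm2 B))%H; [Hring|rewrite E2; Hring]. }
  split.
  + unfold imag_unit.
    transitivity (RtoH (/ Hnorm2 B * / Hnorm2 B) * ((A * Hconj B) * (A * Hconj B)))%H.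
    * generalize (/ Hnorm2 B); Hring.
    * rewrite EW; replace (Hnorm2 A) with (Hnorm2 B) by lra.
      transitivity (RtoH (- ((/ Hnorm2 B * Hnorm2 B) * (/ Hnorm2 B * Hnorm2 B)))).
      -- generalize (/ Hnorm2 B) (Hnorm2 B); Hring.
      -- rewrite Rinv_l by easy; f_equal; ring.
  + transitivity (A - RtoH (/ Hnorm2 B) * (A * (Hconj B * B)))%H.
    * generalize (/ Hnorm2 B); Hring.
    * replace (Hconj B * B)%H with (RtoH (Hnorm2 B)) by Hring.
      transitivity (A - RtoH (/ Hnorm2 B * Hnorm2 B) * A)%H.
      -- generalize (/ Hnorm2 B) (Hnorm2 B); Hring.
      -- rewrite Rinv_l by easy; Hring.
Qed.

(* Formal division: [sig 0] is the sequence d, and [sig m 0] is the m-th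
   coefficient of the left quotient of d by b. *)
Fixpoint sig (b d : nat -> H) (m : nat) : nat -> H :=
  match m with
  | O => d
  | S m => fun n => (sig b d m (S n) - b (S n) * sig b d m O)%H
  end.

Lemma conv_ball_sig b d m : conv_ball b -> conv_ball d -> conv_ball (sig b d m).
Proof.
intros Hb Hd; induction m as [|m IH]; [easy|].
apply (conv_ball_minus (fun n => sig b d m (S n)) (fun n => b (S n) * sig b d m O)%H).
- now apply conv_ball_shift.
- apply (conv_ball_rmul (fun n => b (S n))); now apply conv_ball_shift.
Qed.

(** One division step, evaluated at a point. Subtracting b times a constant on the right cancels the
    constant term, as b 0 = 1, and leaves a factor q. Right multiplication by a constant commutes
    with evaluation, so only pointwise products occur. *)
Lemma HPSeries_sig b d m q : conv_ball b -> conv_ball d -> b O = RtoH 1 ->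
  Hmod q < 1 ->
  HPSeries (sig b d m) q =
  (HPSeries b q * sig b d m O + q * HPSeries (sig b d (S m)) q)%H.
Proof.
intros Hb Hd b0 Hq; assert (Hs := conv_ball_sig b d m Hb Hd).
assert (Hbp := conv_ball_rmul b (sig b d m O) Hb).
assert (E := HPSeries_shift _ q (conv_ball_minus _ _ Hs Hbp) Hq).
assert (E1 : HPSeries (fun n => sig b d m n - b n * sig b d m O)%H q =
  (HPSeries (sig b d m) q - HPSeries b q * sig b d m O)%H).
{ apply hsum_HSeries.
  generalize (hsum_plus _ _ _ _ (hsum_HPSeries _ q Hs Hq)
    (hsum_opp _ _ (hsum_rmul (sig b d m O) _ _ (hsum_HPSeries b q Hb Hq)))).
  apply hsum_ext; intros n.
  rewrite Hmult_plus_r; f_equal; Hring. }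
cbv beta in E; rewrite E1, b0, Hmult_1_l, Hplus_opp_r in E.
change (fun n => (sig b d m (S n) - b (S n) * sig b d m O)%H) with (sig b d (S m)) in E.
replace (HPSeries (sig b d m) q) with
  ((HPSeries (sig b d m) q - HPSeries b q * sig b d m O) + HPSeries b q * sig b d m O)%H
  by Hring.
rewrite E; Hring.
Qed.

(** * Caratheodory's inequality applied to the slices of the quotient *)

Section SliceQuotient.

Variables b d : nat -> H.
Hypothesis (Hb : conv_ball b) (Hd : conv_ball d).
Hypothesis (b0 : b O = RtoH 1) (d0 : d O = RtoH 1).
Hypothesis b_nz : forall q, Hmod q < 1 -> HPSeries b q <> RtoH 0.
Hypothesis bd_pos : forall q, Hmod q < 1 ->
  0 < hre (/ HPSeries b q * HPSeries d q)%H.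

Definition qphi_den (z : C) : C :=
  qnorm (cps (fun n => hre (b n)) z) (cps (fun n => him1 (b n)) z)
        (cps (fun n => him2 (b n)) z) (cps (fun n => him3 (b n)) z).

(** The C_J-coordinate of the regular quotient of d by b at the point of C_J with coordinate z. *)
Definition qphi (J : H) (z : C) : C :=
  (qnum J (cps (fun n => hre (b n)) z) (cps (fun n => him1 (b n)) z)
          (cps (fun n => him2 (b n)) z) (cps (fun n => him3 (b n)) z)
          (cps (fun n => hre (d n)) z) (cps (fun n => him1 (d n)) z)
          (cps (fun n => him2 (d n)) z) (cps (fun n => him3 (d n)) z)
   * / qphi_den z)%C.

Lemma qphi_den_nz z : Cmod z < 1 -> qphi_den z <> RtoC 0.
Proof.
intros Hz E; destruct (qnorm_zero_slice _ _ _ _ E) as (I & HI & Z).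
apply (b_nz (slice_pt I (Re z) (Im z))).
- rewrite Hmod_slice_pt by easy; destruct z; exact Hz.
- rewrite HPSeries_slice by easy; exact Z.
Qed.

Lemma holo_cps_comp c (pr : H -> R) rho : conv_ball c -> 0 <= rho < 1 ->
  (forall q, Rabs (pr q) <= Hmod q) ->
  holo (fun z => Cmod z <= rho) (cps (fun n => pr (c n))).
Proof.
intros Hc Hr Hpr; eexists; apply holo_cps; [now apply conv_ball_comp|easy].
Qed.

Lemma holo_qphi_den rho : 0 <= rho < 1 -> holo (fun z => Cmod z <= rho) qphi_den.
Proof.
intros Hr; unfold qphi_den, qnorm.
assert (HK : forall z, Cmod z <= rho -> Cmod z <= 1) by (intros; lra).
repeat first [apply holo_plus | apply (holo_mult _ _ _ HK)];
  apply holo_cps_comp; auto using hre_le, him1_le, him2_le, him3_le.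
Qed.

Lemma qphi_den_bounded_below rho : 0 <= rho < 1 ->
  exists m, 0 < m /\ forall z, Cmod z <= rho -> m <= Cmod (qphi_den z).
Proof.
intros Hr; apply holo_bounded_below; [lra|now apply holo_qphi_den|].
intros z Hz; apply qphi_den_nz; lra.
Qed.

Lemma holo_qphi J rho : 0 <= rho < 1 -> holo (fun z => Cmod z <= rho) (qphi J).
Proof.
intros Hr.
assert (HK : forall z, Cmod z <= rho -> Cmod z <= 1) by (intros; lra).
destruct (qphi_den_bounded_below rho Hr) as (m & m0 & Hm).
unfold qphi; apply (holo_mult _ _ _ HK).
- unfold qnum.
  repeat first [apply (holo_minus _ _ _ HK) | apply holo_plus
    | apply (holo_mult _ _ _ HK) | apply holo_const];
  apply holo_cps_comp; auto using hre_le, him1_le, him2_le, him3_le.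
- apply (holo_inv _ qphi_den m HK m0 Hm); now apply holo_qphi_den.
Qed.

Lemma re_im_cps_bounded rho : 0 <= rho < 1 -> exists M, forall z, Cmod z <= rho ->
  Hmod (re_cps b z) <= M /\ Hmod (im_cps b z) <= M.
Proof.
intros Hr.
assert (B := fun pr Hpr => cps_bound (fun n => pr (b n)) rho
  (conv_ball_comp b pr Hpr Hb) Hr).
set (M := fun pr : H -> R => 2 * Series (fun n => Rabs (pr (b n)) * rho ^ n)).
exists (M hre + M him1 + M him2 + M him3); intros z Hz.
assert (B0 := B hre hre_le z Hz); assert (B1 := B him1 him1_le z Hz);
assert (B2 := B him2 him2_le z Hz); assert (B3 := B him3 him3_le z Hz).
split; (eapply Rle_trans; [apply Hmod_le_sum|]).
- change (Rabs (Re (cps (fun n => hre (b n)) z)) + Rabs (Re (cps (fun n => him1 (b n)) z))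
    + Rabs (Re (cps (fun n => him2 (b n)) z)) + Rabs (Re (cps (fun n => him3 (b n)) z))
    <= M hre + M him1 + M him2 + M him3).
  repeat apply Rplus_le_compat; (eapply Rle_trans; [apply re_le_Cmod|eassumption]).
- change (Rabs (Im (cps (fun n => hre (b n)) z)) + Rabs (Im (cps (fun n => him1 (b n)) z))
    + Rabs (Im (cps (fun n => him2 (b n)) z)) + Rabs (Im (cps (fun n => him3 (b n)) z))
    <= M hre + M him1 + M him2 + M him3).
  repeat apply Rplus_le_compat; (eapply Rle_trans; [apply im_le_Cmod|eassumption]).
Qed.

(** The point q lies on the same sphere as z but in a slice C_K that depends on z. The bound on h is
    nevertheless uniform over the disc, by the lower bound on [qphi_den]; the jets need this
    uniformity. *)
Lemma qphi_slice J rho : imag_unit J -> 0 <= rho < 1 -> exists M, 0 <= M /\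
  forall z, Cmod z <= rho -> exists K h, imag_unit K /\
    let q := slice_pt K (Re z) (Im z) in
    (h * HPSeries b q)%H = RtoH 1 /\
    (h * q = slice_pt J (Re z) (Im z) * h)%H /\ Hmod h <= M /\
    qphi J z = lamJ J (h * HPSeries d q)%H.
Proof.
intros HJ Hr.
destruct (re_im_cps_bounded rho Hr) as [M HM].
destruct (qphi_den_bounded_below rho Hr) as (m & m0 & Hm).
exists (Rabs (/ m * (2 * (M + M)))); split; [apply Rabs_pos|]; intros z Hz; assert (Hz1 : Cmod z < 1) by lra.
destruct (slice_quotient J _ _ _ _
  (cps (fun n => hre (d n)) z) (cps (fun n => him1 (d n)) z)
  (cps (fun n => him2 (d n)) z) (cps (fun n => him3 (d n)) z)
  HJ (qphi_den_nz z Hz1)) as (K & h & HK & E1 & E2 & E3 & E4).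
exists K, h; split; [exact HK|]; cbv zeta.
rewrite (HPSeries_slice K b z HK Hb Hz1), (HPSeries_slice K d z HK Hd Hz1).
split; [exact E1|split; [|split; [|exact E4]]].
- unfold slice_pt.
  transitivity (RtoH (Re z) * h + RtoH (Im z) * (h * K))%H; [Hring|].
  rewrite E2; Hring.
- eapply Rle_trans; [exact E3|]; eapply Rle_trans; [|apply Rle_abs].
  destruct (HM z Hz) as [MA MB].
  apply Rmult_le_compat; [apply Cmod_ge_0| | |].
  + apply Rmult_le_pos; [lra|apply Rplus_le_le_0_compat; apply Hmod_ge0].
  + change (Cmod (/ qphi_den z)%C <= / m).
    rewrite (Cmod_inv (qphi_den z) (qphi_den_nz z Hz1)).
    apply Rinv_le_contravar; [exact m0|exact (Hm z Hz)].
  + apply Rmult_le_compat_l; [lra|].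
    apply Rplus_le_compat; [exact MA|exact MB].
Qed.

(** Each division step is multiplied by h on the left: h b(q) = 1 isolates the coefficient, and h q
    = z_J h, with z_J the point of C_J of coordinate z, moves the factor q to the left, where [lamJ]
    extracts it as z. After m + 1 steps the rest is z^(m+1) times a bounded factor. *)
Lemma qphi_jets J : imag_unit J ->
  has_jets (qphi J) (fun k => lamJ J (sig b d k O)).
Proof.
intros HJ rho m Hr; assert (Hr' : 0 <= rho < 1) by lra.
destruct (qphi_slice J rho HJ Hr') as (Mh & Mh0 & Hq).
destruct (HPSeries_bounded _ rho (conv_ball_sig b d (S m) Hb Hd) Hr') as (M & M0 & HM).
exists (Mh * M); intros z Hz.
destruct (Hq z Hz) as (K & h & HK & E1 & E2 & E3 & E4); cbv zeta in E1, E2, E4.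
set (q := slice_pt K (Re z) (Im z)) in *.
assert (Hqm : Hmod q <= rho).
{ unfold q; rewrite Hmod_slice_pt by easy; destruct z; exact Hz. }
assert (step : forall k, lamJ J (h * HPSeries (sig b d k) q)%H =
  (lamJ J (sig b d k O) + z * lamJ J (h * HPSeries (sig b d (S k)) q)%H)%C).
{ intros k; rewrite HPSeries_sig by (easy || lra).
  rewrite Hmult_plus_r, !Hmult_assoc, E1, E2, Hmult_1_l, lamJ_plus.
  now rewrite <- Hmult_assoc, lamJ_slice. }
assert (Hexp : forall k, qphi J z = (sum_n (fun k => lamJ J (sig b d k O) * z ^ k)%C k
  + z ^ S k * lamJ J (h * HPSeries (sig b d (S k)) q)%H)%C).
{ induction k as [|k IH].
  - rewrite E4, sum_O; change d with (sig b d O) at 1; rewrite step.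
    cbn [Cpow]; ring.
  - rewrite IH, (step (S k)), sum_Sn.
    change (plus (sum_n (fun k => lamJ J (sig b d k O) * z ^ k)%C k)
      (lamJ J (sig b d (S k) O) * z ^ S k)%C) with
      (sum_n (fun k => lamJ J (sig b d k O) * z ^ k)%C k
      + lamJ J (sig b d (S k) O) * z ^ S k)%C.
    rewrite (Cpow_S z (S k)); ring. }
rewrite (Hexp m).
match goal with |- Cmod ?x <= _ => replace x with
  (z ^ S m * lamJ J (h * HPSeries (sig b d (S m)) q)%H)%C by ring end.
rewrite Cmod_mult, Cmod_pow, Rmult_comm.
apply Rmult_le_compat_r; [apply pow_le, Cmod_ge_0|].
eapply Rle_trans; [now apply Cmod_lamJ_le|].
rewrite Hmod_mult; apply Rmult_le_compat; auto using Hmod_ge0.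
Qed.

(** The real part of [lamJ J v] is [hre v] whatever J is, and h is the inverse of the value of b, so
    positivity at q transfers to z. *)
Lemma qphi_pos J z : imag_unit J -> Cmod z < 1 -> 0 <= Re (qphi J z).
Proof.
intros HJ Hz.
destruct (qphi_slice J (Cmod z) HJ (conj (Cmod_ge_0 z) Hz)) as (M & _ & Hq).
destruct (Hq z (Rle_refl _)) as (K & h & HK & E1 & _ & _ & E4); cbv zeta in E1, E4.
rewrite E4; apply Hinv_unique in E1; rewrite <- E1.
apply Rlt_le, bd_pos; rewrite Hmod_slice_pt by easy; destruct z; exact Hz.
Qed.

Lemma lamJ_sig0 J : imag_unit J -> lamJ J (sig b d 0 O) = RtoC 1.
Proof.
intros HJ; cbn [sig]; rewrite d0.
replace (RtoH 1) with (slice_pt J 1 0) by (unfold slice_pt; Hring).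
now apply (lamJ_slice_pt J (RtoC 1)).
Qed.

Lemma Cmod_lamJ_sig_le2 J n : imag_unit J -> (0 < n)%nat ->
  Cmod (lamJ J (sig b d n O)) <= 2.
Proof.
intros HJ Hn.
apply (caratheodory_le2 (qphi J) (fun k => lamJ J (sig b d k O))); try easy.
- intros rho Hr; apply holo_qphi; lra.
- now apply qphi_jets.
- intros z Hz; now apply qphi_pos.
- now apply lamJ_sig0.
Qed.

(** With J chosen so that this coefficient lies in C_J, the projection keeps its modulus. *)
Lemma Hmod_sig_le2 n : (0 < n)%nat -> Hmod (sig b d n O) <= 2.
Proof.
intros Hn; destruct (slice_rep (sig b d n O)) as (J & x & y & HJ & E).
set (z := (x, y) : C); change (sig b d n O = slice_pt J (Re z) (Im z)) in E.
assert (A := Cmod_lamJ_sig_le2 J n HJ Hn).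
rewrite E in A |- *; rewrite lamJ_slice_pt in A by easy.
rewrite Hmod_slice_pt by easy; exact A.
Qed.

(** J is taken from the first coefficient. The extremal case determines the projections of all the
    others to C_J, of modulus 2; as their own moduli are at most 2, they lie in C_J. *)
Lemma sig_extremal : Hmod (sig b d 1 O) = 2 ->
  exists u, Hmod u = 1 /\ forall n, (0 < n)%nat ->
    sig b d n O = (RtoH 2 * pow_n u n)%H.
Proof.
intros H1; destruct (slice_rep (sig b d 1 O)) as (J & x & y & HJ & E).
set (z := (x, y) : C); change (sig b d 1 O = slice_pt J (Re z) (Im z)) in E.
assert (Ez : lamJ J (sig b d 1 O) = z) by (rewrite E; now apply lamJ_slice_pt).
assert (Mz : Cmod z = 2).
{ rewrite <- H1, E, Hmod_slice_pt by easy; easy. }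
set (w := (z / 2)%C).
assert (Mw : Cmod w = 1).
{ unfold w; rewrite Cmod_div, Mz, Cmod_R, Rabs_pos_eq.
  - field.
  - lra.
  - intros Q; injection Q; lra. }
exists (slice_pt J (Re w) (Im w)); split.
{ rewrite Hmod_slice_pt by easy; destruct w; exact Mw. }
intros n Hn; rewrite pow_n_slice_pt by easy.
assert (C : lamJ J (sig b d n O) = (2 * w ^ n)%C).
{ unfold w; rewrite <- Ez.
  apply (caratheodory_extremal (qphi J) (fun k => lamJ J (sig b d k O))); try easy.
  - intros rho Hr; apply holo_qphi; lra.
  - now apply qphi_jets.
  - intros t Ht; now apply qphi_pos.
  - now apply lamJ_sig0.
  - now rewrite Ez. }
rewrite (slice_pt_lamJ J (sig b d n O) HJ).
- rewrite C, re_scal_l, im_scal_l; unfold slice_pt; Hring.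
- rewrite C, Cmod_mult, Cmod_pow, Mw, pow1, Cmod_R, Rabs_pos_eq by lra.
  rewrite Rmult_1_r; now apply Hmod_sig_le2.
Qed.

End SliceQuotient.

(** * The Koebe functions and the coefficient bounds *)

Lemma has_expansion_of_HPSeries f a : conv_ball a ->
  (forall q, in_ball q -> f q = HPSeries a q) -> has_expansion f a.
Proof.
intros Ha E q Hq; rewrite E by easy; now apply conv_ball_has_expansion.
Qed.

Lemma is_series_zero : is_series (fun _ : nat => 0) 0.
Proof.
apply (filterlim_ext (fun _ => 0)); [|apply filterlim_const].
intros n; rewrite sum_n_const; ring.
Qed.

Lemma conv_ball_finite c N : (forall n, (N <= n)%nat -> c n = RtoH 0) -> conv_ball c.
Proof.
intros Hc r Hr; apply (ex_series_incr_n _ N); exists 0.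
apply (is_series_ext (fun _ => 0)); [|exact is_series_zero].
intros n; rewrite Hc by lia; rewrite Hmod_0, Rabs_R0; symmetry; apply Rmult_0_l.
Qed.

Lemma HPSeries_zero c q : (forall n, c n = RtoH 0) -> HPSeries c q = RtoH 0.
Proof.
intros Hc; apply hsum_HSeries, (hsum_ext (fun _ => RtoH 0)).
- intros n; now rewrite Hc, Hmult_0_r.
- repeat split; exact is_series_zero.
Qed.

Lemma HPSeries_deg2 c q : (forall n, (3 <= n)%nat -> c n = RtoH 0) -> Hmod q < 1 ->
  HPSeries c q = (c 0%nat + q * (c 1%nat + q * c 2%nat))%H.
Proof.
intros Hc Hq.
assert (C0 := conv_ball_finite c 3 Hc).
assert (C1 := conv_ball_shift _ C0); assert (C2 := conv_ball_shift _ C1).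
rewrite (HPSeries_shift c q C0 Hq), (HPSeries_shift _ q C1 Hq),
  (HPSeries_shift _ q C2 Hq).
rewrite (HPSeries_zero (fun n => c (S (S (S n))))) by (intros; apply Hc; lia).
now rewrite Hmult_0_r, Hplus_0_r.
Qed.

Lemma sum_n_H_zero (v : nat -> H) n :
  (forall k, (k <= n)%nat -> v k = RtoH 0) -> sum_n v n = RtoH 0.
Proof.
induction n as [|n IH]; intros Hv; [rewrite sum_O; auto|].
rewrite sum_Sn, IH, Hv by auto; apply (Hplus_0_r (RtoH 0)).
Qed.

Lemma sum_n_H_ext (v w : nat -> H) n :
  (forall k, (k <= n)%nat -> v k = w k) -> sum_n v n = sum_n w n.
Proof. intros E; now apply sum_n_ext_loc. Qed.

Lemma sum_n_shift {G : AbelianMonoid} (v : nat -> G) n :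
  sum_n v (S n) = plus (v O) (sum_n (fun k => v (S k)) n).
Proof.
induction n as [|n IH]; [now rewrite sum_Sn, !sum_O|].
now rewrite sum_Sn, IH, sum_Sn, plus_assoc.
Qed.

Section Koebe.

Variable u : H.
Hypothesis u1 : Hmod u = 1.

Let lin (n : nat) : H :=
  match n with 0%nat => RtoH 1 | 1%nat => (- u)%H | _ => RtoH 0 end.

Let fac (p : H) : H := (RtoH 1 - p * u)%H.

Lemma coef_fac : coef fac = lin.
Proof.
apply coefE, has_expansion_of_HPSeries.
- apply (conv_ball_finite _ 2); intros [|[|n]]; easy || lia.
- intros q Hq; rewrite HPSeries_deg2; [|intros [|[|[|n]]]; easy || lia|exact Hq].
  unfold fac; cbn [lin]; hring.
Qed.

Lemma reg_conj_fac q : in_ball q -> reg_conj fac q = (RtoH 1 - q * Hconj u)%H.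
Proof.
intros Hq; unfold reg_conj; rewrite coef_fac, HPSeries_deg2; [|intros|exact Hq].
- cbn [lin]; hring.
- destruct n as [|[|n]]; try lia; cbn [lin]; hring.
Qed.

Lemma coef_reg_conj_fac : coef (reg_conj fac) = fun n => Hconj (lin n).
Proof.
apply coefE, has_expansion_of_HPSeries.
- apply (conv_ball_finite _ 2); intros [|[|n]]; try lia; intros _; cbn [lin]; hring.
- intros q Hq; unfold reg_conj; now rewrite coef_fac.
Qed.

Lemma symmetrization_fac q : in_ball q ->
  symmetrization fac q = (RtoH 1 + q * (RtoH (- 2 * hre u) + q))%H.
Proof.
intros Hq; unfold symmetrization, reg_mult; rewrite coef_fac, coef_reg_conj_fac.
rewrite HPSeries_deg2; [|intros|exact Hq].
- rewrite !sum_Sn, !sum_O; cbn [lin Nat.sub].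
  repeat change (plus ?x ?y) with (Hplus x y).
  assert (U : (u * Hconj u)%H = RtoH 1).
  { transitivity (RtoH (Hnorm2 u)); [Hring|rewrite <- Hmod_sq, u1; f_equal; ring]. }
  transitivity (RtoH 1 + q * (RtoH (- 2 * hre u) + q * (u * Hconj u)))%H; [|rewrite U].
  + Hring.
  + Hring.
- apply sum_n_H_zero; intros k Hk.
  destruct k as [|[|k]].
  + destruct n as [|[|n]]; try lia; cbn [lin Nat.sub]; hring.
  + destruct n as [|[|[|n]]]; try lia; cbn [lin Nat.sub]; hring.
  + cbn [lin]; apply Hmult_0_l.
Qed.

(** The zeros of 1 - 2 Re(u) q + q^2 form the sphere of real part Re(u) and modulus 1, which the
    open ball does not meet. *)
Lemma symmetrization_fac_nz q : in_ball q -> symmetrization fac q <> RtoH 0.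
Proof.
intros Hq; rewrite symmetrization_fac by easy; intros E.
assert (c1 : hre u ^ 2 <= 1).
{ assert (A := hre_le u); rewrite u1 in A; apply Rabs_le_between in A; nra. }
assert (q1 : Hnorm2 q < 1).
{ rewrite <- Hmod_sq; assert (A := Hmod_ge0 q); unfold in_ball in Hq; nra. }
unfold Hnorm2 in q1.
assert (E0 := f_equal hre E); assert (E1 := f_equal him1 E);
assert (E2 := f_equal him2 E); assert (E3 := f_equal him3 E).
autorewrite with quat in E0, E1, E2, E3.
revert c1 q1 E0 E1 E2 E3.
generalize (hre u) (hre q) (him1 q) (him2 q) (him3 q).
intros c x y1 y2 y3 c1 q1 E0 E1 E2 E3.
destruct (Req_dec x c) as [->|N]; [nra|].
assert (y1 = 0) by (apply Rmult_eq_reg_l with (x - c); nra).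
assert (y2 = 0) by (apply Rmult_eq_reg_l with (x - c); nra).
assert (y3 = 0) by (apply Rmult_eq_reg_l with (x - c); nra).
subst; assert (0 < (x - c) ^ 2) by (apply pow2_gt_0; lra); nra.
Qed.

Lemma conv_disc_1 : conv_disc (fun _ => 1).
Proof.
intros r Hr; apply (ex_series_ext (fun n => r ^ n)).
- intros n; rewrite Rabs_R1; symmetry; apply Rmult_1_l.
- exists (/ (1 - r)); apply is_series_geom; rewrite Rabs_pos_eq; lra.
Qed.

Lemma Hmod_pow_u n : Hmod (pow_n u n) = 1.
Proof. rewrite Hmod_pow, u1; apply pow1. Qed.

Lemma conv_ball_pow : conv_ball (pow_n u).
Proof.
generalize conv_disc_1; apply conv_disc_dom; intros n.
rewrite Hmod_pow_u, Rabs_R1; lra.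
Qed.

Lemma pow_u_comm n : (pow_n u n * u)%H = (u * pow_n u n)%H.
Proof. exact (pow_n_comm_1 (K := H_Ring) u n). Qed.

(** The geometric series T satisfies T - q T u = 1. Writing the real number 2 Re(u) as u + conj(u)
    to the right of T factors the symmetrization times T as (T - q T u) - q (T - q T u) conj(u),
    that is 1 - q conj(u). *)
Lemma reg_recip_fac q : in_ball q -> reg_recip fac q = HPSeries (pow_n u) q.
Proof.
intros Hq; unfold reg_recip.
assert (Hnz := symmetrization_fac_nz q Hq).
assert (ET : HPSeries (pow_n u) q = (RtoH 1 + q * HPSeries (pow_n u) q * u)%H).
{ rewrite (HPSeries_shift _ q conv_ball_pow Hq) at 1; f_equal.
  rewrite <- Hmult_assoc; f_equal.
  rewrite <- HPSeries_rmul by (exact conv_ball_pow || exact Hq).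
  unfold HPSeries; f_equal; apply FunctionalExtensionality.functional_extensionality.
  intros n; rewrite pow_u_comm; easy. }
set (T := HPSeries (pow_n u) q) in *.
assert (E : (symmetrization fac q * T)%H = reg_conj fac q).
{ rewrite symmetrization_fac, reg_conj_fac by easy.
  assert (U : (u * Hconj u)%H = RtoH 1).
  { transitivity (RtoH (Hnorm2 u)); [Hring|rewrite <- Hmod_sq, u1; f_equal; ring]. }
  assert (U2 : RtoH (- 2 * hre u) = (- u - Hconj u)%H) by Hring.
  assert (comm : (RtoH (- 2 * hre u) * T)%H = (T * (- u - Hconj u))%H)
    by (rewrite <- U2; Hring).
  assert (ED : (T - q * T * u)%H = RtoH 1).
  { rewrite ET at 1; Hring. }
  transitivity ((T - q * T * u) - q * ((T - q * T * u) * Hconj u))%H.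
  - transitivity (T + q * (RtoH (- 2 * hre u) * T) + q * (q * T * RtoH 1))%H; [Hring|].
    rewrite comm, <- U; Hring.
  - rewrite ED, Hmult_1_l; easy. }
rewrite <- E, Hmult_assoc, Hinv_l by easy; apply Hmult_1_l.
Qed.

Lemma coef_reg_recip_fac : coef (reg_recip fac) = pow_n u.
Proof.
apply coefE, has_expansion_of_HPSeries; [exact conv_ball_pow|exact reg_recip_fac].
Qed.

(** At n = 0 the truncated [pred] is harmless, as the scalar factor is 0. *)
Definition koebe_coef (n : nat) : H := (RtoH (INR n) * pow_n u (pred n))%H.

Lemma Hmod_koebe_coef n : Hmod (koebe_coef n) = INR n.
Proof.
unfold koebe_coef; rewrite Hmod_mult, Hmod_RtoH, Hmod_pow_u, Rabs_pos_eq, Rmult_1_r;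
  auto using pos_INR.
Qed.

Lemma conv_ball_koebe_coef : conv_ball koebe_coef.
Proof.
generalize (conv_disc_derive _ conv_disc_1); apply conv_disc_dom; intros n.
rewrite Rabs_pos_eq, Hmod_koebe_coef by apply Hmod_ge0.
unfold PS_derive; rewrite S_INR; lra.
Qed.

Lemma slice_koebe_expansion : has_expansion (slice_koebe u) koebe_coef.
Proof.
apply has_expansion_of_HPSeries; [exact conv_ball_koebe_coef|]; intros q Hq.
rewrite HPSeries_shift by (exact conv_ball_koebe_coef || exact Hq).
replace (koebe_coef 0) with (RtoH 0) by (unfold koebe_coef; cbn [INR]; Hring).
rewrite (Hplus_comm (RtoH 0)), Hplus_0_r.
unfold slice_koebe; cbv zeta; f_equal; unfold reg_mult.
change (fun p => (RtoH 1 - p * u)%H) with fac; rewrite coef_reg_recip_fac.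
unfold HPSeries; f_equal; apply FunctionalExtensionality.functional_extensionality.
intros n; f_equal; unfold koebe_coef; cbn [pred].
rewrite (sum_n_H_ext _ (fun _ => pow_n u n)).
- assert (G : forall m, sum_n (fun _ => pow_n u n) m
      = (RtoH (INR (S m)) * pow_n u n)%H).
  { induction m as [|m IH].
    - rewrite sum_O; symmetry; apply Hmult_1_l.
    - rewrite sum_Sn, IH, (S_INR (S m)).
      change ((RtoH (INR (S m)) * pow_n u n + pow_n u n)%H =
        (RtoH (INR (S m) + 1) * pow_n u n)%H); Hring. }
  apply G.
- intros k Hk; assert (P := pow_n_plus (K := H_Ring) u k (n - k)).
  change (mult ?x ?y) with (Hmult x y) in P.
  rewrite <- P; f_equal; lia.
Qed.

End Koebe.

(** * From the quotient back to the coefficients *)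

Lemma sig_expand b d m n :
  d (S m + n)%nat = (sig b d (S m) n
    + sum_n (fun k => b (S m + n - k)%nat * sig b d k O)%H m)%H.
Proof.
revert n; induction m as [|m IH]; intros n.
- rewrite sum_O; cbn [sig Nat.add Nat.sub]; Hring.
- replace (S (S m) + n)%nat with (S m + S n)%nat by lia.
  rewrite IH, sum_Sn.
  change (sig b d (S (S m)) n) with (sig b d (S m) (S n) - b (S n) * sig b d (S m) O)%H.
  replace (S m + S n - S m)%nat with (S n) by lia.
  generalize (sum_n (fun k => (b (S m + S n - k)%nat * sig b d k O)%H) m).
  intros s; change (plus s ?x) with (s + x)%H; Hring.
Qed.

(** At n = 0 the remainder left in [sig_expand] is itself the next quotient coefficient, and b 0 = 1
    makes it the last term of the convolution. *)
Lemma sig_recurrence b d m : b O = RtoH 1 ->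
  d m = sum_n (fun k => b (m - k)%nat * sig b d k O)%H m.
Proof.
intros b0; destruct m as [|m].
- rewrite sum_O; cbn [Nat.sub sig]; rewrite b0; symmetry; apply Hmult_1_l.
- assert (E := sig_expand b d m 0); rewrite Nat.add_0_r in E.
  rewrite E at 1; rewrite sum_Sn, Nat.sub_diag, b0.
  rewrite Hmult_1_l; apply Hplus_comm.
Qed.

Lemma Hmod_sum_n (v : nat -> H) n : Hmod (sum_n v n) <= sum_n (fun k => Hmod (v k)) n.
Proof.
induction n as [|n IH]; [rewrite !sum_O; lra|].
rewrite !sum_Sn; eapply Rle_trans; [apply Hmod_triangle|].
change (Hmod (sum_n v n) + Hmod (v (S n)) <=
  sum_n (fun k => Hmod (v k)) n + Hmod (v (S n))); lra.
Qed.

(** This is the majorant of the recurrence. Divided by m + 1 it leaves m + 2, so the inductive bound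
    reproduces itself with no slack, which makes the equality case rigid. *)
Lemma sum_n_rev_INR m :
  sum_n (fun k => INR (S (m - k)) * 2) m = INR (S m) * INR (S (S m)).
Proof.
induction m as [|m IH]; [rewrite sum_O; cbn; ring|].
rewrite sum_n_shift; cbn [Nat.sub]; rewrite IH, !S_INR; unfold plus; cbn; ring.
Qed.

Lemma sum_n_ge_head (z : nat -> R) n : (forall k, (k <= n)%nat -> 0 <= z k) ->
  z O <= sum_n z n.
Proof.
induction n as [|n IH]; intros Hz; [rewrite sum_O; lra|].
rewrite sum_Sn; specialize (IH ltac:(auto)); specialize (Hz (S n) (le_n _)).
change (z O <= sum_n z n + z (S n)); lra.
Qed.

Section Coefficients.

Variables b p : nat -> H.
Hypothesis b0 : b O = RtoH 1.
Hypothesis rec : forall m,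
  (RtoH (INR (S m)) * b (S m))%H = sum_n (fun k => b (m - k)%nat * p (S k))%H m.
Hypothesis p_le2 : forall k, Hmod (p (S k)) <= 2.

Lemma Hmod_rec m : INR (S m) * Hmod (b (S m))
  <= sum_n (fun k => Hmod (b (m - k)%nat * p (S k))%H) m.
Proof.
rewrite <- (Rabs_pos_eq (INR (S m))) by apply pos_INR.
rewrite <- Hmod_RtoH, <- Hmod_mult, rec; apply Hmod_sum_n.
Qed.

Lemma Hmod_coef_le n : Hmod (b n) <= INR (S n).
Proof.
induction n as [n IH] using (well_founded_induction Nat.lt_wf_0).
destruct n as [|m]; [rewrite b0, Hmod_1; cbn; lra|].
apply Rmult_le_reg_l with (INR (S m)); [apply INR_S_pos|].
eapply Rle_trans; [apply Hmod_rec|].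
rewrite <- sum_n_rev_INR; apply sum_n_m_le; intros k; rewrite Hmod_mult.
apply Rmult_le_compat; auto using Hmod_ge0; apply IH; lia.
Qed.

(** Equality at one index makes every slack in the majorant vanish. The slack of the term k = 0
    compares |b_m| |p_1| with 2 (m + 1), and |b_m| <= m + 1 forces |p_1| = 2. *)
Lemma Hmod_coef_eq m : Hmod (b (S m)) = INR (S (S m)) -> Hmod (p 1%nat) = 2.
Proof.
intros Hm; apply Rle_antisym; [apply p_le2|].
set (z := fun k => INR (S (m - k)) * 2 - Hmod (b (m - k)%nat * p (S k))%H).
assert (Hz : forall k, 0 <= z k).
{ intros k; unfold z; rewrite Hmod_mult.
  assert (Hmod (b (m - k)%nat) * Hmod (p (S k)) <= INR (S (m - k)) * 2); [|lra].
  apply Rmult_le_compat; auto using Hmod_ge0, Hmod_coef_le. }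
assert (Hs : sum_n z m <= 0).
{ assert (E : forall n, sum_n z n = sum_n (fun k => INR (S (m - k)) * 2) n
    - sum_n (fun k => Hmod (b (m - k)%nat * p (S k))%H) n).
  { induction n as [|n IH].
    - rewrite !sum_O; easy.
    - rewrite !sum_Sn, IH; unfold z, plus; cbn; ring. }
  assert (A := Hmod_rec m); rewrite Hm, <- sum_n_rev_INR in A; rewrite E; lra. }
assert (A := sum_n_ge_head z m (fun k _ => Hz k)).
unfold z in A at 1; rewrite Nat.sub_0_r, Hmod_mult in A.
assert (B := Hmod_coef_le m); assert (s0 := INR_S_pos m).
assert (P := Hmod_ge0 (b m)); assert (Q := Hmod_ge0 (p 1%nat)); nra.
Qed.

Lemma coef_extremal u : (forall k, p (S k) = (RtoH 2 * pow_n u (S k))%H) ->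
  forall n, b n = koebe_coef u (S n).
Proof.
intros Hp n; induction n as [n IH] using (well_founded_induction Nat.lt_wf_0).
destruct n as [|m].
{ rewrite b0; unfold koebe_coef; cbn [pred pow_n INR]; symmetry; apply Hmult_1_l. }
assert (s0 := INR_S_pos m).
assert (E := rec m).
rewrite (sum_n_H_ext _ (fun k => RtoH (INR (S (m - k)) * 2) * pow_n u (S m))%H) in E.
- assert (G : forall (c : nat -> R) n, sum_n (fun k => RtoH (c k) * pow_n u (S m))%H n
    = (RtoH (sum_n c n) * pow_n u (S m))%H).
  { intros c n; induction n as [|n IHn]; [now rewrite !sum_O|].
    rewrite !sum_Sn, IHn.
    change (RtoH (sum_n c n) * pow_n u (S m) + RtoH (c (S n)) * pow_n u (S m) =
      RtoH (sum_n c n + c (S n)) * pow_n u (S m))%H; Hring. }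
  rewrite G, sum_n_rev_INR in E.
  transitivity (RtoH (/ INR (S m)) * (RtoH (INR (S m)) * b (S m)))%H.
  + transitivity (RtoH (/ INR (S m) * INR (S m)) * b (S m))%H; [|Hring].
    rewrite Rinv_l by lra; symmetry; apply Hmult_1_l.
  + rewrite E; unfold koebe_coef; cbn [pred].
    transitivity (RtoH (/ INR (S m) * INR (S m)) * (RtoH (INR (S (S m))) * pow_n u (S m)))%H;
      [Hring|rewrite Rinv_l by lra; apply Hmult_1_l].
- intros k Hk; rewrite IH, Hp by lia; unfold koebe_coef; cbn [pred].
  assert (P := pow_n_plus (K := H_Ring) u (m - k) (S k)).
  change (mult ?x ?y) with (Hmult x y) in P.
  replace (m - k + S k)%nat with (S m) in P by lia; rewrite P.
  generalize (pow_n u (m - k)) (pow_n u (S k)); intros v w.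
  change (RtoH (INR (S (m - k))) * v * (RtoH 2 * w) =
    RtoH (INR (S (m - k)) * 2) * (v * w))%H; Hring.
Qed.

End Coefficients.

Theorem theorem1p1 (f : H -> H) (a : nat -> H)
  (a0 : a 0%nat = RtoH 0) (a1 : a 1%nat = RtoH 1)
  (fa : has_expansion f a)
  (f_starlike : slice_starlike f) :
  (forall n : nat, (2 <= n)%nat -> Hmod (a n) <= INR n) /\
  (forall n : nat, (2 <= n)%nat ->
     (Hmod (a n) = INR n <->
      exists u : H, Hmod u = 1 /\
        forall q : H, in_ball q -> f q = slice_koebe u q)).
Proof.
destruct f_starlike as [[f_reg [f_zero _]] f_pos].
assert (Ha := has_expansion_conv_ball f a fa).
(* Dividing f and q f' by q gives series with constant term 1, whose quotient is unchanged; the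
   bound n for a_n becomes n + 1 for b_n. *)
set (b := fun n => a (S n)); set (d := hderiv a).
assert (Hb : conv_ball b) by now apply conv_ball_shift.
assert (Hd : conv_ball d) by now apply conv_ball_hderiv.
assert (b0 : b O = RtoH 1) by exact a1.
assert (d0 : d O = RtoH 1) by (unfold d, hderiv; rewrite a1; apply Hmult_1_l).
assert (at0 : forall c, conv_ball c -> HPSeries c (RtoH 0) = c O).
{ intros c Hc; rewrite HPSeries_shift, Hmult_0_l; [apply Hplus_0_r|easy|].
  rewrite Hmod_0; lra. }
assert (fE : forall q, Hmod q < 1 -> f q = (q * HPSeries b q)%H).
{ intros q Hq; rewrite (has_expansion_HPSeries f a) by easy.
  rewrite HPSeries_shift, a0, (Hplus_comm (RtoH 0)) by easy; apply Hplus_0_r. }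
assert (b_nz : forall q, Hmod q < 1 -> HPSeries b q <> RtoH 0).
{ intros q Hq Z; apply H1_neq0.
  assert (q0 : q = RtoH 0) by (apply f_zero; [exact Hq|]; rewrite fE, Z, Hmult_0_r; easy).
  rewrite <- Z, q0, at0 by easy; symmetry; exact b0. }
assert (bd_pos : forall q, Hmod q < 1 -> 0 < hre (/ HPSeries b q * HPSeries d q)%H).
(* Starlikeness says nothing at the origin, where both series take the value 1; elsewhere f^-1 q f'
   = b^-1 q^-1 q f' and the factor q cancels. *)
{ intros q Hq; destruct (Req_dec (Hmod q) 0) as [E|N'].
  - apply Hmod_eq0 in E; subst q; rewrite !at0, b0, d0 by easy.
    rewrite (Hinv_unique (RtoH 1)), Hmult_1_l by apply Hmult_1_l; cbn; lra.
  - assert (N : q <> RtoH 0) by (intros E; apply N'; rewrite E; apply Hmod_0).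
    assert (P := f_pos q Hq N).
    rewrite (slice_deriv_HPSeries f a), fE in P by easy.
    rewrite (Hinv_unique (/ HPSeries b q * / q)%H) in P.
    + rewrite <- (Hmult_assoc _ (/ q)%H q), Hinv_l, Hmult_1_r in P by easy; exact P.
    + rewrite <- Hmult_assoc, (Hmult_assoc (/ q)%H q), Hinv_l, Hmult_1_l by easy.
      apply Hinv_l; auto. }
set (p := fun n => sig b d n O).
(* The term k = 0 of the convolution is b (m+1) itself, since p_0 = 1; moving it to the left lowers
   the factor m + 2 of f' to m + 1. *)
assert (rec : forall m, (RtoH (INR (S m)) * b (S m))%H
  = sum_n (fun k => b (m - k)%nat * p (S k))%H m).
{ intros m; assert (E := sig_recurrence b d (S m) b0).
  rewrite sum_n_shift in E; cbn [Nat.sub sig] in E; rewrite d0, Hmult_1_r in E.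
  unfold d at 1, hderiv in E; rewrite (S_INR (S m)) in E.
  change (a (S (S m))) with (b (S m)) in E.
  match type of E with _ = plus _ ?s => set (S0 := s : H) in E end.
  change ((RtoH (INR (S m)) * b (S m))%H = S0); clearbody S0.
  change (plus (b (S m)) S0) with (b (S m) + S0)%H in E.
  transitivity (RtoH (INR (S m) + 1) * b (S m) - b (S m))%H; [Hring|].
  rewrite E; Hring. }
assert (p_le2 : forall k, Hmod (p (S k)) <= 2).
{ intros k; apply (Hmod_sig_le2 b d); auto; lia. }
split.
- intros [|n] Hn; [lia|]; now apply (Hmod_coef_le b p).
- intros n Hn; split.
  + intros En; destruct n as [|[|m]]; [lia|lia|].
    assert (p1 := Hmod_coef_eq b p b0 rec p_le2 m En).
    destruct (sig_extremal b d Hb Hd b0 d0 b_nz bd_pos p1) as (u & u1 & Hu).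
    exists u; split; [exact u1|]; intros q Hq.
    assert (Eb := coef_extremal b p b0 rec u (fun k => Hu (S k) (Nat.lt_0_succ k))).
    assert (Ea : a = koebe_coef u).
    { apply FunctionalExtensionality.functional_extensionality; intros [|k].
      - rewrite a0; unfold koebe_coef; cbn [INR]; Hring.
      - apply Eb. }
    rewrite (has_expansion_HPSeries f a), Ea by easy; symmetry.
    apply has_expansion_HPSeries; [now apply slice_koebe_expansion|exact Hq].
  + intros (u & u1 & Hu).
    assert (E : a = koebe_coef u).
    { apply (has_expansion_unique f); [exact fa|].
      intros q Hq; rewrite Hu by easy; now apply slice_koebe_expansion. }
    rewrite E; now apply Hmod_koebe_coef.
Qed.
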